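(* Suppose there are two different symmetries with center at $x$ on a torsion-free conformal geometry of arbitrary signature $(p,q)$, $p+q\ge3$, and denote by $\Upsilon$ their difference. Suppose that $\Upsilon$ has nonzero length at $x$. Then the curvature $\kappa$ vanishes at $x$.
   Context: Conformal geometry of signature $(p,q)$: Let $J=\mathrm{diag}(E_p,-E_q)$ ($E_n$ the identity matrix), let $S=\left(\begin{smallmatrix}0&0&1\\0&J&0\\1&0&0\end{smallmatrix}\right)$, let $G=O(p+1,q+1)$ be the orthogonal group of $S$, with Lie algebra $$\mathfrak g=\left\{\left(\begin{smallmatrix}a&Z&0\\ X&A&-JZ^T\\0&-X^TJ&-a\end{smallmatrix}\right): a\in\mathbb R,\ X,Z^T\in\mathbb R^{p+q},\ A\in\mathfrak o(p,q)\right\}=\mathfrak g_{-1}\oplus\mathfrak g_0\oplus\mathfrak g_1$$ (the components given by $X$; by $(a,A)$; by $Z$). $G_0\subset G$ is the subgroup of block diagonal matrices $\mathrm{diag}(\lambda,C,\lambda^{-1})$, $\lambda\in\mathbb R\setminus\{0\}$, $C\in O(p,q)$, and $P=G_0\ltimes\exp\mathfrak g_1$; $\mathfrak p=\mathfrak g_0\oplus\mathfrak g_1$. A conformal geometry is a Cartan geometry of type $(G,P)$ on a smooth manifold $M$: a principal $P$-bundle $\mathcal G\to M$ (projection $\mathrm{pr}$) with $\omega\in\Omega^1(\mathcal G,\mathfrak g)$ satisfying $(r^h)^*\omega=\mathrm{Ad}_{h^{-1}}\circ\omega$ for $h\in P$, $\omega(\zeta_X)=X$ for fundamental vector fields, $X\in\mathfrak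 p$, and $\omega(u):T_u\mathcal G\to\mathfrak g$ a linear isomorphism. With $\omega^{-1}(X)$ the vector field satisfying $\omega(\omega^{-1}(X))=X$, the curvature is $\kappa(u)(X,Y)=[X,Y]-\omega([\omega^{-1}(X),\omega^{-1}(Y)](u))$, $X,Y\in\mathfrak g_{-1}$. Torsion free means $\kappa$ takes values in $\mathfrak p$. ''$\kappa$ vanishes at $x$'' means $\kappa(u)=0$ for all $u$ over $x$. A (locally defined) automorphism is a principal bundle isomorphism $\varphi$ between restrictions of $\mathcal G$ to open subsets of $M$ with $\varphi^*\omega=\omega$; $\underline\varphi$ is its base map. A (local) symmetry with center at $x$ is a locally defined diffeomorphism $s_x$ of $M$ near $x$ with $s_x(x)=x$, $T_xs_x=-\mathrm{id}$, which near $x$ equals $\underline\varphi$ for some automorphism $\varphi$ ($\varphi$ covers $s_x$). Two symmetries at $x$ are different if they do not agree on any neighborhood of $x$. A Weyl structure is a smooth $G_0$-equivariant section $\sigma$ of $\mathcal G\to\mathcal G_0=\mathcal G/\exp\mathfrak g_1$. For two Weyl structures $\hat\sigma(v)=\sigma(v)\exp\Upsilon(v)$ for a unique $G_0$-equivariant $\Upsilon:\mathcal G_0\to\mathfrak g_1$, equivalently a 1-form on $M$ (section of $T^*M\simeq\mathcal G\times_P\mathfrak g_1$); write $\hat\sigma=\sigma+\Upsilon$. Pullback: $\varphi^*\sigma=\varphi^{-1}\circ\sigma\circ\varphi_0$, with $\varphi_0$ induced by $\varphi$ on $\mathcal G_0$. Difference: for two different symmetries at $x$ covered by $\varphi$ and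 $\psi$, choose $\sigma$ with $\varphi^*\sigma=\sigma$ on the fiber of $\mathcal G_0$ over $x$ (it exists and is unique along this fiber) and define $\Upsilon$ by $\psi^*\sigma=\sigma+\Upsilon$; its value at $x$ is nonzero and independent of the coverings, and is called the difference of the symmetries (the order of the two plays no role). If $\Upsilon(x)$ is represented in a frame $u$ over $x$ by the row vector $V\in\mathbb R^{p+q*}$ (element of $\mathfrak g_1$ with $Z=V$), then $\Upsilon$ has nonzero length at $x$ if $VJV^T\ne0$ (independent of $u$). *)

(* Defs.v *)
From HB Require Import structures.
From mathcomp Require Import all_boot all_order all_algebra.
From mathcomp Require Import all_classical all_reals all_analysis.

Set Implicit Arguments.
Unset Strict Implicit.
Unset Printing Implicit Defensive.

Import Order.TTheory GRing.Theory Num.Theory.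
Import numFieldNormedType.Exports.

Local Open Scope classical_set_scope.
Local Open Scope ring_scope.

Section Smooth.
Variable R : realType.
Implicit Types E F : normedModType R.

(* [U] is meant to be open and [E] finite-dimensional. *)
Fixpoint Ck_on E F (k : nat) (U : set E) (f : E -> F) : Prop :=
  match k with
  | 0%N => forall x, U x -> {for x, continuous f}
  | k'.+1 => (forall x, U x -> differentiable f x) /\
             (forall v, Ck_on k' U ('D_v f))
  end.

Definition smooth_on E F (U : set E) (f : E -> F) : Prop :=
  forall k, Ck_on k U f.

(* The maps [cmap] and [cinv] are total_space; their values are relevant only on
   [cdom] and on [cmap @` cdom]. *)
Record chart (M : topologicalType) (E : normedModType R) := Chart {
  cdom : set M;
  cmap : M -> E;
  cinv : E -> M
}.

Record charted (E : normedModType R) := Charted {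
  cspace :> topologicalType;
  atlas : set (chart cspace E)
}.
Arguments atlas {E} _.

Definition is_chart (M : topologicalType) E (c : chart M E) : Prop :=
  [/\ open (cdom c), open (cmap c @` cdom c),
      forall x, cdom c x -> cinv c (cmap c x) = x,
      forall x, cdom c x -> {for x, continuous (cmap c)}
    & forall y, (cmap c @` cdom c) y -> {for y, continuous (cinv c)}].

Definition compatible (M : topologicalType) E (c d : chart M E) : Prop :=
  smooth_on (cmap c @` (cdom c `&` cdom d)) (cmap d \o cinv c).

Definition is_manifold E (M : charted E) : Prop :=
  [/\ hausdorff_space M, @second_countable M,
      forall c, atlas M c -> is_chart c,
      forall x : M, exists2 c, atlas M c & cdom c x
    & forall c d, atlas M c -> atlas M d -> compatible c d].

Record manifold (n : nat) := Manifold {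
  mcharted :> charted 'rV[R]_n;
  manifoldP : is_manifold mcharted
}.

Definition vect E : charted E := @Charted E E [set Chart setT id id].

Definition prodm E F (M : charted E) (N : charted F) : charted (E * F)%type :=
  @Charted (E * F)%type (M * N)%type
    [set c | exists a b, [/\ atlas M a, atlas N b &
       c = Chart (cdom a `*` cdom b)
                 (fun z => (cmap a z.1, cmap b z.2))
                 (fun z => (cinv a z.1, cinv b z.2))]].

(* Smoothness on some neighbourhood of [x]. *)
Definition smooth_at E F (M : charted E) (N : charted F) (f : M -> N) (x : M)
    : Prop :=
  {for x, continuous f} /\
  forall c d, atlas M c -> atlas N d -> cdom c x -> cdom d (f x) ->
    exists U : set E, [/\ open U, U (cmap c x) &
                          smooth_on U (cmap d \o f \o cinv c)].

(* Smoothness of a map defined on an arbitrary subset: local existence of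
   smooth extensions.  It is used only for [A] an embedded submanifold, where
   it is smoothness for the submanifold structure. *)
Definition smooth_within E F (M : charted E) (N : charted F)
    (A : set M) (f : M -> N) : Prop :=
  forall a, A a ->
    exists g : M -> N, smooth_at g a /\ (\forall b \near a, A b -> g b = f b).

(* A tangent vector at [u] is the directional derivative it defines on the
   functions that are smooth near [u]; a functional is normalized to be 0 on
   the other functions, so that equality of functionals is equality of tangent
   vectors. *)
Definition functional E (M : charted E) := (M -> R) -> R.

Definition smoothR_at E (M : charted E) (f : M -> R) (u : M) : Prop :=
  @smooth_at E R M (vect R) f u.

Definition germ_only E (M : charted E) (u : M) (delta : functional M)
    : functional M :=
  fun f => if `[< smoothR_at f u >] then delta f else 0.

Definition tangent E (M : charted E) (u : M) : set (functional M) :=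
  [set delta | exists c v, [/\ atlas M c, cdom c u &
     delta = germ_only u (fun f => 'D_v (f \o cinv c) (cmap c u))]].

Definition pushforward E F (M : charted E) (N : charted F) (f : M -> N)
    (u : M) (delta : functional M) : functional N :=
  germ_only (f u) (fun g => delta (g \o f)).

Definition is_vector_field E (M : charted E) (O : set M)
    (xi : M -> functional M) : Prop :=
  [/\ open O, forall u, O u -> tangent u (xi u)
    & forall u f, O u -> smoothR_at f u -> smoothR_at (fun w => xi w f) u].

Definition lie_bracket E (M : charted E) (xi eta : M -> functional M) (u : M)
    : functional M :=
  germ_only u (fun f => xi u (fun w => eta w f) - eta u (fun w => xi w f)).

Definition local_diffeo_near E (M : charted E) (s : M -> M) (x : M) : Prop :=
  exists (U V : set M) (s' : M -> M),
    [/\ open U, open V, U x,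
        forall y, U y -> [/\ V (s y), s' (s y) = y & smooth_at s y]
      & forall y, V y -> [/\ U (s' y), s (s' y) = y & smooth_at s' y]].

End Smooth.

Section Model.
Variables (R : realType) (p q : nat).

Definition Jpq : 'M[R]_(p + q) := block_mx 1%:M 0 0 (- 1%:M).

Notation Mat := 'M[R]_(1 + (p + q + 1)).

Definition mx3 (a : R) (Z : 'rV[R]_(p + q)) (b : R)
    (X : 'cV[R]_(p + q)) (A : 'M[R]_(p + q)) (Y : 'cV[R]_(p + q))
    (c : R) (W : 'rV[R]_(p + q)) (d : R) : Mat :=
  block_mx a%:M (row_mx Z b%:M)
           (col_mx X c%:M) (block_mx A Y W d%:M).

Definition mexp (A : Mat) : Mat :=
  lim (series (fun k : nat => k`!%:R^-1 *: A ^+ k) @ \oo).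

Definition o_pq (A : 'M[R]_(p + q)) : Prop := A^T *m Jpq + Jpq *m A = 0.

Definition O_pq (C : 'M[R]_(p + q)) : Prop := C^T *m Jpq *m C = Jpq.

Definition gmx (a : R) (X : 'cV[R]_(p + q)) (A : 'M[R]_(p + q))
    (Z : 'rV[R]_(p + q)) : Mat :=
  mx3 a Z               0
      X A               (- (Jpq *m Z^T))
      0 (- (X^T *m Jpq))  (- a).

Definition lie_g : set Mat :=
  [set B | exists a X A Z, o_pq A /\ B = gmx a X A Z].

Definition lie_p : set Mat :=
  [set B | exists a A Z, o_pq A /\ B = gmx a 0 A Z].

Definition gm1 (X : 'cV[R]_(p + q)) : Mat := gmx 0 X 0 0.
Definition g1 (Z : 'rV[R]_(p + q)) : Mat := gmx 0 0 0 Z.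

Definition G0mat : set Mat :=
  [set h | exists lambda C, [/\ lambda != 0, O_pq C &
     h = mx3 lambda 0 0
             0      C 0
             0      0 lambda^-1]].

Definition Pmat : set Mat :=
  [set h | exists g Z, G0mat g /\ h = g *m mexp (g1 Z)].

Definition brk (A B : Mat) : Mat := A *m B - B *m A.

Definition Ad_inv (h B : Mat) : Mat := invmx h *m B *m h.

End Model.

Section Cartan.
Variables (R : realType) (p q : nat).

Notation Mat := 'M[R]_(1 + (p + q + 1)).
Notation matm := (vect Mat).

Section BundleAndConnection.
Variables (m d : nat) (M : manifold R m) (T : manifold R d).
Variables (pr : T -> M) (act : T -> Mat -> T).
Variable omega : forall u : T, functional T -> Mat.

(* [triv] is the P-component of a local trivialization
   pr^-1(U) -> U x P, and [untriv] is the inverse of that trivialization. *)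
Definition locally_trivial_at (x : M) : Prop :=
  exists (U : set M) (triv : T -> Mat) (untriv : M * Mat -> T),
    [/\ open U /\ U x,
        forall u, U (pr u) ->
          [/\ @Pmat R p q (triv u), untriv (pr u, triv u) = u
            & @smooth_at _ _ _ T matm triv u],
        forall u h, U (pr u) -> @Pmat R p q h ->
          triv (act u h) = triv u *m h,
        forall y h, U y -> @Pmat R p q h ->
          pr (untriv (y, h)) = y /\ triv (untriv (y, h)) = h
      & @smooth_within _ _ _ (prodm M matm) T (U `*` @Pmat R p q) untriv].

(* Only the values [act u h] with [h] in P are relevant. *)
Definition is_principal_bundle : Prop :=
  [/\ forall u, act u 1%:M = u /\
        forall g h, @Pmat R p q g -> @Pmat R p q h ->
          act (act u g) h = act u (g *m h),
      forall u h, @Pmat R p q h -> pr (act u h) = pr u,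
      forall u, smooth_at pr u,
      @smooth_within _ _ _ (prodm T matm) T (setT `*` @Pmat R p q)
        (fun z => act z.1 z.2)
    & forall x, locally_trivial_at x].

Definition fundamental_field (B : Mat) (u : T) : functional T :=
  germ_only u (fun f => derive1 (fun t : R => f (act u (mexp (t *: B)))) 0).

Definition is_cartan_connection : Prop :=
  [/\ forall u : T,
        [/\ forall delta, tangent u delta -> @lie_g R p q (omega u delta),
            forall (a : R) delta eps, tangent u delta -> tangent u eps ->
              omega u (fun f => a * delta f + eps f)
              = a *: omega u delta + omega u eps,
            forall delta eps, tangent u delta -> tangent u eps ->
              omega u delta = omega u eps -> delta = eps
          & forall B, @lie_g R p q B ->
              exists2 delta, tangent u delta & omega u delta = B],
      forall O xi, is_vector_field O xi -> forall u, O u ->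
        @smooth_at _ _ _ T matm (fun w => omega w (xi w)) u,
      forall u h delta, @Pmat R p q h -> tangent u delta ->
        omega (act u h) (pushforward (fun w => act w h) u delta)
        = Ad_inv h (omega u delta)
    & forall u B, @lie_p R p q B -> omega u (fundamental_field B u) = B].

End BundleAndConnection.

(* The group G enters only through its Lie algebra and its subgroup P.
   'C(p + q + 2, 2) is the dimension of O(p + 1, q + 1). *)
Record conformal_geometry := ConformalGeometry {
  base_space : manifold R (p + q);
  total_space : manifold R 'C(p + q + 2, 2);
  pr : total_space -> base_space;
  act : total_space -> Mat -> total_space;
  omega : forall u : total_space, functional total_space -> Mat;
  bundleP : is_principal_bundle pr act;
  cartanP : is_cartan_connection act omega
}.

Section Geometry.
Variable C : conformal_geometry.
Implicit Types (x : base_space C) (u : total_space C).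

(* The vector field omega^-1(B); a value exists and is unique for B in g. *)
Definition omega_inv (B : Mat) : total_space C -> functional (total_space C) :=
  fun u => xget (fun=> 0) [set delta | tangent u delta /\ omega u delta = B].

Definition kappa u (X Y : 'cV[R]_(p + q)) : Mat :=
  brk (gm1 X) (gm1 Y)
  - omega u (lie_bracket (omega_inv (gm1 X)) (omega_inv (gm1 Y)) u).

Definition torsion_free : Prop := forall u X Y, @lie_p R p q (kappa u X Y).

Definition curvature_vanishes_at x : Prop :=
  forall u, pr u = x -> forall X Y, kappa u X Y = 0.

Record automorphism := Automorphism {
  adom : set (base_space C);
  acod : set (base_space C);
  afun : total_space C -> total_space C;
  ainv : total_space C -> total_space C;
  adom_open : open adom;
  acod_open : open acod;
  afunP : forall u, adom (pr u) ->
    [/\ acod (pr (afun u)), ainv (afun u) = u & smooth_at afun u];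
  ainvP : forall u, acod (pr u) ->
    [/\ adom (pr (ainv u)), afun (ainv u) = u & smooth_at ainv u];
  afun_act : forall u h, adom (pr u) -> @Pmat R p q h ->
    afun (act u h) = act (afun u) h;
  afun_omega : forall u delta, adom (pr u) -> tangent u delta ->
    omega (afun u) (pushforward afun u delta) = omega u delta
}.

Definition covers (phi : automorphism) (s : base_space C -> base_space C) x : Prop :=
  adom phi x /\
  (\forall y \near x, forall u, pr u = y -> pr (afun phi u) = s y).

Definition is_symmetry (s : base_space C -> base_space C) x : Prop :=
  [/\ local_diffeo_near s x, s x = x,
      forall delta, tangent x delta ->
        pushforward s x delta = (fun f => - delta f)
    & exists phi : automorphism, covers phi s x].

Definition different_at (s t : base_space C -> base_space C) x : Prop :=
  ~ (\forall y \near x, s y = t y).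

(* The elements of G_0 = G / exp g_1 are the orbits [orbit1 u], and
   u |-> [orbit1 u] is the projection. *)
Definition orbit1 u : set (total_space C) :=
  [set act u (mexp (g1 Z)) | Z in [set: 'rV[R]_(p + q)]].

(* The projection onto G_0 is a surjective submersion, so a map defined on G_0
   is smooth iff its composition with the projection is. *)
Definition is_weyl_structure (sigma : set (total_space C) -> total_space C) : Prop :=
  [/\ forall u, orbit1 (sigma (orbit1 u)) = orbit1 u,
      forall u g, @G0mat R p q g ->
        sigma ((fun w => act w g) @` orbit1 u) = act (sigma (orbit1 u)) g
    & forall u, smooth_at (sigma \o orbit1) u].

Definition pullback_weyl (phi : automorphism)
    (sigma : set (total_space C) -> total_space C) : set (total_space C) -> total_space C :=
  fun v => ainv phi (sigma (afun phi @` v)).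

(* [Upsilon] : G_0 -> g_1 is the difference of [s] and [t]; only its values on
   the fibre of G_0 over [x] are canonical. *)
Definition is_difference (s t : base_space C -> base_space C) x
    (Upsilon : set (total_space C) -> 'rV[R]_(p + q)) : Prop :=
  exists (phi psi : automorphism) (sigma : set (total_space C) -> total_space C),
    [/\ covers phi s x, covers psi t x, is_weyl_structure sigma,
        forall u, pr u = x ->
          pullback_weyl phi sigma (orbit1 u) = sigma (orbit1 u)
      & forall u, adom psi (pr u) ->
          pullback_weyl psi sigma (orbit1 u)
          = act (sigma (orbit1 u)) (mexp (g1 (Upsilon (orbit1 u))))].

(* [Upsilon (orbit1 u)] is the row vector representing the 1-form in the
   frame [u]. *)
Definition nonzero_length_at (Upsilon : set (total_space C) -> 'rV[R]_(p + q)) x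
    : Prop :=
  exists2 u, pr u = x &
    Upsilon (orbit1 u) *m Jpq R p q *m (Upsilon (orbit1 u))^T != 0.

End Geometry.
End Cartan.

(* Main.v *)
Require Import Defs.
From HB Require Import structures.
From mathcomp Require Import all_boot all_order all_algebra.
From mathcomp Require Import all_classical all_reals all_analysis.
From mathcomp Require Import ring lra.
(* Imported last as well, so that [pushforward] is not the one of measure theory. *)
Require Import Defs.

(** Write Om(u)(A, B) = omega([omega^-1(A), omega^-1(B)](u)); on g_-1 it is
    minus the curvature, and it equals [A, B] as soon as A lies in p.  Hence the
    entries n(u) of the diagonal blocks of Om(u)(X, Y), X, Y in g_-1 fixed, are real
    functions on the total space that are invariant under automorphisms, under
    exp(g_1) and under the symmetry elements g = diag(e, -e, e), e = +-1, and
    that scale by exp(-2t) along the flow of the grading element E.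

    A covering of a symmetry at x fixes some frame over x up to such a g; as
    Ad(g) is -1 on g_-1, the derivative of n along g_-1 vanishes at this frame.
    For two symmetries with difference Upsilon the two frames are u0 and
    u1 = u0 exp(Z) with Z = Upsilon / 2.  Take xi = J Z^T.  Modulo g_1,
    Ad(exp Z) xi = xi + (Z J Z^T) E, so comparing the vanishing derivatives of n
    along xi at u1 and at u0 gives (Z J Z^T) n(u0) = 0, whence n(u0) = 0.  The
    remaining g_1 block of Om(u0)(X, Y) vanishes because it is odd under g. *)

Set Implicit Arguments.
Unset Strict Implicit.
Unset Printing Implicit Defensive.

Import Order.TTheory GRing.Theory Num.Theory.
Import numFieldNormedType.Exports.

Local Open Scope classical_set_scope.
Local Open Scope ring_scope.

(** * Differential calculus in finite dimension *)

Section CkCalculus.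
Variable R : realType.
Implicit Types E F G : normedModType R.

(** Working on the total space with the fields omega^-1(B), every derivative of curvature is the
    derivative of one real function, and no covariant derivative is formed. Torsion-freeness makes
    the diagonal entries usable: on p the adjoint action of exp(g_1) changes only the g_1 block,
    while a g_-1 component of Om would leak into the diagonal. The weight -2 is one factor exp(-t)
    for each argument in g_-1. The half in Z comes from exp(Z) g = g exp(-Z): psi sends u0
    exp(Upsilon) to u0 g, so the midpoint is moved by g alone. The choice xi = J Z^T kills the
    o(p,q) part of [Z, xi], which would contribute an uncontrolled derivative of n. The obstacle is
    that tangent vectors are functionals on functions and P is a mere set of matrices. Smoothness of
    omega^-1(B), the formula Om(A, B) = [A, B] for A in p, and the fact that omega maps vertical
    vectors into p are not axioms; they are proved in charts, with smooth extensions to open sets of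
    matrices, where derivatives make sense. *)

Lemma is_diff_scale E F (r : E -> R) (f : E -> F) x :
  differentiable r x -> differentiable f x ->
  is_diff x (fun y => r y *: f y)
    (fun v => 'd r x v *: f x + r x *: 'd f x v).
Proof.
move=> dr df.
have scale_bilin : bilinear_for
   (GRing.Scale.Law.clone _ _ *:%R _) (GRing.Scale.Law.clone _ _ *:%R _)
   (@GRing.scale R F : R -> F -> F).
  split => [u'|u] a b c /=.
  - by rewrite scalerDl scalerA.
  - by rewrite scalerDr !scalerA mulrC.
pose sc := bilinear_isBilinear.Build R R F F _ _ (@GRing.scale R F) scale_bilin.
pose scb : {bilinear R -> F -> F} := HB.pack (@GRing.scale R F : R -> F -> F) sc.
have cs : continuous (fun p : R * F => scb p.1 p.2) by move=> p; exact: scale_continuous.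
have -> : (fun y => r y *: f y) = (fun p : R * F => scb p.1 p.2) \o (fun y => (r y, f y)) by [].
have dp := differentiable_pair dr df.
have db := @differentiable_bilin _ _ _ _ scb (r x, f x) cs.
apply: DiffDef; first exact: differentiable_comp.
rewrite (diff_comp dp db) (@diff_bilin _ _ _ _ scb (r x, f x) cs) diff_pair //.
by apply/funext => v /=; rewrite addrC.
Qed.

Lemma differentiable_scale E F (r : E -> R) (f : E -> F) x :
  differentiable r x -> differentiable f x ->
  differentiable (fun y => r y *: f y) x.
Proof. by move=> dr df; case: (is_diff_scale dr df). Qed.

Lemma derive_scale E F (r : E -> R) (f : E -> F) x v :
  differentiable r x -> differentiable f x ->
  'D_v (fun y => r y *: f y) x = 'D_v r x *: f x + r x *: 'D_v f x.
Proof.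
move=> dr df; rewrite !deriveE //; last exact: differentiable_scale.
by have [_ ->] := is_diff_scale dr df.
Qed.

Lemma derive_comp E F G (f : E -> F) (g : F -> G) x v :
  differentiable f x -> differentiable g (f x) ->
  'D_v (g \o f) x = 'D_('D_v f x) g (f x).
Proof.
move=> df dg; have dgf := differentiable_comp df dg.
by rewrite (deriveE _ dgf) (deriveE _ df) (deriveE _ dg) (diff_comp df dg).
Qed.

Lemma derive_linear E F (g : E -> F) x v w a :
  differentiable g x -> 'D_(a *: v + w) g x = a *: 'D_v g x + 'D_w g x.
Proof. by move=> dg; rewrite !deriveE // linearP. Qed.

(** [differentiable] goes through a chosen differential, so dependence on the germ alone is not
    immediate. Here ['d f x] is offered as a differential of [g], and its little-o expansion at [x]
    carries over. *)
Lemma near_differentiable E F (f g : E -> F) x :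
  (\forall y \near x, f y = g y) -> differentiable f x -> differentiable g x.
Proof.
move=> fg df; apply/diffP => /=.
apply: (@getPex _ (fun (dg : {linear E -> F}) => continuous dg /\
  forall y, g y = g (lim (nbhs x)) + dg (y - lim (nbhs x))
                  +o_(y \near x) (y - lim (nbhs x)))).
exists ('d f x); split; first exact: diff_continuous.
have lx : lim (nbhs x) = x by exact: lim_id.
suff : g = (fun y => g (lim (nbhs x)) + 'd f x (y - lim (nbhs x)))
   +o_ (nbhs x) (fun y => y - lim (nbhs x)) by rewrite funeqE.
have /funext : forall y, f y = f (lim (nbhs x)) + 'd f x (y - lim (nbhs x))
   +o_(y \near x) (y - lim (nbhs x)) by exact: diffE.
move=> /eqaddoP fo; apply/eqaddoP => e e0.
have fgx := nbhs_singleton fg.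
have := fo e e0; apply: filterS2 fg => y fgy.
by rewrite /= !fctE -fgy !lx fgx.
Qed.

Lemma Ck_on_cont E F k (U : set E) (f : E -> F) x :
  Ck_on k U f -> U x -> {for x, continuous f}.
Proof.
case: k => [|k] /=; first exact.
move=> [df _] Ux; exact/differentiable_continuous/df.
Qed.

Lemma Ck_onW E F k (U : set E) (f : E -> F) : Ck_on k.+1 U f -> Ck_on k U f.
Proof.
elim: k f => [|k IH] f.
  by move=> h x Ux; exact: Ck_on_cont h Ux.
by move=> [df Df]; split=> // v; apply: IH; exact: Df.
Qed.

Lemma Ck_on_sub E F k (U V : set E) (f : E -> F) :
  V `<=` U -> Ck_on k U f -> Ck_on k V f.
Proof.
move=> VU; elim: k f => [|k IH] f /=; first by move=> h x /VU; exact: h.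
by move=> [df Df]; split=> [x /VU|v]; [exact: df|apply: IH].
Qed.

Lemma Ck_on_ext E F k (U : set E) (f g : E -> F) : open U ->
  (forall x, U x -> f x = g x) -> Ck_on k U f -> Ck_on k U g.
Proof.
move=> oU; elim: k f g => [|k IH] f g fg /=.
  move=> h x Ux; have := h x Ux; rewrite /prop_for /continuous_at (fg x Ux).
  by apply: cvg_trans; apply: near_eq_cvg; apply: filterS (open_nbhs_nbhs (conj oU Ux)) => y /fg.
move=> [df Df]; split=> [x Ux|v].
  apply: near_differentiable (df x Ux).
  by apply: filterS (open_nbhs_nbhs (conj oU Ux)) => y /fg.
apply: IH (Df v) => x Ux; apply: near_eq_derive.
by apply: filterS (open_nbhs_nbhs (conj oU Ux)) => y /fg.
Qed.

Lemma Ck_on_cst E F k (U : set E) (a : F) : Ck_on k U (fun _ => a).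
Proof.
elim: k a => [|k IH] a /=; first by move=> x _; exact: cst_continuous.
split=> [x _|v]; first exact: differentiable_cst.
have -> : 'D_v (fun _ : E => a) = (fun _ : E => 0 : F).
  by apply/funext => x; rewrite derive_cst.
exact: IH.
Qed.

Lemma derive_lin E F (L : {linear E -> F}) x v : continuous L -> 'D_v L x = L v.
Proof.
by move=> cL; rewrite deriveE ?diff_lin //; exact: linear_differentiable.
Qed.

Lemma Ck_on_linear E F k (U : set E) (L : {linear E -> F}) :
  continuous L -> Ck_on k U L.
Proof.
move=> cL; case: k => [|k] /=; first by move=> x _; exact: cL.
split=> [x _|v]; first exact: linear_differentiable.
have -> : 'D_v L = (fun _ : E => L v).
  by apply/funext => x; exact: derive_lin.
exact: Ck_on_cst.
Qed.

Lemma Ck_on_add E F k (U : set E) (f g : E -> F) : open U ->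
  Ck_on k U f -> Ck_on k U g -> Ck_on k U (fun x => f x + g x).
Proof.
move=> oU; elim: k f g => [|k IH] f g /=.
  by move=> cf cg x Ux; apply: cvgD; [exact: cf|exact: cg].
move=> [df Df] [dg Dg]; split=> [x Ux|v].
  exact: (differentiableD (df x Ux) (dg x Ux)).
apply: (@Ck_on_ext _ _ _ _ (fun x => 'D_v f x + 'D_v g x)) => //.
  move=> x Ux; rewrite -(@deriveD _ _ _ f g) //; apply/diff_derivable; [exact: df|exact: dg].
exact: IH.
Qed.

Lemma Ck_on_lin_comp E F G k (U : set E) (f : E -> F) (L : {linear F -> G}) :
  open U -> continuous L -> Ck_on k U f -> Ck_on k U (fun x => L (f x)).
Proof.
move=> oU cL; elim: k f => [|k IH] f /=.
  move=> cf x Ux; apply: continuous_comp; [exact: cf|exact: cL].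
move=> [df Df]; have dL y : differentiable L y by exact: linear_differentiable.
split=> [x Ux|v].
  by apply: (@differentiable_comp _ _ _ _ f L); first exact: df.
apply: (@Ck_on_ext _ _ _ _ (fun x => L ('D_v f x))) => //; last exact: IH.
move=> x Ux; rewrite -[RHS]/('D_v (L \o f) x) (derive_comp _ (df x Ux) (dL _)).
by rewrite derive_lin.
Qed.

Lemma Ck_on_scale E F k (U : set E) (r : E -> R) (f : E -> F) : open U ->
  Ck_on k U r -> Ck_on k U f -> Ck_on k U (fun x => r x *: f x).
Proof.
move=> oU; elim: k r f => [|k IH] r f.
  by move=> cr cf x Ux; apply: cvgZ; [exact: cr|exact: cf].
move=> cr cf; have [dr Dr] := cr; have [df Df] := cf; split=> [x Ux|v].
  apply: differentiable_scale; [exact: dr|exact: df].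
apply: (@Ck_on_ext _ _ _ _ (fun x => 'D_v r x *: f x + r x *: 'D_v f x)) => //.
  by move=> x Ux; rewrite derive_scale //; [exact: dr|exact: df].
apply: Ck_on_add => //; apply: IH.
- exact: Dr.
- exact: Ck_onW.
- exact: Ck_onW.
- exact: Df.
Qed.

Lemma Ck_on_sum E F k (U : set E) I (s : seq I) (f : I -> E -> F) : open U ->
  (forall i, Ck_on k U (f i)) -> Ck_on k U (fun x => \sum_(i <- s) f i x).
Proof.
move=> oU Cf; elim: s => [|i s IH].
  apply: (@Ck_on_ext _ _ _ _ (fun _ => 0)) => //; last exact: Ck_on_cst.
  by move=> x _; rewrite big_nil.
apply: (@Ck_on_ext _ _ _ _ (fun x => f i x + \sum_(i <- s) f i x)) => //.
  by move=> x _; rewrite big_cons.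
exact: Ck_on_add.
Qed.

(** Encodes finite dimension as a finite spanning family with continuous coordinate functionals, the
    form needed to expand a derivative along a varying direction into derivatives along fixed
    ones. *)
Definition fin_basis F := exists (I : finType) (e : I -> F)
  (c : I -> {linear F -> R}), (forall i, continuous (c i)) /\
    forall v, v = \sum_i c i v *: e i.

Lemma derive_sum_basis (I : finType) (F G : normedModType R) (e : I -> F)
    (a : I -> R) (g : F -> G) x :
  differentiable g x ->
  'D_(\sum_i a i *: e i) g x = \sum_i a i *: 'D_(e i) g x.
Proof.
move=> dg; rewrite deriveE // linear_sum; apply: eq_bigr => i _.
by rewrite linearZ /= deriveE.
Qed.

(** [Ck_on] controls derivatives along fixed vectors only, so the varying direction [b x] is
    expanded in a basis. The assumption on [('D_v g) \o f] is exactly what the induction in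
    [Ck_on_comp] can supply, which avoids circularity. *)
Lemma Ck_on_derive_along E F G k (U : set E) (V : set F) (f b : E -> F) (g : F -> G) :
  fin_basis F -> open U -> (forall x, U x -> V (f x)) ->
  (forall x, V x -> differentiable g x) ->
  (forall v, Ck_on k U (('D_v g) \o f)) -> Ck_on k U b ->
  Ck_on k U (fun x => 'D_(b x) g (f x)).
Proof.
move=> [I [e [c [cc ce]]]] oU UV dg Dg Cb.
apply: (@Ck_on_ext _ _ _ _ (fun x => \sum_i c i (b x) *: 'D_(e i) g (f x))) => //.
  move=> x Ux; rewrite [in RHS](ce (b x)) derive_sum_basis //; exact/dg/UV.
apply: Ck_on_sum => // i; apply: Ck_on_scale => //; last exact: Dg.
exact: Ck_on_lin_comp.
Qed.

Lemma Ck_on_comp E F G k (U : set E) (V : set F) (f : E -> F) (g : F -> G) :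
  fin_basis F -> open U -> (forall x, U x -> V (f x)) ->
  Ck_on k U f -> Ck_on k V g -> Ck_on k U (g \o f).
Proof.
move=> bF oU UV; elim: k g => [|k IH] g.
  move=> cf cg x Ux; apply: continuous_comp; [exact: cf|exact/cg/UV].
move=> Cf [dg Dg]; have [df Df] := Cf; split=> [x Ux|v].
  by apply: differentiable_comp; [exact: df|exact/dg/UV].
apply: (@Ck_on_ext _ _ _ _ (fun x => 'D_('D_v f x) g (f x))) => //.
  by move=> x Ux; rewrite derive_comp //; [exact: df|exact/dg/UV].
apply: (Ck_on_derive_along (V := V));
  [exact: bF|exact: oU|exact: UV|exact: dg| |exact: Df].
by move=> w; apply: IH; [exact: Ck_onW|exact: Dg].
Qed.

Lemma derive_inv E (g : E -> R) x v : differentiable g x -> g x != 0 ->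
  'D_v (fun y => (g y)^-1) x = (- ((g x)^-1 * (g x)^-1)) *: 'D_v g x.
Proof.
move=> dg g0; rewrite deriveE ?deriveE //; last exact: differentiableV.
by rewrite diffV // -exprVn expr2.
Qed.

Lemma Ck_on_inv E k (U : set E) (g : E -> R) : open U ->
  (forall x, U x -> g x != 0) -> Ck_on k U g -> Ck_on k U (fun x => (g x)^-1).
Proof.
move=> oU g0; elim: k => [|k IH].
  by move=> cg x Ux; apply: cvgV; [exact: g0|exact: cg].
move=> Cg; have [dg Dg] := Cg; split=> [x Ux|v].
  by apply: differentiableV; [exact: dg|exact: g0].
apply: (@Ck_on_ext _ _ _ _ (fun x => (- 1) *: ((g x)^-1 *: ((g x)^-1 *: 'D_v g x)))) => //.
  by move=> x Ux; rewrite derive_inv ?g0 //; [rewrite !scalerA mulN1r|exact: dg].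
have CV := IH (Ck_onW Cg).
by do !apply: Ck_on_scale => //; [exact: Ck_on_cst|exact: Dg].
Qed.

End CkCalculus.

Section FiniteBases.
Variable R : realType.

Lemma coord_is_linear m n (i : 'I_m) (j : 'I_n) :
  linear (fun A : 'M[R]_(m, n) => A i j : R).
Proof. by move=> a A B; rewrite !mxE. Qed.

Definition coordl m n (i : 'I_m) (j : 'I_n) : {linear 'M[R]_(m, n) -> R} :=
  HB.pack (fun A : 'M[R]_(m, n) => A i j : R)
    (GRing.isLinear.Build _ _ _ _ _ (coord_is_linear i j)).

Lemma coordl_continuous m n (i : 'I_m) (j : 'I_n) : continuous (coordl i j).
Proof. exact: coord_continuous. Qed.

Lemma fin_basis_mx m n : fin_basis 'M[R]_(m, n).
Proof.
exists ('I_m * 'I_n)%type, (fun p => delta_mx p.1 p.2), (fun p => coordl p.1 p.2).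
split=> [p|A]; first exact: coordl_continuous.
by rewrite {1}(matrix_sum_delta A) pair_big.
Qed.

Lemma fin_basis_real : fin_basis R.
Proof.
exists unit, (fun _ => 1), (fun _ => idfun : {linear R -> R}).
split=> [_ x|v]; first exact: cvg_id.
by rewrite (big_pred1 tt) //= ?[_ *: _]mulr1 // => -[].
Qed.

Lemma fin_basis_prod (E F : normedModType R) :
  fin_basis E -> fin_basis F -> fin_basis (E * F)%type.
Proof.
move=> [I [e [c [cc ce]]]] [J [f [d [cd df]]]].
pose b (k : I + J) : E * F := match k with inl i => (e i, 0) | inr j => (0, f j) end.
pose a (k : I + J) : {linear (E * F)%type -> R} :=
  match k with inl i => c i \o fst | inr j => d j \o snd end.
exists (I + J)%type, b, a; split=> [[i|j] x|[v w]] /=.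
- by apply: continuous_comp; [exact: cvg_fst|exact: cc].
- by apply: continuous_comp; [exact: cvg_snd|exact: cd].
rewrite big_sumType /= {1}(ce v) {1}(df w).
rewrite [X in X = _](_ : _ = (\sum_i c i v *: e i, 0) + (0, \sum_j d j w *: f j)); last first.
  by congr (_, _); rewrite /= ?addr0 ?add0r.
congr (_ + _).
  apply: (big_ind2 (fun x y => (x, 0 : F) = y)) => // [x1 x2 y1 y2 <- <-|i _].
    by congr (_, _); rewrite /= ?addr0.
  by congr (_, _); rewrite /= ?scaler0.
apply: (big_ind2 (fun x y => (0 : E, x) = y)) => // [x1 x2 y1 y2 <- <-|i _].
  by congr (_, _); rewrite /= ?addr0.
by congr (_, _); rewrite /= ?scaler0.
Qed.

End FiniteBases.

(** * Smooth germs, derivatives along moving directions, symmetry of second derivatives *)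

Section Germs.
Variable R : realType.
Implicit Types E F G : normedModType R.

(** Asking for smoothness on a whole neighbourhood makes this an open condition ([smth_near]) that
    is stable under ['D_v] ([smth_derive]). *)
Definition smth E F (f : E -> F) (x : E) : Prop :=
  exists U, [/\ open U, U x & smooth_on U f].

Lemma smth_ext E F (f g : E -> F) x :
  (\forall y \near x, f y = g y) -> smth f x -> smth g x.
Proof.
move=> fg [U [oU Ux sf]].
exists (U `&` [set y | f y = g y]°); split.
- by apply: openI => //; exact: open_interior.
- by split.
- move=> k; apply: (@Ck_on_ext _ _ _ _ _ f).
  + by apply: openI => //; exact: open_interior.
  + by move=> y [_ /interior_subset].
  + by apply: Ck_on_sub (sf k) => y [].
Qed.

Lemma smth_near E F (f : E -> F) x : smth f x -> \forall y \near x, smth f y.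
Proof.
move=> [U [oU Ux sf]].
by apply: filterS (open_nbhs_nbhs (conj oU Ux)) => y Uy; exists U.
Qed.

Lemma smth_diff E F (f : E -> F) x : smth f x -> differentiable f x.
Proof. by move=> [U [oU Ux sf]]; have [df _] := sf 1%N; exact: df. Qed.

Lemma smth_cont E F (f : E -> F) x : smth f x -> {for x, continuous f}.
Proof. by move=> /smth_diff /differentiable_continuous. Qed.

Lemma smth_derive E F (f : E -> F) x v : smth f x -> smth ('D_v f) x.
Proof.
by move=> [U [oU Ux sf]]; exists U; split=> // k; have [_] := sf k.+1; exact.
Qed.

Lemma smth_cst E F (a : F) (x : E) : smth (fun _ => a) x.
Proof.
by exists setT; split=> // [|k]; [exact: openT|exact: Ck_on_cst].
Qed.

Lemma smth_linear E F (L : {linear E -> F}) x : continuous L -> smth L x.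
Proof.
move=> cL; exists setT; split=> // [|k]; [exact: openT|exact: Ck_on_linear].
Qed.

Lemma smth_id E (x : E) : smth id x.
Proof. by apply: (@smth_linear _ _ (idfun : {linear E -> E})) => y; exact: cvg_id. Qed.

Lemma smth_add E F (f g : E -> F) x :
  smth f x -> smth g x -> smth (fun y => f y + g y) x.
Proof.
move=> [U [oU Ux sf]] [V [oV Vx sg]]; exists (U `&` V); split=> //; first exact: openI.
move=> k; apply: Ck_on_add; first exact: openI.
  by apply: Ck_on_sub (sf k) => y [].
by apply: Ck_on_sub (sg k) => y [].
Qed.

Lemma smth_scale E F (r : E -> R) (f : E -> F) x :
  smth r x -> smth f x -> smth (fun y => r y *: f y) x.
Proof.
move=> [U [oU Ux sf]] [V [oV Vx sg]]; exists (U `&` V); split=> //; first exact: openI.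
move=> k; apply: Ck_on_scale; first exact: openI.
  by apply: Ck_on_sub (sf k) => y [].
by apply: Ck_on_sub (sg k) => y [].
Qed.

Lemma smth_mul E (r s : E -> R) x :
  smth r x -> smth s x -> smth (fun y => r y * s y) x.
Proof. exact: smth_scale. Qed.

Lemma smth_opp E F (f : E -> F) x : smth f x -> smth (fun y => - f y) x.
Proof.
move=> sf; apply: (@smth_ext _ _ (fun y => (-1) *: f y)).
  by near=> y; rewrite scaleN1r.
by apply: smth_scale => //; exact: smth_cst.
Unshelve. all: by end_near. Qed.

Lemma smth_sum E F I (s : seq I) (P : pred I) (f : I -> E -> F) x :
  (forall i, P i -> smth (f i) x) -> smth (fun y => \sum_(i <- s | P i) f i y) x.
Proof.
move=> sf; elim: s => [|i s IH].
  apply: (@smth_ext _ _ (fun _ => 0)); last exact: smth_cst.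
  by near=> y; rewrite big_nil.
case Pi : (P i); last first.
  by apply: smth_ext IH; near=> y; rewrite big_cons Pi.
apply: (@smth_ext _ _ (fun y => f i y + \sum_(i <- s | P i) f i y)).
  by near=> y; rewrite big_cons Pi.
by apply: smth_add => //; exact: sf.
Unshelve. all: by end_near. Qed.

Lemma smth_prod E I (s : seq I) (P : pred I) (f : I -> E -> R) x :
  (forall i, P i -> smth (f i) x) -> smth (fun y => \prod_(i <- s | P i) f i y) x.
Proof.
move=> sf; elim: s => [|i s IH].
  have s1 : smth (fun _ : E => 1 : R) x by exact: smth_cst.
  by apply: smth_ext s1; near=> y; rewrite big_nil.
case Pi : (P i); last first.
  by apply: smth_ext IH; near=> y; rewrite big_cons Pi.
apply: (@smth_ext _ _ (fun y => f i y * \prod_(i <- s | P i) f i y)).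
  by near=> y; rewrite big_cons Pi.
by apply: smth_mul => //; exact: sf.
Unshelve. all: by end_near. Qed.

Lemma smth_inv E (g : E -> R) x : smth g x -> g x != 0 ->
  smth (fun y => (g y)^-1) x.
Proof.
move=> sg g0; have cg := smth_cont sg; have [U [oU Ux sgU]] := sg.
have n0 : \forall y \near x, g y != 0.
  exact: cvgr_neq0 g0.
exists (U `&` [set y | g y != 0]°); split.
- by apply: openI => //; exact: open_interior.
- by split.
- move=> k; apply: Ck_on_inv.
  + by apply: openI => //; exact: open_interior.
  + by move=> y [_ /interior_subset].
  + by apply: Ck_on_sub (sgU k) => y [].
Qed.

Lemma smth_comp E F G (f : E -> F) (g : F -> G) x : fin_basis F ->
  smth f x -> smth g (f x) -> smth (fun y => g (f y)) x.
Proof.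
move=> bF sf [V [oV Vx sg]]; have cf := smth_cont sf; have [U [oU Ux sfU]] := sf.
have nV : \forall y \near x, V (f y) by apply: cf; exact: open_nbhs_nbhs.
have oW : open (U `&` [set y | V (f y)]°) by apply: openI => //; exact: open_interior.
exists (U `&` [set y | V (f y)]°); split=> // k.
apply: (Ck_on_comp bF (V := V) oW) => //.
  by move=> y [_ /interior_subset].
by apply: Ck_on_sub (sfU k) => y [].
Qed.

Lemma smth_lin_comp E F G (f : E -> F) (L : {linear F -> G}) x :
  continuous L -> smth f x -> smth (fun y => L (f y)) x.
Proof.
move=> cL [U [oU Ux sf]]; exists U; split=> // k; exact: Ck_on_lin_comp.
Qed.

Lemma smth_derive_along E F G (f b : E -> F) (g : F -> G) x : fin_basis F ->
  smth f x -> smth b x -> smth g (f x) -> smth (fun y => 'D_(b y) g (f y)) x.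
Proof.
move=> bF sf sb sg; have cf := smth_cont sf.
have [I [e [c [cc ce]]]] := bF.
apply: (@smth_ext _ _ (fun y => \sum_i c i (b y) *: 'D_(e i) g (f y))).
  near=> y; rewrite [in RHS](ce (b y)) derive_sum_basis //.
  apply: smth_diff; near: y; apply: cf; exact: smth_near.
apply: smth_sum => i _; apply: smth_scale; first exact: smth_lin_comp.
by apply: (smth_comp (g := 'D_(e i) g)) => //; exact: smth_derive.
Unshelve. all: by end_near. Qed.

Lemma smth_pair E F G (f : E -> F) (g : E -> G) x :
  smth f x -> smth g x -> smth (fun y => (f y, g y)) x.
Proof.
move=> sf sg.
have l1 : linear (fun u : F => (u, 0 : G)).
  by move=> a u v; congr (_, _); rewrite /= scaler0 addr0.
have l2 : linear (fun u : G => (0 : F, u)).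
  by move=> a u v; congr (_, _); rewrite /= scaler0 addr0.
pose L1 : {linear F -> (F * G)%type} := HB.pack (fun u : F => (u, 0 : G)) (GRing.isLinear.Build _ _ _ _ _ l1).
pose L2 : {linear G -> (F * G)%type} := HB.pack (fun u : G => (0 : F, u)) (GRing.isLinear.Build _ _ _ _ _ l2).
apply: (@smth_ext _ _ (fun y => L1 (f y) + L2 (g y))).
  by near=> y; congr (_, _); rewrite /= ?addr0 ?add0r.
apply: smth_add; apply: smth_lin_comp => // u.
  by apply: cvg_pair; [exact: cvg_id|exact: cvg_cst].
by apply: cvg_pair; [exact: cvg_cst|exact: cvg_id].
Unshelve. all: by end_near. Qed.

(** A product rule: ['D_(b y) g (f y)] is linear in [b y], so expansion in a basis turns it into a
    finite sum of products. The two terms, direction varying and base point varying, later become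
    the first and second order parts of an iterated derivative. *)
Lemma derive_along E F G (f b : E -> F) (g : F -> G) x v : fin_basis F ->
  differentiable f x -> differentiable b x -> smth g (f x) ->
  'D_v (fun y => 'D_(b y) g (f y)) x
  = 'D_('D_v b x) g (f x) + 'D_('D_v f x) ('D_(b x) g) (f x).
Proof.
move=> bF df db sg; have cf := differentiable_continuous df.
have [I [e [c [cc ce]]]] := bF.
have dDg i : differentiable ('D_(e i) g) (f x) by apply: smth_diff; exact: smth_derive.
have ng : \forall z \near f x, differentiable g z.
  by apply: filterS (smth_near sg) => z /smth_diff.
have nf : \forall y \near x, differentiable g (f y) := cf _ ng.
rewrite (@near_eq_derive _ _ _ _ (fun y => \sum_i c i (b y) *: 'D_(e i) g (f y))); last first.
  near=> y; rewrite [in LHS](ce (b y)) derive_sum_basis //.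
  by near: y.
have dcb i : differentiable (fun y => c i (b y)) x.
  by apply: (@differentiable_comp _ _ _ _ b (c i)) => //; exact: linear_differentiable.
have dDgf i : differentiable (fun y => 'D_(e i) g (f y)) x.
  exact: (@differentiable_comp _ _ _ _ f ('D_(e i) g)).
have sumE (X Y : normedModType R) (h : I -> X -> Y) (z u : X) :
   (forall i, derivable (h i) z u) ->
   'D_u (fun y => \sum_i h i y) z = \sum_i 'D_u (h i) z.
  move=> dh; suff [] : derivable (fun y => \sum_i h i y) z u /\
    'D_u (fun y => \sum_i h i y) z = \sum_i 'D_u (h i) z by [].
  elim: (index_enum I) => [|i s [ds Ds]].
    rewrite big_nil (_ : (fun _ => _) = cst 0) ?derive_cst //.
    by apply/funext => y; rewrite big_nil.
  rewrite big_cons -Ds.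
  have -> : (fun y => \sum_(j <- i :: s) h j y) = h i + (fun y => \sum_(j <- s) h j y).
    by apply/funext => y; rewrite big_cons.
  by split; [exact: derivableD|exact: deriveD].
rewrite sumE; last by move=> i; apply: diff_derivable; exact: differentiable_scale.
rewrite (@near_eq_derive _ _ _ ('D_(b x) g) (fun z => \sum_i c i (b x) *: 'D_(e i) g z)); last first.
  near=> z; rewrite [in LHS](ce (b x)) derive_sum_basis //.
  by near: z.
rewrite sumE; last by move=> i; apply: diff_derivable; exact: differentiableZ.
rewrite {1}(ce ('D_v b x)) derive_sum_basis; last exact: smth_diff.
rewrite -big_split; apply: eq_bigr => i _ /=.
rewrite derive_scale // deriveZ; last exact: diff_derivable.
congr (_ *: _ + _ *: _).
  by rewrite -[LHS]/('D_v (c i \o b) x) derive_comp ?derive_lin //; exact: linear_differentiable.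
by rewrite -[LHS]/('D_v ('D_(e i) g \o f) x) derive_comp.
Unshelve. all: by end_near. Qed.

Lemma mvt_along E (G : E -> R) z w (h : R) : 0 < h ->
  (forall t, 0 <= t <= h -> differentiable G (z + t *: w)) ->
  exists2 t, 0 <= t <= h & G (z + h *: w) - G z = h * 'D_w G (z + t *: w).
Proof.
move=> h0 dG.
pose l (t : R) := z + t *: w.
have dw (t : R) : differentiable (fun t : R => t *: w) t.
  exact: (@differentiable_scale _ _ _ (fun t : R => t) (cst w)).
have dl (t : R) : differentiable l t.
  exact: (@differentiableD _ _ _ (cst z) (fun t : R => t *: w)).
have Dl (t : R) : 'D_1 l t = w.
  rewrite -[l]/(cst z + (fun t : R => t *: w)) deriveD //; last exact: diff_derivable.
  by rewrite derive_cst add0r derive_scale // derive_id derive_cst scale1r scaler0 addr0.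
have dGl t : 0 <= t <= h -> is_derive t 1 (G \o l) ('D_w G (l t)).
  move=> th; apply: DeriveDef.
    by apply: diff_derivable; apply: differentiable_comp; [exact: dl|exact: dG].
  by rewrite derive_comp ?Dl //; exact: dG.
have [|||t th] := @MVT_segment _ (G \o l) (fun t => 'D_w G (l t)) 0 h.
- exact: ltW.
- by move=> t; rewrite in_itv /= => /andP[t0 th]; apply: dGl; rewrite !ltW.
- apply: derivable_within_continuous => t; rewrite in_itv /= => th.
  by have [] := dGl t th.
rewrite /= /l scale0r addr0 subr0 mulrC => e; by exists t.
Qed.

(* Mean value form of the second difference, the core of Schwarz's theorem. *)
Lemma mvt_rectangle E (H : E -> R) x v w (h : R) : 0 < h ->
  (forall s t, 0 <= s <= h -> 0 <= t <= h ->
     smth H (x + s *: v + t *: w)) ->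
  exists s t, [/\ 0 <= s <= h, 0 <= t <= h &
    H (x + h *: v + h *: w) - H (x + h *: v) - H (x + h *: w) + H x
    = h * (h * 'D_w ('D_v H) (x + s *: v + t *: w))].
Proof.
move=> h0 sH; have hh : 0 <= h <= h by rewrite lexx ltW.
have h00 : 0 <= (0 : R) <= h by rewrite lexx ltW.
have dh y : differentiable (fun y => y + h *: w) y.
  exact: (@differentiableD _ _ _ id (cst (h *: w))).
have De y u : 'D_u (fun y => y + h *: w) y = u.
  have -> : (fun y => y + h *: w) = (id : E -> E) + cst (h *: w) by [].
  by rewrite deriveD // derive_id derive_cst addr0.
have dshift y : differentiable H (y + h *: w) ->
    differentiable (fun y => H (y + h *: w)) y.
  move=> dH; exact: (@differentiable_comp _ _ _ _ (fun y => y + h *: w) H).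
have Dshift y u : differentiable H (y + h *: w) ->
    'D_u (fun y => H (y + h *: w)) y = 'D_u H (y + h *: w).
  by move=> dH; rewrite -[LHS]/('D_u (H \o (fun y => y + h *: w)) y) derive_comp // De.
have sH0 s : 0 <= s <= h -> smth H (x + s *: v).
  by move=> sh; have := sH s 0 sh h00; rewrite scale0r addr0.
have [s|s sh e] := @mvt_along _ (fun y => H (y + h *: w) - H y) x v h h0.
  move=> sh; apply: (@differentiableB _ _ _ (fun y => H (y + h *: w)) H).
    by apply: dshift; apply: smth_diff; exact: sH.
  by apply: smth_diff; exact: sH0.
have [t|t th e'] := @mvt_along _ ('D_v H) (x + s *: v) w h h0.
  by move=> th; apply: smth_diff; apply: smth_derive; exact: sH.
exists s, t; split=> //; rewrite -e'.
have -> : 'D_v H (x + s *: v + h *: w) - 'D_v H (x + s *: v)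
   = 'D_v (fun y => H (y + h *: w) - H y) (x + s *: v).
  have d1 : differentiable H (x + s *: v + h *: w) by apply: smth_diff; exact: sH.
  rewrite (@deriveB _ _ _ (fun y => H (y + h *: w)) H) ?Dshift //.
    by apply: diff_derivable; exact: dshift.
  by apply: diff_derivable; apply: smth_diff; exact: sH0.
by rewrite -e; ring.
Qed.

Lemma near_dist_lt E (g : E -> R) x (e : R) : {for x, continuous g} -> 0 < e ->
  \forall y \near x, `|g x - g y| < e.
Proof. by move=> cg e0; move/cvgrPdist_lt: cg; exact. Qed.

(** The second difference of [H] over the parallelogram with sides [h *: v] and [h *: w] does not
    change when [v] and [w] are exchanged. Its mean value form makes a value of one mixed derivative
    equal to a value of the other, at two points as close to [x] as desired; continuity at [x]
    finishes. *)
Lemma derive_swap E (H : E -> R) x v w : smth H x ->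
  'D_v ('D_w H) x = 'D_w ('D_v H) x.
Proof.
move=> sH; apply/eqP; rewrite -subr_eq0 -normr_le0; apply/ler_addgt0Pl => e e0.
rewrite addr0.
have e2 : 0 < e / 2 by rewrite divr_gt0.
have c1 := smth_cont (smth_derive v (smth_derive w sH)).
have c2 := smth_cont (smth_derive w (smth_derive v sH)).
have n1 := near_dist_lt c1 e2.
have n2 := near_dist_lt c2 e2.
have n3 := smth_near sH.
have fx : Filter (nbhs x) by exact: nbhs_filter.
have /nbhs_ballP := @filterI _ _ fx _ _ n1 (@filterI _ _ fx _ _ n2 n3).
move=> [d /= d0 bd].
(* The points [x + s *: v + t *: w] with [s], [t] between 0 and [h] stay within [h * N] of [x]; the
   summand 1 keeps [N] positive when both directions vanish. *)
pose N := `|v| + `|w| + 1.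
have N0 : 0 < N by rewrite ltr_wpDl // addr_ge0.
have [h h0 hN] : exists2 h : R, 0 < h & h * N < d.
  exists (d / 2 / N); first by rewrite !divr_gt0.
  by rewrite divfK ?gt_eqF // ltr_pdivrMr // ltr_pMr // ltr1n.
have inb s t : 0 <= s <= h -> 0 <= t <= h -> ball x d (x + s *: v + t *: w).
  move=> /andP[s0 sh] /andP[t0 th]; rewrite -ball_normE /=.
  rewrite -addrA opprD addNKr normrN (le_lt_trans (ler_normD _ _)) //.
  rewrite !normrZ !ger0_norm //.
  apply: le_lt_trans hN; rewrite /N !mulrDr mulr1 -[leLHS]addr0 lerD //; last exact: ltW.
  by rewrite lerD // ler_wpM2r.
have [|s [t [sh th e1]]] := @mvt_rectangle _ H x v w h h0.
  by move=> s t sh th; have [_ []] := bd _ (inb s t sh th).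
have inb' s' t' : 0 <= s' <= h -> 0 <= t' <= h -> ball x d (x + s' *: w + t' *: v).
  by move=> *; rewrite addrAC; exact: inb.
have [|s' [t' [sh' th' e2']]] := @mvt_rectangle _ H x w v h h0.
  by move=> s' t' s'h t'h; have [_ []] := bd _ (inb' s' t' s'h t'h).
have [_ [b1 _]] := bd _ (inb s t sh th).
have [b2 _] := bd _ (inb' s' t' sh' th').
move: e1 b1; set a := 'D_w ('D_v H) _; move: a => a e1 b1.
move: e2' b2; set b := 'D_v ('D_w H) _; move: b => b e2' b2.
have eD : a = b.
  have hn : h != 0 by rewrite gt_eqF.
  have : h * (h * a) = h * (h * b).
    by rewrite -e1 -e2' (addrAC x (h *: w)); congr (_ + _); exact: addrAC.
  by move/(mulfI hn)/(mulfI hn).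
rewrite -(subrKA b) (le_trans (ler_normD _ _)) //.
by rewrite [leRHS]splitr lerD // ltW // -eD distrC.
Qed.

End Germs.

(** * The matrix exponential *)

Section MatrixExponential.
Variables (R : realType) (p q : nat).
Notation N := (1 + (p + q + 1))%N.
Notation Mat := 'M[R]_N.
Implicit Types A B : Mat.

(** Convergence of matrices can be checked entrywise, which reduces [mexp] to real power series. *)
Lemma mx_norm_lim m n (u : nat -> 'M[R]_(m, n)) (A : 'M[R]_(m, n)) :
  (forall i j, (fun k => u k i j) @ \oo --> A i j) -> u @ \oo --> A.
Proof.
move=> uA; apply/cvgrPdist_le => /= e e0.
near=> k.
rewrite /Num.Def.normr/= mx_normrE (bigmax_le _ (ltW e0))//= => -[i j] _.
rewrite !mxE/=.
move: i j; near: k.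
have : \forall k \near \oo, forall (i : 'I_m) (j : 'I_n), `|A i j - u k i j| <= e.
  apply: filter_forall => i; apply: filter_forall => j.
  exact: ((cvgrPdist_le _ _).1 (uA i j) e e0).
by [].
Unshelve. all: by end_near. Qed.

Lemma cvg_series_dominated (c : nat -> R) (D C x : R) : 0 <= D -> 0 <= C ->
  (forall k, `|c k| <= D * (C ^+ k / k`!%:R)) -> cvgn (pseries c x).
Proof.
move=> D0 C0 cD; apply: normed_cvg.
apply: (@series_le_cvg _ _ (fun k => D * exp_coeff (C * `|x|) k)) => [k|k|k|].
- exact: normr_ge0.
- by rewrite mulr_ge0 // /exp_coeff /= divr_ge0 ?exprn_ge0 ?mulr_ge0.
- rewrite /exp_coeff /= normrM normrX exprMn.
  rewrite -!mulrA (mulrC (`|x| ^+ k)) !mulrA ler_wpM2r ?exprn_ge0 //.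
  by rewrite -mulrA; exact: cD.
- rewrite (_ : (fun k => _) = D *: exp_coeff (C * `|x|)) //.
  by apply: is_cvg_seriesZ; exact: is_cvg_series_exp_coeff.
Qed.

(** The Taylor coefficients in [t] of the entry [(i, j)] of [mexp (t *: A)]; with the parameter
    singled out, the theory of real power series applies. *)
Let c A (i j : 'I_N) (k : nat) : R := (A ^+ k) i j / k`!%:R.

(** The sum of all absolute values dominates every row sum, so entries of [A ^+ k] are bounded by
    [bnd A ^+ k] by induction, and comparison with the exponential series gives convergence. *)
Let bnd A : R := \sum_i \sum_j `|A i j|.

Let bnd_ge0 A : 0 <= bnd A.
Proof. by apply: sumr_ge0 => i _; apply: sumr_ge0. Qed.

Lemma mx_exp_bound A k i j : `|(A ^+ k) i j| <= bnd A ^+ k.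
Proof.
elim: k i j => [|k IH] i j.
  by rewrite expr0 expr0 mxE; case: eqP; rewrite ?normr1 ?normr0.
rewrite exprS -[A * _]/(A *m _) mxE exprS (le_trans (ler_norm_sum _ _ _)) //.
apply: (@le_trans _ _ (\sum_l `|A i l| * bnd A ^+ k)).
  by apply: ler_sum => l _; rewrite normrM ler_wpM2l.
rewrite -mulr_suml; apply: ler_wpM2r; first exact: exprn_ge0.
rewrite [leRHS]/bnd [leRHS](bigD1 i) //= lerDl.
by apply: sumr_ge0 => l _; apply: sumr_ge0.
Qed.

(** The differential equation of the exponential at the level of coefficients, before any
    convergence: formal differentiation is multiplication by [A] on the left. *)
Let diffs_c A i j : pseries_diffs (c A i j) = (fun k => \sum_l A i l * c A l j k).
Proof.
apply/funext => k; rewrite /pseries_diffs /c factS natrM invfM.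
rewrite exprS -[A * _]/(A *m _) mxE mulrCA mulVKf ?pnatr_eq0 //.
by rewrite mulr_suml; apply: eq_bigr => l _; rewrite mulrA.
Qed.

Let cvg_c A i j x : cvgn (pseries (c A i j) x).
Proof.
apply: (@cvg_series_dominated _ 1 (bnd A)) => // k.
by rewrite mul1r normrM normfV normr_nat ler_wpM2r ?invr_ge0 //; exact: mx_exp_bound.
Qed.

Let series_sum A i (x : R) (d : 'I_N -> nat -> R) :
  pseries (fun k => \sum_l A i l * d l k) x = (fun k => \sum_l A i l * pseries (d l) x k).
Proof.
apply/funext => k; rewrite /pseries /series /=.
under eq_bigr do rewrite mulr_suml.
rewrite exchange_big /=; apply: eq_bigr => l _.
by rewrite mulr_sumr; apply: eq_bigr => m _; rewrite mulrA.
Qed.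

Let cvg_suml A i (v : 'I_N -> nat -> R) : (forall l, cvgn (v l)) ->
  (fun k => \sum_l A i l * v l k) @ \oo --> \sum_l A i l * limn (v l).
Proof.
move=> cv; rewrite (_ : (fun k => _) = \sum_l (A i l *: v l)); last first.
  by apply/funext => k; rewrite fct_sumE.
apply: (big_ind2 (fun (u : nat -> R) (x : R) => u @ \oo --> x)) => [|u x w y|l _].
- exact: cvg_cst.
- exact: cvgD.
- by apply: (@cvgMl_tmp _ _ _ _ (v l) (A i l)); exact: cv.
Qed.

Let is_derive_c A i j (t : R) :
  is_derive t 1 (fun t => limn (pseries (c A i j) t))
    (\sum_l A i l * limn (pseries (c A l j) t)).
Proof.
have cd i' j' x : cvgn (pseries (pseries_diffs (c A i' j')) x).
  rewrite diffs_c series_sum; apply/cvg_ex; eexists; apply: cvg_suml => l; exact: cvg_c.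
(* Termwise differentiation at [t] needs convergence at some point of larger absolute value; adding
   1 provides one. *)
have cK := @cvg_c A i j (`|t| + 1); have dK := @cd i j (`|t| + 1).
have := @pseries_snd_diffs _ (c A i j) (`|t| + 1) t cK dK.
rewrite diffs_c series_sum.
have -> : limn (fun k => \sum_l A i l * pseries [eta c A l j] t k) =
    \sum_l A i l * limn (pseries (c A l j) t).
  apply: cvg_lim => //; apply: cvg_suml => l; exact: cvg_c.
apply.
- have -> : pseries_diffs (fun k => \sum_l A i l * c A l j k) =
    (fun k => \sum_l A i l * pseries_diffs (c A l j) k).
    apply/funext => k; rewrite /pseries_diffs mulr_sumr; apply: eq_bigr => l _.
    by rewrite mulrCA.
  by rewrite series_sum; apply/cvg_ex; eexists; apply: cvg_suml => l; exact: cd.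
- by rewrite [ltRHS]ger0_norm ?addr_ge0 // ltrDl.
Qed.

Lemma mexpE A i j (t : R) :
  mexp (t *: A) i j = limn (pseries (c A i j) t).
Proof.
rewrite /mexp (_ : lim _ = \matrix_(i, j) limn (pseries (c A i j) t)) ?mxE //.
apply: cvg_lim => //; apply: mx_norm_lim => i' j'; rewrite mxE.
rewrite (_ : (fun k => _) = pseries (c A i' j') t); first exact: cvg_c.
apply/funext => k; rewrite /series /pseries /= summxE; apply: eq_bigr => l _.
have -> : (t *: A) ^+ l = t ^+ l *: A ^+ l by exact: exprZn.
by rewrite /c !mxE; ring.
Qed.

Lemma is_derive_mexp A i j (t : R) :
  is_derive t 1 (fun t => mexp (t *: A) i j) ((A *m mexp (t *: A)) i j).
Proof.
have -> : (fun t => mexp (t *: A) i j) = (fun t => limn (pseries (c A i j) t)).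
  by apply/funext => s; rewrite mexpE.
rewrite mxE; under eq_bigr do rewrite mexpE; exact: is_derive_c.
Qed.

Lemma mexp_nilpotent A m : A ^+ m = 0 -> mexp A = \sum_(0 <= k < m) k`!%:R^-1 *: A ^+ k.
Proof.
move=> Am; apply: cvg_lim => //; apply: cvg_near_cst; near=> k.
have mk : (m <= k)%N by near: k; exact: nbhs_infty_ge.
rewrite /series /= (big_cat_nat (leq0n m) mk) /= [X in _ + X]big1_seq ?addr0 // => l.
rewrite mem_index_iota => /andP[_ /andP[ml _]].
by rewrite -(subnK ml) exprD Am mulr0 scaler0.
Unshelve. all: by end_near. Qed.

Lemma mexp0 : mexp (0 : Mat) = 1%:M.
Proof.
rewrite (@mexp_nilpotent _ 1) ?expr1 // big_nat1 expr0 fact0 invr1 scale1r //.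
Qed.

Lemma mexp_diag (d : 'rV[R]_N) : mexp (diag_mx d) = diag_mx (map_mx (@expR R) d).
Proof.
have pow k : (diag_mx d : Mat) ^+ k = diag_mx (map_mx (fun x => x ^+ k) d).
  elim: k => [|k IH].
    by rewrite expr0; apply/matrixP => i j; rewrite !mxE expr0.
  rewrite exprS IH -[_ * _]/(_ *m _) mulmx_diag; congr diag_mx.
  by apply/rowP => i; rewrite !mxE exprS.
apply/matrixP => i j; rewrite -(scale1r (diag_mx d)) mexpE !mxE.
case: (eqVneq i j) => [<-|ij].
  rewrite mulr1n /expR; congr (limn _); apply/funext => k.
  rewrite /pseries /series /=; apply: eq_bigr => l _.
  by rewrite /c /exp_coeff /= pow !mxE eqxx mulr1n expr1n mulr1.
rewrite mulr0n (_ : pseries _ _ = cst 0) ?lim_cst //; apply/funext => k.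
rewrite /pseries /series /= big1 // => l _.
by rewrite /c pow !mxE (negbTE ij) mulr0n !mul0r.
Qed.

End MatrixExponential.

(** * Charts and tangent vectors *)

Local Notation atl M := (@atlas _ _ M).

Section Charts.
Variable R : realType.
Implicit Types E F G : normedModType R.

(** A common interface for manifolds and for model spaces [vect E], so that maps between manifolds
    and real- or matrix-valued functions obey the same lemmas. *)
Definition good_atlas E (M : charted E) : Prop :=
  [/\ fin_basis E, forall c, atl M c -> is_chart c,
      forall x : M, exists2 c, atl M c & cdom c x
    & forall c d, atl M c -> atl M d -> compatible c d].

Lemma manifold_good n (M : manifold R n) : good_atlas M.
Proof. by have [_ _ ? ? ?] := manifoldP M; split=> //; exact: fin_basis_mx. Qed.

Lemma vect_good E : fin_basis E -> good_atlas (vect E).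
Proof.
move=> bE; split=> // [c ->|x|c d -> ->].
- split=> //=; first exact: openT.
  + by rewrite image_id; exact: openT.
  + by move=> x _; exact: cvg_id.
  + by move=> x _; exact: cvg_id.
- by exists (Chart setT id id).
- move=> k; apply: (@Ck_on_sub _ _ _ _ setT) => //.
  apply: (@Ck_on_linear _ _ _ _ _ (idfun : {linear E -> E})) => x; exact: cvg_id.
Qed.

Section OneManifold.
Variables (E : normedModType R) (M : charted E).
Hypothesis gM : good_atlas M.
Implicit Types (c d : chart M E) (x : M).

Lemma cmap_cont c x : atl M c -> cdom c x -> {for x, continuous (cmap c)}.
Proof. by move=> ac cx; have [_ /(_ _ ac)[_ _ _ + _] _ _] := gM; apply. Qed.

Lemma cinvK c x : atl M c -> cdom c x -> cinv c (cmap c x) = x.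
Proof. by move=> ac cx; have [_ /(_ _ ac)[_ _ + _ _] _ _] := gM; apply. Qed.

Lemma cinv_cont c x : atl M c -> cdom c x -> {for cmap c x, continuous (cinv c)}.
Proof.
by move=> ac cx; have [_ /(_ _ ac)[_ _ _ _ +] _ _] := gM; apply; exists x.
Qed.

Lemma near_cdom c x : atl M c -> cdom c x -> \forall y \near x, cdom c y.
Proof.
move=> ac cx; have [_ /(_ _ ac)[oc _ _ _ _] _ _] := gM.
exact: open_nbhs_nbhs.
Qed.

Lemma near_chart c x : atl M c -> cdom c x ->
  \forall y \near cmap c x, cdom c (cinv c y) /\ cmap c (cinv c y) = y.
Proof.
move=> ac cx; have [_ /(_ _ ac)[_ oi cK _ _] _ _] := gM.
have : nbhs (cmap c x) (cmap c @` cdom c) by apply: open_nbhs_nbhs; split=> //; exists x.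
by apply: filterS => _ [z cz <-]; rewrite cK.
Qed.

Lemma near_cinv c x (P : M -> Prop) : atl M c -> cdom c x ->
  (\forall y \near x, P y) -> \forall y \near cmap c x, P (cinv c y).
Proof.
move=> ac cx Px; have cc := cinv_cont ac cx.
by apply: (cc P); rewrite cinvK.
Qed.

Lemma near_cmap c x (P : E -> Prop) : atl M c -> cdom c x ->
  (\forall y \near cmap c x, P y) -> \forall y \near x, P (cmap c y).
Proof. by move=> ac cx Px; exact: (cmap_cont ac cx Px). Qed.

Lemma smth_transition c d x : atl M c -> atl M d -> cdom c x -> cdom d x ->
  smth (cmap d \o cinv c) (cmap c x).
Proof.
move=> ac ad cx dx; have [_ _ _ /(_ _ _ ac ad) cd] := gM.
exists ((cmap c @` (cdom c `&` cdom d))°); split.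
- exact: open_interior.
- have n1 := near_chart ac cx; have n2 := near_cinv ac cx (near_cdom ad dx).
  rewrite /interior; apply: filterS2 n1 n2 => y [cy e] dy.
  by exists (cinv c y).
- by move=> k; apply: Ck_on_sub (cd k); exact: interior_subset.
Qed.

End OneManifold.

Section Maps.
Variables (E F G : normedModType R) (M : charted E) (N : charted F) (L : charted G).
Hypotheses (gM : good_atlas M) (gN : good_atlas N) (gL : good_atlas L).

Lemma smooth_at_smth (f : M -> N) x c d : smooth_at f x ->
  atl M c -> atl N d -> cdom c x -> cdom d (f x) ->
  smth (cmap d \o f \o cinv c) (cmap c x).
Proof. by move=> [_ sf] ac ad cx dx; have [U []] := sf _ _ ac ad cx dx; exists U. Qed.

(** Other pairs of charts differ from the given one by transition maps, so a single pair suffices.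
    Continuity is a separate premise because it keeps [f] inside the domain of [d] near [x]. *)
Lemma smooth_at_intro (f : M -> N) x c d : {for x, continuous f} ->
  atl M c -> atl N d -> cdom c x -> cdom d (f x) ->
  smth (cmap d \o f \o cinv c) (cmap c x) -> smooth_at f x.
Proof.
move=> cf ac ad cx dx sf; split=> // c' d' ac' ad' cx' dx'.
suff [U [oU Ux sU]] : smth (cmap d' \o f \o cinv c') (cmap c' x) by exists U.
have [bE _ _ _] := gM; have [bF _ _ _] := gN.
have s1 := smth_transition gM ac' ac cx' cx.
have s2 := smth_transition gN ad ad' dx dx'.
have s12 : smth (fun y => (cmap d \o f \o cinv c) ((cmap c \o cinv c') y)) (cmap c' x).
  by apply: smth_comp => //; rewrite /= (cinvK gM ac' cx').
have s123 : smth (fun y => (cmap d' \o cinv d) ((cmap d \o f \o cinv c) ((cmap c \o cinv c') y))) (cmap c' x).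
  by apply: (smth_comp bF s12); rewrite /= (cinvK gM ac' cx') (cinvK gM ac cx).
apply: smth_ext s123.
have n1 := near_cinv gM ac' cx' (near_cdom gM ac cx).
have n2 : \forall y \near cmap c' x, cdom d (f (cinv c' y)).
  apply: (near_cinv gM ac' cx' (P := fun z => cdom d (f z))).
  exact: (cf _ (near_cdom gN ad dx)).
by apply: filterS2 n1 n2 => y cy dy; rewrite /= (cinvK gM ac cy) (cinvK gN ad dy).
Qed.

Lemma smth_continuous (f : M -> N) x c d :
  atl M c -> atl N d -> cdom c x -> (\forall y \near x, cdom d (f y)) ->
  smth (cmap d \o f \o cinv c) (cmap c x) -> {for x, continuous f}.
Proof.
move=> ac ad cx dx /smth_cont sf.
have c1 : {for x, continuous (cmap d \o f \o cinv c \o cmap c)}.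
  by apply: continuous_comp => //; exact: (cmap_cont gM).
have c2 : {for x, continuous (cinv d \o (cmap d \o f \o cinv c \o cmap c))}.
  apply: continuous_comp => //; rewrite /= (cinvK gM ac cx).
  by apply: (cinv_cont gN) => //; exact: nbhs_singleton dx.
have e : (cinv d \o (cmap d \o f \o cinv c \o cmap c)) x = f x.
  by rewrite /= (cinvK gM ac cx) (cinvK gN ad) //; exact: nbhs_singleton dx.
move: c2; rewrite /prop_for /continuous_at e; apply: cvg_trans.
apply: near_eq_cvg; apply: filterS2 dx (near_cdom gM ac cx) => y dy cy.
by rewrite /= (cinvK gM ac cy) (cinvK gN ad dy).
Qed.

Lemma smooth_at_near (f : M -> N) x : smooth_at f x -> \forall y \near x, smooth_at f y.
Proof.
move=> sf; have [cf _] := sf.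
have [_ _ /(_ x)[c ac cx] _] := gM; have [_ _ /(_ (f x))[d ad dx] _] := gN.
have s1 := smooth_at_smth sf ac ad cx dx.
have n1 := near_cmap gM ac cx (smth_near s1).
have n2 := near_cdom gM ac cx.
have n3 : \forall y \near x, cdom d (f y) := cf _ (near_cdom gN ad dx).
(* Continuity at a nearby [y] requires [f] to stay in the chart on a neighbourhood of [y], not only
   at [y] itself. *)
have n3' : \forall y \near x, \forall z \near y, cdom d (f z) := nbhs_interior n3.
apply: filterS3 n1 n2 n3' => y s1y cy dy.
have dfy := nbhs_singleton dy.
apply: (smooth_at_intro _ ac ad) => //; exact: (smth_continuous ac ad).
Qed.

Lemma smooth_at_ext (f g : M -> N) x : (\forall y \near x, f y = g y) ->
  smooth_at f x -> smooth_at g x.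
Proof.
move=> fg sf; have [cf _] := sf.
have [_ _ /(_ x)[c ac cx] _] := gM; have [_ _ /(_ (f x))[d ad dx] _] := gN.
have fgx := nbhs_singleton fg.
apply: (smooth_at_intro _ ac ad) => //; rewrite -?fgx //.
  move: cf; rewrite /prop_for /continuous_at fgx; apply: cvg_trans.
  by apply: near_eq_cvg; exact: fg.
apply: smth_ext (smooth_at_smth sf ac ad cx dx).
by apply: filterS (near_cinv gM ac cx fg) => y /= ->.
Qed.

End Maps.

Lemma smooth_at_comp E F G (M : charted E) (N : charted F) (L : charted G)
  (f : M -> N) (g : N -> L) x :
  good_atlas M -> good_atlas N -> good_atlas L ->
  smooth_at f x -> smooth_at g (f x) -> smooth_at (g \o f) x.
Proof.
move=> gM gN gL sf sg; have [cf _] := sf; have [cg _] := sg.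
have [_ _ /(_ x)[c ac cx] _] := gM; have [bF _ /(_ (f x))[d ad dx] _] := gN.
have [_ _ /(_ (g (f x)))[e ae ex] _] := gL.
apply: (smooth_at_intro gM gL _ ac ae) => //; first exact: continuous_comp.
have s1 := smooth_at_smth sf ac ad cx dx.
have s2 := smooth_at_smth sg ad ae dx ex.
have s12 : smth (fun y => (cmap e \o g \o cinv d) ((cmap d \o f \o cinv c) y)) (cmap c x).
  by apply: smth_comp => //; rewrite /= (cinvK gM ac cx).
apply: smth_ext s12.
have n1 : \forall y \near cmap c x, cdom d (f (cinv c y)).
  apply: (near_cinv gM ac cx (P := fun z => cdom d (f z))).
  exact: (cf _ (near_cdom gN ad dx)).
by apply: filterS n1 => y dy; rewrite /= (cinvK gN ad dy).
Qed.

Definition smooth_fun E F (M : charted E) (f : M -> F) (u : M) : Prop :=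
  @smooth_at R E F M (vect F) f u.

Lemma smooth_fun_smth E F (M : charted E) (f : M -> F) u c :
  smooth_fun f u -> atl M c -> cdom c u -> smth (f \o cinv c) (cmap c u).
Proof.
move=> sf ac cu.
exact: (@smooth_at_smth _ _ M (vect F) f u c (Chart setT id id) sf).
Qed.

Lemma smooth_fun_intro E F (M : charted E) (f : M -> F) u c :
  good_atlas M -> fin_basis F -> atl M c -> cdom c u ->
  smth (f \o cinv c) (cmap c u) -> smooth_fun f u.
Proof.
move=> gM bF ac cu sf; have gF := vect_good bF.
apply: (@smooth_at_intro _ _ M (vect F) gM gF f u c (Chart setT id id)) => //.
apply: (@smth_continuous _ _ M (vect F) gM gF f u c (Chart setT id id)) => //.
exact: filterE.
Qed.

Lemma smooth_fun_near E F (M : charted E) (f : M -> F) u :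
  good_atlas M -> fin_basis F -> smooth_fun f u -> \forall w \near u, smooth_fun f w.
Proof.
by move=> gM bF; exact: (@smooth_at_near _ _ M (vect F) gM (vect_good bF)).
Qed.

Lemma smooth_fun_comp E F G (M : charted E) (N : charted F) (f : M -> N) (g : N -> G) x :
  good_atlas M -> good_atlas N -> fin_basis G ->
  smooth_at f x -> smooth_fun g (f x) -> smooth_fun (g \o f) x.
Proof.
move=> gM gN bG; exact: (@smooth_at_comp _ _ _ M N (vect G) f g x gM gN (vect_good bG)).
Qed.

(** * Tangent vectors in charts *)

Section Tangent.
Variables (E : normedModType R) (M : charted E).
Hypothesis gM : good_atlas M.
Implicit Types (c d : chart M E) (u : M) (f : M -> R).

Definition tanv c u v : functional M :=
  germ_only u (fun f => 'D_v (f \o cinv c) (cmap c u)).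

Lemma germ_onlyT u (delta : functional M) f : smooth_fun f u -> germ_only u delta f = delta f.
Proof. by move=> sf; rewrite /germ_only; case: asboolP. Qed.

Lemma germ_onlyF u (delta : functional M) f : ~ smooth_fun f u -> germ_only u delta f = 0.
Proof. by move=> sf; rewrite /germ_only; case: asboolP. Qed.

Lemma tanvE c u v f : smooth_fun f u -> tanv c u v f = 'D_v (f \o cinv c) (cmap c u).
Proof. exact: germ_onlyT. Qed.

Lemma germ_eq u (delta eps : functional M) :
  (forall f, smooth_fun f u -> delta f = eps f) -> germ_only u delta = germ_only u eps.
Proof.
by move=> de; apply/funext => f; rewrite /germ_only; case: asboolP => // /de.
Qed.

Lemma tangent_tanv c u v : atl M c -> cdom c u -> tangent u (tanv c u v).
Proof. by move=> ac cu; exists c, v. Qed.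

Lemma tanv_lin c u a v w : atl M c -> cdom c u ->
  tanv c u (a *: v + w) = (fun f => a * tanv c u v f + tanv c u w f).
Proof.
move=> ac cu; apply/funext => f; case: (pselect (smooth_fun f u)) => sf.
  by rewrite !tanvE // derive_linear //; apply: smth_diff; exact: smooth_fun_smth.
by rewrite /tanv !germ_onlyF // mulr0 addr0.
Qed.

Lemma tanv_change c d u v : atl M c -> atl M d -> cdom c u -> cdom d u ->
  tanv c u v = tanv d u ('D_v (cmap d \o cinv c) (cmap c u)).
Proof.
move=> ac ad cu du; apply: germ_eq => f sf.
have s1 := smth_transition gM ac ad cu du.
have s2 := smooth_fun_smth sf ad du.
have e : (cmap d \o cinv c) (cmap c u) = cmap d u by rewrite /= (cinvK gM).
rewrite -e -(derive_comp v (smth_diff s1)); last by rewrite e; exact: smth_diff.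
apply: near_eq_derive.
apply: filterS (near_cinv gM ac cu (near_cdom gM ad du)) => y dy.
by rewrite /= (cinvK gM ad dy).
Qed.

Lemma tangentP c u delta : atl M c -> cdom c u -> tangent u delta ->
  exists v, delta = tanv c u v.
Proof.
move=> ac cu [d [v [ad du ->]]].
by exists ('D_v (cmap c \o cinv d) (cmap d u)); rewrite -tanv_change.
Qed.

Lemma tangent_germ u delta : tangent u delta -> germ_only u delta = delta.
Proof.
move=> [c [v [ac cu ->]]]; apply: germ_eq => f sf.
by rewrite germ_onlyT.
Qed.

(** Both functionals vanish on functions that are not smooth at [u], so smooth test functions decide
    equality. Identities between tangent vectors are reduced to identities between functions in this
    way. *)
Lemma tangent_eq u delta eps : tangent u delta -> tangent u eps ->
  (forall f, smooth_fun f u -> delta f = eps f) -> delta = eps.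
Proof.
by move=> td te de; rewrite -(tangent_germ td) -(tangent_germ te); exact: germ_eq.
Qed.

(** The test functions are the chart coordinates [k i \o cmap c]; each one reads off a coordinate of
    the direction. *)
Lemma tanv_inj c u v w : atl M c -> cdom c u -> tanv c u v = tanv c u w -> v = w.
Proof.
move=> ac cu e; have [bE _ _ _] := gM; have [I [b [k [ck kb]]]] := bE.
rewrite (kb v) (kb w); apply: eq_bigr => i _; congr (_ *: _).
have near_k : \forall y \near cmap c u, k i y = ((k i \o cmap c) \o cinv c) y.
  by apply: filterS (near_chart gM ac cu) => y [_] /= ->.
have sk : smooth_fun (k i \o cmap c) u.
  apply: (smooth_fun_intro gM (fin_basis_real R) ac cu).
  by apply: (smth_ext near_k); exact: smth_linear.
have := congr1 (fun delta : functional M => delta (k i \o cmap c)) e.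
rewrite !tanvE // -!(near_eq_derive _ near_k) !derive_lin //.
Qed.

Lemma tangent_lin u a delta eps : tangent u delta -> tangent u eps ->
  tangent u (fun f => a * delta f + eps f).
Proof.
move=> [c [v [ac cu ->]]] /(tangentP ac cu)[w ->].
by rewrite -/(tanv c u v) -tanv_lin //; exact: tangent_tanv.
Qed.

End Tangent.

Lemma pushforwardE E F (M : charted E) (N : charted F) (f : M -> N) u delta g :
  smooth_fun g (f u) -> pushforward f u delta g = delta (g \o f).
Proof. exact: germ_onlyT. Qed.

Lemma pushforward_tanv E F (M : charted E) (N : charted F) (f : M -> N) u v c d :
  good_atlas M -> good_atlas N -> smooth_at f u ->
  atl M c -> cdom c u -> atl N d -> cdom d (f u) ->
  pushforward f u (tanv c u v) = tanv d (f u) ('D_v (cmap d \o f \o cinv c) (cmap c u)).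
Proof.
move=> gM gN sf ac cu ad du; apply: germ_eq => g sg.
have sgf : smooth_fun (g \o f) u by apply: smooth_fun_comp => //; exact: fin_basis_real.
have s1 := smooth_at_smth sf ac ad cu du.
have s2 := smooth_fun_smth sg ad du.
rewrite tanvE //.
have e : (cmap d \o f \o cinv c) (cmap c u) = cmap d (f u) by rewrite /= (cinvK gM).
rewrite -e -(derive_comp v (smth_diff s1)); last by rewrite e; exact: smth_diff.
apply: near_eq_derive.
have [cf _] := sf.
have n1 : \forall y \near cmap c u, cdom d (f (cinv c y)).
  apply: (near_cinv gM ac cu (P := fun z => cdom d (f z))).
  exact: (cf _ (near_cdom gN ad du)).
by apply: filterS n1 => y dy; rewrite /= (cinvK gN ad dy).
Qed.

Lemma pushforward_tangent E F (M : charted E) (N : charted F) (f : M -> N) u delta :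
  good_atlas M -> good_atlas N -> smooth_at f u -> tangent u delta ->
  tangent (f u) (pushforward f u delta).
Proof.
move=> gM gN sf [c [v [ac cu ->]]].
have [_ _ /(_ (f u))[d ad du] _] := gN.
by rewrite -/(tanv c u v) (pushforward_tanv v gM gN sf ac cu ad du); exact: tangent_tanv.
Qed.

Lemma tangent_near E (M : charted E) (u : M) delta f g : good_atlas M ->
  tangent u delta -> (\forall w \near u, f w = g w) -> smooth_fun f u -> delta f = delta g.
Proof.
move=> gM [c [v [ac cu ->]]] fg sf.
have sg : smooth_fun g u.
  by apply: (@smooth_at_ext _ _ M (vect R) gM (vect_good (fin_basis_real R)) f g).
rewrite -/(tanv c u v) !tanvE //; apply: near_eq_derive.
exact: (near_cinv gM ac cu fg).
Qed.

End Charts.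

(** * The conformal Lie algebra *)

Section OneByOne.
Variable R : realType.

Lemma mx00 : (0 : 'M[R]_1) 0 0 = 0. Proof. by rewrite mxE. Qed.

Lemma opp00 (M : 'M[R]_1) : (- M) 0 0 = - M 0 0. Proof. by rewrite mxE. Qed.

Lemma add00 (M M' : 'M[R]_1) : (M + M') 0 0 = M 0 0 + M' 0 0.
Proof. by rewrite mxE. Qed.

Lemma scale00 k (M : 'M[R]_1) : (k *: M) 0 0 = k * M 0 0. Proof. by rewrite mxE. Qed.

End OneByOne.

Local Notation simpmx := (mulmx0, mul0mx, mul1mx, mulmx1, mx00, opp00, scale00,
  scaler0, scale0r, scale1r, scalerN, scaleNr, mulmxN, mulNmx,
  mulr0, mul0r, mulr1, mul1r, mulrN, mulNr, oppr0, opprK, addr0, add0r, trmx0, trmx1).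

Section ConformalAlgebra.
Variables (R : realType) (p q : nat).
Notation n := (p + q)%N.
Notation N := (1 + (p + q + 1))%N.
Notation Mat := 'M[R]_N.
Notation J := (Jpq R p q).
Notation mx3 := (@mx3 R p q).
Implicit Types (B h : Mat).

Lemma mx3_eta (B : Mat) : exists a Z b X A Y c W d, B = mx3 a Z b X A Y c W d.
Proof.
exists (ulsubmx B 0 0), (lsubmx (ursubmx B)), (rsubmx (ursubmx B) 0 0).
exists (usubmx (dlsubmx B)), (ulsubmx (drsubmx B)), (ursubmx (drsubmx B)).
exists (dsubmx (dlsubmx B) 0 0), (dlsubmx (drsubmx B)), (drsubmx (drsubmx B) 0 0).
by rewrite /Defs.mx3 -!mx11_scalar hsubmxK vsubmxK !submxK.
Qed.

Lemma mx3_inj a Z b X A Y c W d a' Z' b' X' A' Y' c' W' d' :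
  mx3 a Z b X A Y c W d = mx3 a' Z' b' X' A' Y' c' W' d' :> Mat ->
  [/\ a = a', Z = Z' & b = b'] /\ [/\ X = X', A = A' & Y = Y'] /\
  [/\ c = c', W = W' & d = d'].
Proof.
have si (x y : R) : (x%:M : 'M[R]_1) = y%:M -> x = y.
  by move=> /matrixP /(_ 0 0); rewrite !mxE eqxx !mulr1n.
rewrite /Defs.mx3 => /eq_block_mx[/si -> /eq_row_mx[-> /si ->] /eq_col_mx[-> /si ->]].
by move=> /eq_block_mx[-> -> -> /si ->].
Qed.

Lemma mx3_congr a Z b X A Y c W d a' Z' b' X' A' Y' c' W' d' :
  a = a' -> Z = Z' -> b = b' -> X = X' -> A = A' -> Y = Y' ->
  c = c' -> W = W' -> d = d' ->
  mx3 a Z b X A Y c W d = mx3 a' Z' b' X' A' Y' c' W' d'.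
Proof. by move=> -> -> -> -> -> -> -> -> ->. Qed.

Lemma mx3_mul a Z b X A Y c W d a' Z' b' X' A' Y' c' W' d' :
  (mx3 a Z b X A Y c W d *m mx3 a' Z' b' X' A' Y' c' W' d' : Mat) =
  mx3 (a * a' + (Z *m X') 0 0 + b * c') (a *: Z' + Z *m A' + b *: W')
      (a * b' + (Z *m Y') 0 0 + b * d')
      (a' *: X + A *m X' + c' *: Y) (X *m Z' + A *m A' + Y *m W')
      (b' *: X + A *m Y' + d' *: Y)
      (c * a' + (W *m X') 0 0 + d * c') (c *: Z' + W *m A' + d *: W')
      (c * b' + (W *m Y') 0 0 + d * d').
Proof.
have sc (x y : R) (M : 'M[R]_1) : (x * y + M 0 0)%:M = x%:M *m y%:M + M.
  by rewrite [M in RHS]mx11_scalar -scalar_mxM -raddfD.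
have s3 (x y z t : R) (M : 'M[R]_1) :
   (x * y + M 0 0 + z * t)%:M = x%:M *m y%:M + (M + z%:M *m t%:M).
  by rewrite [M in RHS]mx11_scalar -!scalar_mxM -!raddfD addrA.
have sr m (x : R) (M : 'M[R]_(m, 1)) : x *: M = M *m x%:M by rewrite mul_mx_scalar.
rewrite /Defs.mx3 mulmx_block mul_row_col mul_mx_row mul_row_block mul_col_mx.
rewrite mul_block_col mul_col_row mulmx_block !add_row_mx add_col_mx add_block_mx.
rewrite !s3 !sr -?mul_scalar_mx -!scalar_mxM ?mul_mx_scalar ?mul_scalar_mx.
rewrite !addrA.
by [].
Qed.

Lemma mx3_add a Z b X A Y c W d a' Z' b' X' A' Y' c' W' d' :
  (mx3 a Z b X A Y c W d + mx3 a' Z' b' X' A' Y' c' W' d' : Mat) =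
  mx3 (a + a') (Z + Z') (b + b') (X + X') (A + A') (Y + Y') (c + c') (W + W') (d + d').
Proof.
by rewrite /Defs.mx3 add_block_mx add_row_mx add_col_mx add_block_mx -!raddfD.
Qed.

Lemma mx3_scale k a Z b X A Y c W d :
  (k *: mx3 a Z b X A Y c W d : Mat) =
  mx3 (k * a) (k *: Z) (k * b) (k *: X) (k *: A) (k *: Y) (k * c) (k *: W) (k * d).
Proof.
by rewrite /Defs.mx3 !(scale_block_mx, scale_row_mx, scale_col_mx, scale_scalar_mx).
Qed.

Lemma mx3_opp a Z b X A Y c W d :
  - mx3 a Z b X A Y c W d = mx3 (- a) (- Z) (- b) (- X) (- A) (- Y) (- c) (- W) (- d).
Proof. by rewrite -scaleN1r mx3_scale !scaleN1r !mulN1r. Qed.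

Lemma mx3_tr a Z b X A Y c W d :
  (mx3 a Z b X A Y c W d : Mat)^T = mx3 a X^T c Z^T A^T W^T b Y^T d.
Proof.
by rewrite /Defs.mx3 !(tr_block_mx, tr_row_mx, tr_col_mx, tr_scalar_mx).
Qed.

Lemma mx3_1 : (1%:M : Mat) = mx3 1 0 0 0 1%:M 0 0 0 1.
Proof. by rewrite /Defs.mx3 -!scalar_mx_block /= !raddf0 row_mx0 col_mx0 -scalar_mx_block. Qed.

Lemma mx3_0 : (0 : Mat) = mx3 0 0 0 0 0 0 0 0 0.
Proof. by rewrite /Defs.mx3 !raddf0 row_mx0 col_mx0 block_mx0 block_mx0. Qed.

Lemma JJ : J *m J = 1%:M.
Proof. by rewrite /Jpq mulmx_block !simpmx -scalar_mx_block. Qed.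

Lemma J_tr : J^T = J.
Proof. by rewrite /Jpq tr_block_mx !trmx0 trmx1 raddfN /= trmx1. Qed.

(** The matrix of the quadratic form preserved by O(p+1, q+1). With it the group and its Lie algebra
    are described by equations instead of block forms. *)
Definition Smx : Mat := mx3 0 0 1 0 J 0 1 0 0.

Lemma SS : Smx *m Smx = 1%:M.
Proof. by rewrite /Smx mx3_mul mx3_1 JJ !simpmx. Qed.

Lemma S_tr : Smx^T = Smx.
Proof. by rewrite /Smx mx3_tr !trmx0 J_tr. Qed.

Lemma mul_S_mx3 a Z b X A Y c W d :
  Smx *m mx3 a Z b X A Y c W d = mx3 c W d (J *m X) (J *m A) (J *m Y) a Z b.
Proof. by rewrite /Smx mx3_mul !simpmx. Qed.

Lemma mul_mx3_S a Z b X A Y c W d :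
  mx3 a Z b X A Y c W d *m Smx = mx3 b (Z *m J) a Y (A *m J) X d (W *m J) c.
Proof. by rewrite /Smx mx3_mul !simpmx. Qed.

Definition is_g (B : Mat) : Prop := B^T *m Smx + Smx *m B = 0.

Lemma is_gE a Z b X A Y c W d : is_g (mx3 a Z b X A Y c W d) <->
  mx3 (c + c) ((J *m X)^T + W) (a + d) (W^T + J *m X) ((J *m A)^T + J *m A)
      (Z^T + J *m Y) (d + a) ((J *m Y)^T + Z) (b + b) = 0.
Proof.
rewrite /is_g -{1}S_tr -trmx_mul mul_S_mx3 mx3_tr mx3_add.
by [].
Qed.

(** Comparing blocks in the equation kills the two corner entries and expresses the last row and
    column through the first column and row. The equation makes closure under brackets and
    conjugation short; the block form supplies coordinates. *)
Lemma lie_gP (B : Mat) : lie_g B <-> is_g B.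
Proof.
split=> [[a [X [A [Z [oA ->]]]]]|].
  rewrite /gmx is_gE mx3_0 !(mulmxN, mulmxA) JJ mul1mx.
  rewrite !(trmx_mul, J_tr) linearN /= trmx_mul trmxK J_tr.
  apply: mx3_congr; rewrite ?addr0 ?subrr ?addNr //.
    by rewrite linearN /= trmxK addrC subrr.
have [a [Z [b [X [A [Y [c [W [d ->]]]]]]]]] := mx3_eta B.
move=> /is_gE; rewrite mx3_0 => /mx3_inj[[c2 WX ad] [[_ oA ZY] [_ _ b2]]].
exists a, X, A, Z; split; first by rewrite /o_pq -[in X in X + _]J_tr -trmx_mul.
have half (x : R) : x + x = 0 -> x = 0.
  by move=> /eqP; rewrite -mulr2n mulrn_eq0 => /orP[//|/eqP].
rewrite /gmx (half _ c2) (half _ b2); apply: mx3_congr => //.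
- have -> : Z^T = - (J *m Y) by apply/eqP; rewrite -addr_eq0; exact/eqP.
  by rewrite mulmxN mulmxA JJ mul1mx opprK.
- apply/eqP; rewrite -addr_eq0 addrC; apply/eqP.
  by move: WX; rewrite trmx_mul J_tr.
- by apply/eqP; rewrite -addr_eq0 addrC; apply/eqP.
Qed.

Lemma is_g_lin k (A B : Mat) : is_g A -> is_g B -> is_g (k *: A + B).
Proof.
rewrite /is_g => gA gB; rewrite linearD linearZ /= mulmxDl mulmxDr -scalemxAl -scalemxAr.
by rewrite addrACA -scalerDr gA gB scaler0 addr0.
Qed.

Lemma is_g_brk (A B : Mat) : is_g A -> is_g B -> is_g (brk A B).
Proof.
have gE (C : Mat) : is_g C -> C^T *m Smx = - (Smx *m C).
  by move=> gC; apply/eqP; rewrite -addr_eq0; exact/eqP.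
move=> /gE gA /gE gB; rewrite /is_g /brk linearB /= !trmx_mul mulmxBl mulmxBr.
rewrite -!mulmxA gA gB !mulmxN !mulmxA gA gB !mulNmx !opprK.
by rewrite -!mulmxA; rewrite addrC subrKA subrr.
Qed.

(** The first column vanishes below its top entry: the isotropic line spanned by the first basis
    vector is preserved. Within G and its Lie algebra this one linear condition cuts out P and p. *)
Definition upp (B : Mat) : Prop := dlsubmx B = 0.

Lemma upp_mx3 a Z b X A Y c W d : upp (mx3 a Z b X A Y c W d) <-> X = 0 /\ c = 0.
Proof.
rewrite /upp /Defs.mx3 block_mxKdl; split=> [|[-> ->]]; last by rewrite raddf0 col_mx0.
rewrite -col_mx0 => /eq_col_mx[-> /matrixP/(_ 0 0)].
by rewrite !mxE eqxx mulr1n.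
Qed.

Lemma upp_mul (A B : Mat) : upp A -> upp B -> upp (A *m B).
Proof.
rewrite /upp => uA uB; rewrite -(submxK A) -(submxK B) mulmx_block block_mxKdl.
by rewrite uA uB mul0mx mulmx0 addr0.
Qed.

Lemma upp_lin k (A B : Mat) : upp A -> upp B -> upp (k *: A + B).
Proof.
rewrite /upp => uA uB; rewrite -(submxK A) -(submxK B) scale_block_mx add_block_mx.
by rewrite block_mxKdl uA uB scaler0 addr0.
Qed.

Lemma lie_pP (B : Mat) : lie_p B <-> is_g B /\ upp B.
Proof.
split=> [[a [A [Z [oA ->]]]]|[/lie_gP[a [X [A [Z [oA ->]]]]] /upp_mx3[-> _]]].
  by split; [apply/lie_gP; exists a, 0, A, Z|apply/upp_mx3].
by exists a, A, Z.
Qed.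

Lemma lie_p_g (B : Mat) : lie_p B -> lie_g B.
Proof. by move=> /lie_pP[? _]; exact/lie_gP. Qed.

Lemma lie_p_lin k (A B : Mat) : lie_p A -> lie_p B -> lie_p (k *: A + B).
Proof.
by move=> /lie_pP[gA uA] /lie_pP[gB uB]; apply/lie_pP; split; [exact: is_g_lin|exact: upp_lin].
Qed.

Lemma lie_g_lin k (A B : Mat) : lie_g A -> lie_g B -> lie_g (k *: A + B).
Proof. by move=> /lie_gP ? /lie_gP ?; apply/lie_gP; exact: is_g_lin. Qed.

Definition is_G (h : Mat) : Prop := h^T *m Smx *m h = Smx.

Lemma is_G_mul (g h : Mat) : is_G g -> is_G h -> is_G (g *m h).
Proof. by rewrite /is_G => Gg Gh; rewrite trmx_mul -{2}Gh -{2}Gg !mulmxA. Qed.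

Lemma is_G_inv (h : Mat) : is_G h -> h \in unitmx /\ invmx h = Smx *m h^T *m Smx.
Proof.
move=> Gh; have e : Smx *m h^T *m Smx *m h = 1%:M by rewrite -!mulmxA (mulmxA h^T) Gh SS.
have [uh uh'] := mulmx1_unit e; split=> //.
by rewrite -[LHS]mul1mx -e mulmxK.
Qed.

(** The cube of [g1 Z] is zero, so the series stops at the quadratic term, which only fills the
    upper right corner. *)
Lemma mexp_g1 (Z : 'rV[R]_n) :
  mexp (g1 Z) = mx3 1 Z (- ((Z *m J *m Z^T) 0 0 / 2)) 0 1%:M (- (J *m Z^T)) 0 0 1.
Proof.
have e : g1 Z = mx3 0 Z 0 0 0 (- (J *m Z^T)) 0 0 0.
  by rewrite /g1 /gmx !simpmx.
have e2 : (g1 Z : Mat) *m g1 Z = mx3 0 0 (- (Z *m J *m Z^T) 0 0) 0 0 0 0 0 0.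
  by rewrite e mx3_mul !simpmx mulmxA.
have e3 : (g1 Z : Mat) ^+ 3 = 0.
  by rewrite !exprS expr0 mulr1 -[_ * (_ * _)]/(_ *m (_ *m _)) e2 e mx3_mul !simpmx mx3_0.
rewrite (@mexp_nilpotent _ _ _ _ 3) // !big_nat_recr //= big_geq // add0r.
have e0 : (g1 Z : Mat) ^+ 0 = mx3 1 0 0 0 1%:M 0 0 0 1 by exact: mx3_1.
rewrite e0 expr1 expr2 -[_ * _]/(_ *m _) e2 e !mx3_scale !mx3_add.
rewrite !factE !invr1 !simpmx; apply: mx3_congr => //.
by rewrite mulrC.
Qed.

Lemma mexp_g1_add (Z Z' : 'rV[R]_n) :
  mexp (g1 Z) *m mexp (g1 Z') = mexp (g1 (Z + Z')).
Proof.
have sym : (Z' *m J *m Z^T) 0 0 = (Z *m J *m Z'^T) 0 0.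
  have <- : (Z *m J *m Z'^T)^T = Z' *m J *m Z^T by rewrite !trmx_mul trmxK J_tr mulmxA.
  by rewrite mxE.
rewrite !mexp_g1 mx3_mul !simpmx; apply: mx3_congr => //.
- exact: addrC.
- rewrite linearD /= !(mulmxDl, mulmxDr) !mulmxA !add00 sym.
  by field.
- by rewrite linearD /= mulmxDr opprD addrC.
Qed.

Lemma is_derive_mulmxl (M M' : R -> Mat) (A : Mat) (s : R) i j :
  (forall k l, is_derive s (1 : R) (fun t : R => M t k l) (M' s k l)) ->
  is_derive s (1 : R) (fun t : R => ((M t)^T *m A) i j) (((M' s)^T *m A) i j).
Proof.
move=> dM.
have -> : (fun t : R => ((M t)^T *m A) i j) = \sum_k (fun t => M t k i) * cst (A k j).
  by apply/funext => t; rewrite fct_sumE mxE; apply: eq_bigr => k _; rewrite mxE.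
apply: is_derive_eq; rewrite mxE; apply: eq_bigr => k _.
by rewrite scaler0 add0r mxE mulrC.
Qed.

Lemma is_derive_quad (M M' : R -> Mat) (A : Mat) (s : R) i j :
  (forall k l, is_derive s (1 : R) (fun t : R => M t k l) (M' s k l)) ->
  is_derive s (1 : R) (fun t : R => ((M t)^T *m A *m M t) i j)
    (((M' s)^T *m A *m M s + (M s)^T *m A *m M' s) i j).
Proof.
move=> dM; have dMl k := @is_derive_mulmxl M M' A s i k dM.
have -> : (fun t : R => ((M t)^T *m A *m M t) i j) =
    \sum_k (fun t : R => ((M t)^T *m A) i k) * (fun t => M t k j).
  by apply/funext => t; rewrite fct_sumE mxE.
apply: is_derive_eq; rewrite [RHS]mxE [X in _ = X + _]mxE [X in _ = _ + X]mxE -big_split.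
apply: eq_bigr => k _ /=.
by rewrite addrC; congr (_ + _); rewrite /GRing.scale /= mulrC.
Qed.

(** For [h = mexp (t *: B)] the derivative of [h^T S h] is [h^T (B^T S + S B) h], which is zero; the
    value at [t = 0] is [S]. *)
Lemma mexp_is_G (B : Mat) t : is_g B -> is_G (mexp (t *: B)).
Proof.
move=> gB; apply/matrixP => i j.
have -> : ((mexp (t *: B))^T *m Smx *m mexp (t *: B)) i j
    = ((mexp ((0 : R) *: B))^T *m Smx *m mexp ((0 : R) *: B)) i j.
  apply: (@is_derive_0_is_cst _ (fun t => ((mexp (t *: B))^T *m Smx *m mexp (t *: B)) i j)) => s.
  have := @is_derive_quad (fun t => mexp (t *: B)) (fun t => B *m mexp (t *: B)) Smx s i j
    (fun k l => is_derive_mexp B k l s).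
  rewrite trmx_mul -!mulmxA -mulmxDr (mulmxA B^T) (mulmxA Smx) -mulmxDl.
  by move: gB; rewrite /is_g => ->; rewrite mul0mx mulmx0 mxE.
by rewrite scale0r mexp0 trmx1 mul1mx mulmx1.
Qed.

Lemma uppP (B : Mat) : upp B <-> forall i, B (rshift 1 i) (lshift _ 0) = 0.
Proof.
rewrite /upp; split=> [uB i|uB].
  by have := congr1 (fun M : 'M[R]_(n + 1, 1) => M i 0) uB; rewrite !mxE.
by apply/matrixP => i j; rewrite (ord1 j) !mxE.
Qed.

Lemma upp1 : upp (1%:M : Mat).
Proof. by rewrite mx3_1; apply/upp_mx3. Qed.

Lemma mexp_upp (B : Mat) t : upp B -> upp (mexp (t *: B)).
Proof.
move=> uB; apply/uppP => i; rewrite mexpE.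
have uBk k : upp (B ^+ k).
  elim: k => [|k IH]; first exact: upp1.
  by rewrite exprS; exact: upp_mul.
rewrite (_ : pseries _ _ = cst 0) ?lim_cst //; apply/funext => k.
rewrite /pseries /series /= big1 // => l _.
by have /uppP -> := uBk l; rewrite !mul0r.
Qed.

Lemma G0_form lam (A : 'M[R]_n) : lam != 0 -> O_pq A ->
  is_G (mx3 lam 0 0 0 A 0 0 0 lam^-1).
Proof.
move=> l0 oA; rewrite /is_G mx3_tr -mulmxA mul_S_mx3 mx3_mul !simpmx mulmxA.
by rewrite divff // mulVf // /Smx; move: oA; rewrite /O_pq => ->.
Qed.

Lemma g1_lie_p Z : lie_p (g1 Z : Mat).
Proof. by exists 0, 0, Z; split=> //; rewrite /o_pq trmx0 mul0mx mulmx0 addr0. Qed.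

(** P is the stabilizer in G of the isotropic line. In this form closure under products is evident
    and inverses are explicit, which the factorization in [Pmat] hides. Conversely, for [h]
    preserving the line, [h^T S h = S] determines the last column from the first row and the middle
    block. *)
Lemma PmatP (h : Mat) : Pmat h <-> is_G h /\ upp h.
Proof.
split.
  move=> [_ [Z [[lam [A [l0 oA ->]]] ->]]]; have /lie_pP[gZ uZ] := g1_lie_p Z.
  split.
    apply: is_G_mul; first exact: G0_form.
    by rewrite -[g1 Z]scale1r; exact: mexp_is_G.
  apply: upp_mul; first by apply/upp_mx3.
  by rewrite -[g1 Z]scale1r; exact: mexp_upp.
have [a [Z [b [X [A [Y [c [W [d ->]]]]]]]]] := mx3_eta h.
move=> [Gh /upp_mx3[X0 c0]]; move: Gh; rewrite X0 c0 /is_G mx3_tr -mulmxA mul_S_mx3 mx3_mul.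
rewrite /Smx !simpmx => /mx3_inj[[_ aW ad] [[_ oA eY] [_ _ eb]]].
have a0 : a != 0 by apply/eqP => a0; move: ad; rewrite a0 mul0r => /eqP; rewrite eq_sym oner_eq0.
have W0 : W = 0 by move/eqP: aW; rewrite scaler_eq0 (negbTE a0) => /eqP.
have ed : d = a^-1 by apply: (mulfI a0); rewrite ad divff.
move: oA eY eb; rewrite W0 !simpmx => oA eY eb.
have oA' : A *m J *m A^T *m J = 1%:M.
  by rewrite -mulmxA; apply: mulmx1C; rewrite mulmxA -(mulmxA A^T J A) oA JJ.
(* The first row of [diag(a, A, a^-1) exp(Z')] starts with [a] and [a Z'], which forces
   [Z' = a^-1 Z]; what remains is to check the last column. *)
exists (mx3 a 0 0 0 A 0 0 0 a^-1), (a^-1 *: Z); split.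
  by exists a, A; split=> //; rewrite /O_pq -mulmxA.
have eJY : A^T *m (J *m Y) = - (d *: Z^T).
  by apply/eqP; rewrite -addr_eq0 addrC; exact/eqP.
have eY' : Y = - (d *: (A *m J *m Z^T)).
  rewrite -[LHS]mul1mx -oA' -!mulmxA.
  by rewrite eJY !mulmxN -!scalemxAr.
have eYY : (Y^T *m (J *m Y)) 0 0 = d * (d * (Z *m J *m Z^T) 0 0).
  rewrite {1}eY' linearN /= linearZ /= !trmx_mul trmxK J_tr mulNmx -scalemxAl.
  rewrite opp00 scale00 -!mulmxA eJY !mulmxN -!scalemxAr opp00 scale00 mulrN opprK.
  by rewrite mulmxA.
have trZ : (a^-1 *: Z)^T = a^-1 *: Z^T by rewrite linearZ.
rewrite mexp_g1 mx3_mul !simpmx trZ -!scalemxAr -!scalemxAl !scale00.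
rewrite ed scalerA divff // scale1r; apply: mx3_congr => //.
  move: eb; rewrite eYY ed => eb; apply: (mulfI a0).
  have -> : a * b = (a * a) * (b * a^-1) by field.
  have -> : b * a^-1 = - (a^-1 * (a^-1 * (Z *m J *m Z^T) 0 0)) / 2 by lra.
  by field.
by rewrite eY' ed mulmxA.
Qed.

Lemma Pmat1 : Pmat (1%:M : Mat).
Proof. by apply/PmatP; split; [rewrite /is_G trmx1 mul1mx mulmx1|exact: upp1]. Qed.

Lemma Pmat_mul (g h : Mat) : Pmat g -> Pmat h -> Pmat (g *m h).
Proof.
move=> /PmatP[Gg ug] /PmatP[Gh uh]; apply/PmatP; split; [exact: is_G_mul|exact: upp_mul].
Qed.

Lemma Pmat_form (h : Mat) : Pmat h -> exists lam C Z b Y,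
  [/\ lam != 0, O_pq C, h = mx3 lam Z b 0 C Y 0 0 lam^-1 & is_G h].
Proof.
move=> Ph; have /PmatP[Gh _] := Ph; move: Ph => [_ [Z [[lam [C [l0 oC ->]]] eh]]].
rewrite eh; move: eh; rewrite mexp_g1 mx3_mul !simpmx => eh.
by do 5 eexists; split; [exact: l0|exact: oC|reflexivity|rewrite -eh].
Qed.

Lemma Pmat_unit (h : Mat) : Pmat h -> h \in unitmx.
Proof. by move=> /PmatP[Gh _]; have [] := is_G_inv Gh. Qed.

Lemma Pmat_inv_form lam (C : 'M[R]_n) Z b Y (h : Mat) : is_G h ->
  h = mx3 lam Z b 0 C Y 0 0 lam^-1 ->
  invmx h = mx3 lam^-1 (Y^T *m J) b 0 (J *m C^T *m J) (J *m Z^T) 0 0 lam.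
Proof.
move=> Gh eh; have [_ ->] := is_G_inv Gh.
by rewrite eh mx3_tr mul_S_mx3 mul_mx3_S !simpmx.
Qed.

Lemma Pmat_inv (h : Mat) : Pmat h -> Pmat (invmx h).
Proof.
move=> Ph; have uh := Pmat_unit Ph; have [lam [C [Z [b [Y [_ _ eh Gh]]]]]] := Pmat_form Ph.
apply/PmatP; split; last by rewrite (Pmat_inv_form Gh eh); apply/upp_mx3.
rewrite /is_G -[X in _ *m X *m _]Gh !mulmxA -trmx_mul mulmxV // trmx1 mul1mx.
by rewrite -mulmxA mulmxV // mulmx1.
Qed.

Lemma Pmat_G0 (g : Mat) : G0mat g -> Pmat g.
Proof.
move=> [lam [C [l0 oC ->]]]; apply/PmatP; split; first exact: G0_form.
exact/upp_mx3.
Qed.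

Lemma Pmat_mexp (B : Mat) t : lie_p B -> Pmat (mexp (t *: B)).
Proof. by move=> /lie_pP[gB uB]; apply/PmatP; split; [exact: mexp_is_G|exact: mexp_upp]. Qed.

Lemma Pmat_mexp1 (Z : 'rV[R]_n) : Pmat (mexp (g1 Z)).
Proof. by rewrite -[g1 Z]scale1r; apply: Pmat_mexp; exact: g1_lie_p. Qed.

Lemma Ad_inv_g (h B : Mat) : is_G h -> lie_g B -> lie_g (Ad_inv h B).
Proof.
move=> Gh /lie_gP gB; apply/lie_gP; have [uh eh] := is_G_inv Gh.
have e1 : Smx *m invmx h = h^T *m Smx by rewrite eh -!mulmxA (mulmxA Smx) SS mul1mx.
have e2 : (invmx h)^T *m Smx = Smx *m h by rewrite -{1}S_tr -trmx_mul e1 trmx_mul trmxK S_tr.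
rewrite /is_g /Ad_inv !trmx_mul -!mulmxA e2 (mulmxA Smx (invmx h)) e1.
by rewrite -!mulmxA -mulmxDr !mulmxA -mulmxDl gB mul0mx mulmx0.
Qed.

Lemma Ad_inv_p (h B : Mat) : Pmat h -> lie_p B -> lie_p (Ad_inv h B).
Proof.
move=> Ph pB; have /lie_pP[_ uB] := pB; have /PmatP[Gh uh] := Ph.
have /PmatP[_ uh'] := Pmat_inv Ph.
apply/lie_pP; split; first by apply/lie_gP; apply: Ad_inv_g => //; exact: lie_p_g.
by apply: upp_mul => //; exact: upp_mul.
Qed.

Lemma Ad_inv_lin (h : Mat) k A B : Ad_inv h (k *: A + B) = k *: Ad_inv h A + Ad_inv h B.
Proof. by rewrite /Ad_inv mulmxDr mulmxDl -scalemxAr -scalemxAl. Qed.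

Lemma Ad_invK (h B : Mat) : h \in unitmx -> Ad_inv h (Ad_inv (invmx h) B) = B.
Proof. by move=> uh; rewrite /Ad_inv invmxK !mulmxA mulVmx // mul1mx -mulmxA mulVmx // mulmx1. Qed.

Lemma Ad_invKV (h B : Mat) : h \in unitmx -> Ad_inv (invmx h) (Ad_inv h B) = B.
Proof. by move=> uh; rewrite /Ad_inv invmxK !mulmxA mulmxV // mul1mx -mulmxA mulmxV // mulmx1. Qed.

Lemma brk_Ad (h A B : Mat) : h \in unitmx -> brk (Ad_inv h A) (Ad_inv h B) = Ad_inv h (brk A B).
Proof.
move=> uh; rewrite /brk /Ad_inv mulmxBr mulmxBl !mulmxA.
by rewrite !(mulmxK uh, mulmxKV uh) // -!mulmxA !(mulmxA h (invmx h)) mulmxV // !mul1mx.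
Qed.

Lemma gm1_lie_g X : lie_g (gm1 X : Mat).
Proof. by exists 0, X, 0, 0; split=> //; rewrite /o_pq trmx0 mul0mx mulmx0 addr0. Qed.

Lemma gmxE a X (A : 'M[R]_n) Z : gmx a X A Z = gm1 X + gmx a 0 A Z :> Mat.
Proof. rewrite /gm1 /gmx mx3_add !simpmx; exact: mx3_congr. Qed.

Lemma gm1E X : gm1 X = mx3 0 0 0 X 0 0 0 (- (X^T *m J)) 0.
Proof. by rewrite /gm1 /gmx !simpmx. Qed.

Lemma gm1_lin k X X' : gm1 (k *: X + X') = k *: gm1 X + gm1 X' :> Mat.
Proof.
rewrite !gm1E mx3_scale mx3_add !simpmx; apply: mx3_congr => //.
by rewrite linearP /= mulmxDl -scalemxAl opprD.
Qed.

Lemma brk_gm1 X X' : brk (gm1 X) (gm1 X') = 0 :> Mat.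
Proof.
rewrite /brk !gm1E !mx3_mul !simpmx mx3_opp mx3_add !simpmx mx3_0.
have -> : X'^T *m J *m X = (X^T *m J *m X')^T by rewrite !trmx_mul trmxK J_tr mulmxA.
by rewrite [_^T 0 0]mxE addNr.
Qed.

(** [Ad_inv (invmx h)] is Ad(h). Modulo p, only the G_0 part of [h] acts, by the standard
    representation of G_0 on g/p; the p-valued remainder is left unspecified because [Om] is
    computable on p. *)
Lemma Ad_gm1 lam (C : 'M[R]_n) Z b Y (h : Mat) X : is_G h ->
  h = mx3 lam Z b 0 C Y 0 0 lam^-1 -> O_pq C -> lam != 0 ->
  exists2 B, lie_p B & Ad_inv (invmx h) (gm1 X) = gm1 (lam^-1 *: (C *m X)) + B.
Proof.
move=> Gh eh oC l0; have [uh _] := is_G_inv Gh; have ih := Pmat_inv_form Gh eh.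
have Gih : is_G (invmx h).
  by have /Pmat_inv/PmatP[] : Pmat h by apply/PmatP; split=> //; rewrite eh; exact/upp_mx3.
have [a' [X' [A' [Z' [oA' e']]]]] := Ad_inv_g Gih (gm1_lie_g X).
exists (gmx a' 0 A' Z'); first by exists a', A', Z'.
rewrite e' gmxE; congr (gm1 _ + _).
move: e'; rewrite /Ad_inv invmxK ih eh gm1E !mx3_mul !simpmx /gmx => /mx3_inj[_ [[<- _ _] _]].
by rewrite scalemxAr ?scalemxAl.
Qed.

Lemma gm1_p_inj X X' (B B' : Mat) : lie_p B -> lie_p B' ->
  gm1 X + B = gm1 X' + B' -> X = X'.
Proof.
move=> [a [A [Z [_ ->]]]] [a' [A' [Z' [_ ->]]]]; rewrite -!gmxE.
by move=> /mx3_inj[_ [[]]].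
Qed.

Definition sym_mx (e : R) : Mat := mx3 e 0 0 0 (- e)%:M 0 0 0 e.

Lemma sym_mx_G0 e : e * e = 1 -> G0mat (sym_mx e).
Proof.
move=> ee; have e0 : e != 0.
  by apply/eqP => e0; move: ee; rewrite e0 mul0r => /eqP; rewrite eq_sym oner_eq0.
have ie : e^-1 = e by apply: (mulfI e0); rewrite divff.
exists e, (- e)%:M; split=> //; last by rewrite ie.
by rewrite /O_pq tr_scalar_mx mul_scalar_mx mul_mx_scalar scalerA mulrNN ee scale1r.
Qed.

(** Acting by -1 on g/p makes [C] the scalar matrix [- lam], and orthogonality of [C] then leaves
    [lam * lam = 1]. Positive dimension is what provides a diagonal entry on which to read this. *)
Lemma sym_form (h : Mat) : (0 < n)%N -> Pmat h ->
  (forall X, exists2 B, lie_p B & Ad_inv h (gm1 X) = gm1 (- X) + B) ->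
  exists e Z, e * e = 1 /\ h = sym_mx e *m mexp (g1 Z).
Proof.
move=> n0 Ph symh; have uh := Pmat_unit Ph.
have [g [Z [[lam [C [l0 oC eg]]] eh]]] := Ph.
have [Gh _] := (PmatP h).1 Ph.
have CX (X : 'cV[R]_n) : C *m X = - lam *: X.
  have [B pB e1] := symh X.
  have eh' := eh; move: eh'; rewrite eg mexp_g1 mx3_mul !simpmx => eh'.
  have [B' pB' e2] := Ad_gm1 (- X) Gh eh' oC l0.
  have : Ad_inv (invmx h) (Ad_inv h (gm1 X)) = gm1 X by exact: Ad_invKV.
  rewrite e1 -[gm1 (- X)]scale1r Ad_inv_lin scale1r e2 -addrA => e3.
  have p0 : lie_p (0 : Mat).
    by exists 0, 0, 0; rewrite /gmx !simpmx mx3_0; split; [rewrite /o_pq trmx0 !simpmx|exact: mx3_congr].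
  have p1 : lie_p (B' + Ad_inv (invmx h) B).
    by rewrite -[B']scale1r; apply: lie_p_lin => //; apply: Ad_inv_p => //; exact: Pmat_inv.
  have e4 : gm1 X + 0 = gm1 (lam^-1 *: (C *m - X)) + (B' + Ad_inv (invmx h) B).
    by rewrite addr0 e3.
  have eX := gm1_p_inj p0 p1 e4.
  by rewrite [in RHS]eX mulmxN !scalerN opprK scalerA divff // scale1r.
have eC : C = (- lam)%:M.
  apply/matrixP => i j; have := CX (delta_mx j 0); rewrite -colE => /matrixP/(_ i 0).
  by rewrite !mxE eqxx andbT mulr_natr.
have ll : lam * lam = 1.
  move: oC; rewrite eC /O_pq tr_scalar_mx mul_scalar_mx mul_mx_scalar scalerA mulrNN.
  move=> /(congr1 (fun M => M *m J)); rewrite -scalemxAl JJ => /matrixP/(_ (Ordinal n0) (Ordinal n0)).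
  by rewrite !mxE eqxx mulr1.
have il : lam^-1 = lam by apply: (mulfI l0); rewrite divff.
by exists lam, Z; split=> //; rewrite eh eg eC il.
Qed.

Lemma Ad_sym_gm1 e X : e * e = 1 -> Ad_inv (sym_mx e) (gm1 X) = gm1 (- X).
Proof.
move=> ee; have u := Pmat_unit (Pmat_G0 (sym_mx_G0 ee)).
apply: (can_inj (mulKmx u)); rewrite /Ad_inv !mulmxA mulmxV // mul1mx.
rewrite !gm1E /sym_mx !mx3_mul !simpmx mul_scalar_mx mul_mx_scalar.
by apply: mx3_congr; rewrite // ?linearN /= ?mulNmx ?scalerN ?scaleNr ?opprK.
Qed.

Lemma Ad_sym_p e a (A : 'M[R]_n) Z : e * e = 1 ->
  Ad_inv (sym_mx e) (gmx a 0 A Z) = gmx a 0 A (- Z).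
Proof.
move=> ee; have u := Pmat_unit (Pmat_G0 (sym_mx_G0 ee)).
apply: (can_inj (mulKmx u)); rewrite /Ad_inv !mulmxA mulmxV // mul1mx.
rewrite /gmx /sym_mx !mx3_mul !simpmx !mul_scalar_mx !mul_mx_scalar.
have tN : (- Z)^T = - Z^T by rewrite linearN.
by apply: mx3_congr; rewrite // ?tN ?mulmxN ?scalerN ?scaleNr ?opprK // mulrC.
Qed.

Lemma mexp_g1_sym e Z : mexp (g1 Z) *m sym_mx e = sym_mx e *m mexp (g1 (- Z)).
Proof.
have tN : (- Z)^T = - Z^T by rewrite linearN.
rewrite !mexp_g1 tN !mx3_mul !simpmx; apply: mx3_congr; rewrite // ?mul_scalar_mx ?mul_mx_scalar.
- by rewrite scaleNr.
- by rewrite mulrC.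
- by rewrite scaleNr.
Qed.

Lemma mexp_g1_inv Z : invmx (mexp (g1 Z)) = mexp (g1 (- Z)) :> Mat.
Proof.
have u := Pmat_unit (Pmat_mexp1 Z).
have g10 : g1 0 = 0 :> Mat by rewrite /g1 /gmx !simpmx mx3_0.
by apply: (can_inj (mulKmx u)); rewrite mulmxV // mexp_g1_add subrr g10 mexp0.
Qed.

(** A scalar middle block commutes with every [A], so comparing diagonal blocks in
    [h *m Ad_inv h B = B *m h] allows [lam] and [mu] to be cancelled. *)
Lemma same_diag lam mu Z0 b Y (h : Mat) a (A : 'M[R]_n) Z :
  Pmat h -> h = mx3 lam Z0 b 0 mu%:M Y 0 0 lam^-1 -> lam != 0 -> mu != 0 ->
  o_pq A -> exists Z', Ad_inv h (gmx a 0 A Z) = gmx a 0 A Z'.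
Proof.
move=> Ph eh l0 m0 oA; have u := Pmat_unit Ph.
have pB : lie_p (gmx a 0 A Z) by exists a, A, Z.
have [a' [A' [Z' [_ e]]]] := Ad_inv_p Ph pB.
exists Z'; rewrite e; have : h *m Ad_inv h (gmx a 0 A Z) = gmx a 0 A Z *m h.
  by rewrite /Ad_inv !mulmxA mulmxV // mul1mx.
rewrite e eh /gmx !mx3_mul !simpmx => /mx3_inj[[+ _ _] [[_ + _] _]].
rewrite mulrC mul_scalar_mx mul_mx_scalar => /(mulIf l0) -> eA.
by have -> : A' = A by apply: (scalerI m0).
Qed.

(** Singles out the positions where an element of p ignores its g_1 component; stating the property
    instead of the indices avoids block bookkeeping. Positions where elements of p always vanish are
    included too, harmlessly. *)
Definition diag_pos (i j : 'I_N) : Prop :=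
  forall a (A : 'M[R]_n) Z Z', (gmx a 0 A Z : Mat) i j = (gmx a 0 A Z' : Mat) i j.

Lemma diag_zero (B : Mat) : lie_p B -> (forall i j, diag_pos i j -> B i j = 0) ->
  exists Z, B = g1 Z.
Proof.
move=> [a [A [Z [oA ->]]]] B0; exists Z.
have a0 : a = 0.
  have := B0 (lshift _ 0) (lshift _ 0); rewrite /gmx /Defs.mx3 block_mxEul mxE eqxx mulr1n.
  by apply=> a' A' Z1 Z2; rewrite /gmx /Defs.mx3 !block_mxEul.
have A0 : A = 0.
  apply/matrixP => i j.
  have := B0 (rshift _ (lshift _ i)) (rshift _ (lshift _ j)).
  rewrite /gmx /Defs.mx3 block_mxEdr block_mxEul => ->; first by rewrite mxE.
  by move=> a' A' Z1 Z2; rewrite /gmx /Defs.mx3 !block_mxEdr !block_mxEul.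
by rewrite a0 A0.
Qed.

Definition grading : Mat := gmx 1 0 0 0.

Lemma grading_lie_p : lie_p grading.
Proof. by exists 1, 0, 0; split=> //; rewrite /o_pq trmx0 mul0mx mulmx0 addr0. Qed.

Lemma mx3_diag a (A : 'M[R]_n) d :
  mx3 a 0 0 0 A 0 0 0 d = block_mx a%:M 0 0 (block_mx A 0 0 d%:M).
Proof.
have z0 : (0 : R)%:M = 0 :> 'M[R]_1 by apply/matrixP => i j; rewrite !mxE mul0rn.
by rewrite /Defs.mx3 z0 row_mx0 col_mx0.
Qed.

Lemma diag_mx11 (a : R) : diag_mx (a%:M : 'M[R]_1) = a%:M.
Proof. by apply/matrixP => i j; rewrite !ord1 !mxE eqxx !mulr1n. Qed.

Lemma mexp_grading t : mexp (t *: grading) = mx3 (expR t) 0 0 0 1%:M 0 0 0 (expR t)^-1.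
Proof.
have -> : t *: grading = diag_mx (row_mx t%:M (row_mx 0 (- t)%:M)).
  rewrite /grading /gmx mx3_scale !simpmx mx3_diag !diag_mx_row !diag_mx11.
  by congr block_mx; congr block_mx; apply/matrixP => i j; rewrite !mxE mul0rn.
have m1 (a : R) : map_mx (@expR R) (a%:M : 'M[R]_1) = (expR a)%:M.
  by apply/matrixP => i j; rewrite !ord1 !mxE eqxx !mulr1n.
rewrite mexp_diag !map_row_mx !diag_mx_row mx3_diag -expRN !m1 !diag_mx11.
congr block_mx; congr block_mx.
by apply/matrixP => i j; rewrite !mxE expR0.
Qed.

(** The expansion xi + [Z, xi] + [Z, [Z, xi]] / 2 with xi = J Z^T. For this xi the two contributions
    to the o(p,q) part of [Z, xi] cancel and [Z, xi] = z E; then [Z, z E] / 2 = - (z / 2) Z gives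
    the last term. *)
Lemma Ad_mexp_g1 (Z : 'rV[R]_n) (z : R) : (Z *m J *m Z^T) 0 0 = z ->
  Ad_inv (invmx (mexp (g1 Z))) (gm1 (J *m Z^T)) =
  gm1 (J *m Z^T) + (z *: grading + g1 (- (z / 2) *: Z)).
Proof.
move=> ez; rewrite /Ad_inv invmxK mexp_g1_inv !mexp_g1 gm1E.
have tN : (- Z)^T = - Z^T by rewrite linearN.
have tZ : (- (z / 2) *: Z)^T = - (z / 2) *: Z^T by rewrite linearZ.
have tJ : (J *m Z^T)^T *m J = Z by rewrite trmx_mul trmxK J_tr -mulmxA JJ mulmx1.
rewrite tJ tN !mx3_mul /grading /g1 /gmx !mx3_scale !mx3_add tZ !simpmx mulmxA ez.
rewrite -!scalemxAr.
have zM : Z *m (J *m Z^T) = z%:M by rewrite [LHS]mx11_scalar mulmxA ez.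
have zz : z = z / 2 + z / 2 by rewrite -splitr.
apply: mx3_congr => //.
- by rewrite {1}zz scalerDl opprD addrNK.
- by rewrite -scalemxAl scale00 mulmxA ez; ring.
- by rewrite addNr.
- rewrite -!mulmxA.
  have -> : J *m (Z^T *m (Z *m (J *m Z^T))) = z *: (J *m Z^T).
    by rewrite zM mul_mx_scalar -scalemxAr.
  by rewrite [X in _ + X *: _]zz scalerDl addKr.
Qed.

(** Since [h = mexp (t *: A)] lies in G, its inverse is [S h^T S], so the conjugate [h B S h^T S] is
    quadratic in [h] and no derivative of an inverse is taken. The transposes in [M] and [Q] only
    fit this expression to [is_derive_quad] and [is_derive_mulmxl]. *)
Lemma is_derive_conj (A B : Mat) i j : lie_p A ->
  is_derive (0 : R) (1 : R)
    (fun t : R => (Ad_inv (invmx (mexp (t *: A))) B) i j) ((brk A B) i j).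
Proof.
move=> pA; have /lie_pP[gA _] := pA.
pose M (t : R) : Mat := (mexp (t *: A))^T.
pose M' (t : R) : Mat := (A *m mexp (t *: A))^T.
have dM k l : is_derive (0 : R) (1 : R) (fun t : R => M t k l) (M' 0 k l).
  rewrite (_ : (fun t : R => M t k l) = (fun t : R => mexp (t *: A) l k)); last first.
    by apply/funext => t; rewrite mxE.
  by rewrite /M' mxE; exact: is_derive_mexp.
pose Q (t : R) : Mat := ((M t)^T *m (B *m Smx) *m M t)^T.
pose Q' (t : R) : Mat := ((M' t)^T *m (B *m Smx) *m M t + (M t)^T *m (B *m Smx) *m M' t)^T.
have dQ k l : is_derive (0 : R) (1 : R) (fun t : R => Q t k l) (Q' 0 k l).
  rewrite (_ : (fun t : R => Q t k l) =
      (fun t : R => ((M t)^T *m (B *m Smx) *m M t) l k)); last first.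
    by apply/funext => t; rewrite mxE.
  by rewrite /Q' mxE; exact: is_derive_quad.
have := @is_derive_mulmxl Q Q' Smx 0 i j dQ.
rewrite (_ : (fun t : R => ((Q t)^T *m Smx) i j) =
   (fun t : R => (Ad_inv (invmx (mexp (t *: A))) B) i j)); last first.
  apply/funext => t; rewrite /Ad_inv invmxK.
  have /PmatP[Gt _] := Pmat_mexp t pA; have [_ ->] := is_G_inv Gt.
  by rewrite /Q /M !trmxK !mulmxA.
move=> dd; apply: is_derive_eq.
congr (fun_of_matrix _ i j).
rewrite /Q' /M' /M trmxK scale0r mexp0 !trmxK mulmx1 trmx1 mul1mx !mulmx1 /brk.
rewrite mulmxDl -!mulmxA SS mulmx1; congr (_ + _).
rewrite -mulmxN; congr (_ *m _); apply/eqP; rewrite -addr_eq0.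
have : Smx *m (A^T *m Smx + Smx *m A) = 0 by move: gA; rewrite /is_g => ->; rewrite mulmx0.
by rewrite mulmxDr !mulmxA SS mul1mx => ->.
Qed.

Lemma gm1Z k x : gm1 (k *: x) = k *: gm1 x :> Mat.
Proof.
have -> : k *: x = (k - 1) *: x + x by rewrite scalerBl scale1r subrK.
by rewrite gm1_lin scalerBl scale1r subrK.
Qed.

Lemma gm1N x : gm1 (- x) = - gm1 x :> Mat.
Proof. by rewrite -scaleN1r gm1Z scaleN1r. Qed.

Lemma g1_0 : g1 (0 : 'rV[R]_n) = 0 :> Mat.
Proof. by rewrite /g1 /gmx !simpmx mx3_0. Qed.

Lemma g1Z r (V : 'rV[R]_n) : r *: g1 V = g1 (r *: V) :> Mat.
Proof.
rewrite /g1 /gmx mx3_scale !simpmx; apply: mx3_congr => //.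
have -> : (r *: V)^T = r *: V^T by rewrite linearZ.
by rewrite -scalemxAr.
Qed.

Lemma Ad_invZ (h : Mat) k A : Ad_inv h (k *: A) = k *: Ad_inv h A.
Proof. by rewrite /Ad_inv -scalemxAr -scalemxAl. Qed.

Lemma lie_g_split (A : Mat) : lie_g A -> exists x B, lie_p B /\ A = gm1 x + B.
Proof.
move=> [a [x [D [Z [oD ->]]]]]; exists x, (gmx a 0 D Z); split; last exact: gmxE.
by exists a, D, Z.
Qed.

Lemma lie_gD (A B : Mat) : lie_g A -> lie_g B -> lie_g (A + B).
Proof. by move=> gA gB; rewrite -[A]scale1r; exact: lie_g_lin. Qed.

End ConformalAlgebra.

(** * Cartan geometries *)

Section SmoothMatrices.
Variable R : realType.

Lemma smth_mx (E : normedModType R) m n (f : E -> 'M[R]_(m, n)) x :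
  (forall i j, smth (fun y => f y i j) x) -> smth f x.
Proof.
move=> sf; apply: (@smth_ext _ _ _ (fun y => \sum_i \sum_j f y i j *: delta_mx i j)).
  by apply: filterE => y; rewrite [RHS]matrix_sum_delta.
apply: smth_sum => i _; apply: smth_sum => j _.
by apply: smth_scale; [exact: sf|exact: smth_cst].
Qed.

Lemma smth_entry (E : normedModType R) m n (f : E -> 'M[R]_(m, n)) x i j :
  smth f x -> smth (fun y => f y i j) x.
Proof.
by apply: (@smth_lin_comp _ _ _ _ f (coordl R i j)); exact: coordl_continuous.
Qed.

Lemma smth_neq0 (E : normedModType R) (g : E -> R) x : smth g x -> g x != 0 ->
  \forall y \near x, g y != 0.
Proof. by move=> /smth_cont cg g0; exact: cvgr_neq0 g0. Qed.

Lemma smth_det (E : normedModType R) n (Q : E -> 'M[R]_n) x :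
  (forall i j, smth (fun y => Q y i j) x) -> smth (fun y => \det (Q y)) x.
Proof.
move=> sQ; apply: smth_sum => s _; apply: smth_mul; first exact: smth_cst.
by apply: smth_prod => i _; exact: sQ.
Qed.

Lemma smth_invmx (E : normedModType R) n (Q : E -> 'M[R]_n) x i j :
  (forall i j, smth (fun y => Q y i j) x) -> \det (Q x) != 0 ->
  smth (fun y => invmx (Q y) i j) x.
Proof.
move=> sQ d0; have sd := smth_det sQ.
apply: (@smth_ext _ _ _ (fun y => (\det (Q y))^-1 * \adj (Q y) i j)).
  have n0 : \forall y \near x, \det (Q y) != 0 by exact: smth_neq0 sd d0.
  by apply: filterS n0 => y /= y0; rewrite /invmx unitmxE unitfE y0 [RHS]mxE.
apply: smth_mul; first exact: smth_inv.
apply: (@smth_ext _ _ _ (fun y => (-1) ^+ (j + i) * \det (row' j (col' i (Q y))))).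
  by apply: filterE => y; rewrite mxE /cofactor.
apply: smth_mul; first exact: smth_cst.
apply: smth_det => k l; apply: (@smth_ext _ _ _ (fun y => Q y (lift j k) (lift i l))).
  by apply: filterE => y; rewrite !mxE.
exact: sQ.
Qed.

End SmoothMatrices.

Section CartanGeometry.
Variables (R : realType) (p q : nat) (C : conformal_geometry R p q).
Notation N := (1 + (p + q + 1))%N.
Notation Mat := 'M[R]_N.
Notation T := (total_space C).
Notation dT := 'C(p + q + 2, 2).
Notation om := (@omega R p q C).
Notation X := (@omega_inv R p q C).

Let gT : good_atlas T := manifold_good T.
Let bR := fin_basis_real R.

Lemma omega_g u delta : tangent u delta -> lie_g (om u delta).
Proof. by have [/(_ u)[h _ _ _] _ _ _] := cartanP C; exact: h. Qed.

Lemma omega_lin u a delta eps : tangent u delta -> tangent u eps ->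
  om u (fun f => a * delta f + eps f) = a *: om u delta + om u eps.
Proof. by have [/(_ u)[_ h _ _] _ _ _] := cartanP C; exact: h. Qed.

Lemma omega_inj u delta eps : tangent u delta -> tangent u eps ->
  om u delta = om u eps -> delta = eps.
Proof. by have [/(_ u)[_ _ h _] _ _ _] := cartanP C; exact: h. Qed.

Lemma omega_invP u A : lie_g A -> tangent u (X A u) /\ om u (X A u) = A.
Proof.
move=> gA; have [/(_ u)[_ _ _ /(_ _ gA)[delta td od]] _ _ _] := cartanP C.
by apply: (@xgetPex _ (fun=> 0) [set delta | tangent u delta /\ om u delta = A]); exists delta.
Qed.

Lemma omega_inv_tan u A : lie_g A -> tangent u (X A u).
Proof. by move=> gA; have [] := omega_invP u gA. Qed.

Lemma omega_invK u A : lie_g A -> om u (X A u) = A.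
Proof. by move=> gA; have [] := omega_invP u gA. Qed.

Lemma omega_inv_uniq u A delta : tangent u delta -> om u delta = A -> delta = X A u.
Proof.
move=> td od; have gA : lie_g A by rewrite -od; exact: omega_g.
by apply: (omega_inj td); [exact: omega_inv_tan|rewrite omega_invK].
Qed.

Lemma omega_inv_lin u a A B : lie_g A -> lie_g B ->
  X (a *: A + B) u = (fun f => a * X A u f + X B u f).
Proof.
move=> gA gB; apply/esym/omega_inv_uniq.
  by apply: tangent_lin => //; exact: omega_inv_tan.
by rewrite omega_lin ?omega_invK //; exact: omega_inv_tan.
Qed.

(** The smoothness axiom of the connection is stated on vector fields; feeding it the coordinate
    fields makes the entries of omega in a chart smooth functions. *)
Lemma vector_field_tanv c v : atl T c -> is_vector_field (cdom c) (fun w => tanv c w v).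
Proof.
move=> ac; have [_ /(_ _ ac)[oc _ _ _ _] _ _] := gT.
split=> // [u cu|u f cu sf]; first exact: tangent_tanv.
apply: (smooth_fun_intro gT bR ac cu).
apply: (@smth_ext _ _ _ ('D_v (f \o cinv c))); last first.
  by apply: smth_derive; exact: smooth_fun_smth.
have n1 := near_cinv gT ac cu (smooth_fun_near gT bR sf).
have n2 := near_chart gT ac cu.
by apply: filterS2 n1 n2 => y sy [cy ey]; rewrite /= tanvE // ey.
Qed.

Section Frame.
Variables (c : chart T 'rV[R]_dT) (u : T).
Hypotheses (ac : atl T c) (cu : cdom c u).

Let W w v : Mat := om w (tanv c w v).

Let W_lin w a v v' : cdom c w -> W w (a *: v + v') = a *: W w v + W w v'.
Proof.
by move=> cw; rewrite /W tanv_lin // omega_lin //; exact: tangent_tanv.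
Qed.

Let W_smth v i j : smth (fun y => W (cinv c y) v i j) (cmap c u).
Proof.
apply: (smth_entry i j (f := fun y => W (cinv c y) v)).
have [_ h _ _] := cartanP C.
have := h _ _ (vector_field_tanv v ac) u cu.
by move=> /smooth_fun_smth; apply.
Qed.

Let Wlin : {linear 'rV[R]_dT -> 'M[R]_(1, N * N)} :=
  HB.pack (fun v => mxvec (W u v) : 'M[R]_(1, N * N)) (GRing.isLinear.Build _ _ _ _ _
    (fun a v v' => etrans (congr1 mxvec (W_lin a v v' cu)) (linearP mxvec a _ _))).

(** In a chart omega(u) is injective, but its image g is only a subspace of the matrices. The
    pseudo-inverse gives a left inverse that is linear on all matrices. *)
Definition frame_inv (A : Mat) : 'rV[R]_dT := mxvec A *m pinvmx (lin1_mx Wlin).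

Lemma frame_inv_lin a A B : frame_inv (a *: A + B) = a *: frame_inv A + frame_inv B.
Proof. by rewrite /frame_inv linearP mulmxDl -scalemxAl. Qed.

Let frame_invK v : frame_inv (W u v) = v.
Proof.
rewrite /frame_inv -[mxvec _]/(Wlin v) -mul_rV_lin1 -mulmxA mulmxVp ?mulmx1 //.
rewrite -kermx_eq0; apply/eqP/row_matrixP => i; rewrite row0.
set r := row i _.
have Wr : W u r = 0.
  have : Wlin r = 0 by rewrite -mul_rV_lin1 -row_mul mulmx_ker row0.
  by move=> /(congr1 vec_mx); rewrite linear0 /= mxvecK.
have W0 : W u 0 = 0.
  by have := W_lin (-1) 0 0 cu; rewrite scaler0 addr0 scaleN1r addNr.
apply: (tanv_inj gT ac cu); apply: (@omega_inj u); try exact: tangent_tanv.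
by rewrite -/(W u r) -/(W u 0) Wr W0.
Qed.

Definition coef A w : 'rV[R]_dT := xget 0 [set v | X A w = tanv c w v].

Lemma coefP A w : lie_g A -> cdom c w -> X A w = tanv c w (coef A w).
Proof.
move=> gA cw; have [v ev] := tangentP gT ac cw (omega_inv_tan w gA).
by apply: (@xgetPex _ 0 [set v | X A w = tanv c w v]); exists v.
Qed.

Lemma coef_frame A : lie_g A -> coef A u = frame_inv A.
Proof.
by move=> gA; rewrite -[LHS]frame_invK /W -coefP // omega_invK.
Qed.

(** omega in a chart is not a square matrix, so it is composed with the left inverse frozen at [u].
    The resulting square matrix [Q] is the identity at [u], hence invertible nearby with smooth
    inverse by Cramer's rule, and the components of omega^-1(A) are [frame_inv A] times that
    inverse. *)
Lemma coef_smth A : lie_g A -> smth (fun y => coef A (cinv c y)) (cmap c u).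
Proof.
move=> gA.
pose Q w : 'M[R]_dT := \matrix_(i, j) frame_inv (W w (delta_mx 0 i)) 0 j.
have QE w v : cdom c w -> v *m Q w = frame_inv (W w v).
  move=> cw; pose Fl : {linear 'rV[R]_dT -> 'rV[R]_dT} :=
    HB.pack (fun v => frame_inv (W w v)) (GRing.isLinear.Build _ _ _ _ _
      (fun a v v' => etrans (congr1 frame_inv (W_lin a v v' cw)) (frame_inv_lin a _ _))).
  rewrite -[RHS]/(Fl v) -mul_rV_lin1; congr (_ *m _).
  by apply/matrixP => i j; rewrite !mxE /=.
have sQ i j : smth (fun y => Q (cinv c y) i j) (cmap c u).
  apply: (@smth_ext _ _ _ (fun y => \sum_k mxvec (W (cinv c y) (delta_mx 0 i)) 0 k
                         * pinvmx (lin1_mx Wlin) k j)).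
    by apply: filterE => y; rewrite !mxE.
  apply: smth_sum => k _; apply: smth_mul; last exact: smth_cst.
  case/mxvec_indexP: k => a b.
  apply: (@smth_ext _ _ _ (fun y => W (cinv c y) (delta_mx 0 i) a b)).
    by apply: filterE => y; rewrite mxvecE.
  exact: W_smth.
have Qu : Q u = 1%:M.
  by apply/row_matrixP => i; rewrite !rowE QE // frame_invK mulmx1.
have dQ : \det (Q (cinv c (cmap c u))) != 0 by rewrite (cinvK gT) // Qu det1 oner_eq0.
have dQn : \forall y \near cmap c u, \det (Q (cinv c y)) != 0.
  exact: (smth_neq0 (smth_det sQ) dQ).
apply: (@smth_ext _ _ _ (fun y => frame_inv A *m invmx (Q (cinv c y)))).
  apply: filterS2 dQn (near_chart gT ac cu) => y dy [cy _].
  have uQ : Q (cinv c y) \in unitmx by rewrite unitmxE unitfE.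
  apply: (can_inj (mulmxK uQ)); rewrite mulmxKV // QE // /W -coefP //.
  by rewrite omega_invK.
apply: smth_mx => i j.
apply: (@smth_ext _ _ _ (fun y => \sum_k frame_inv A i k * invmx (Q (cinv c y)) k j)).
  by apply: filterE => y; rewrite mxE.
apply: smth_sum => k _; apply: smth_mul; first exact: smth_cst.
exact: smth_invmx.
Qed.

End Frame.

End CartanGeometry.

#[local] Opaque derive.

Section DeriveHelpers.
Variable R : realType.
Implicit Types E F : normedModType R.

Lemma derive_along_id E F (b : E -> E) (g : E -> F) x v : fin_basis E ->
  differentiable b x -> smth g x ->
  'D_v (fun y => 'D_(b y) g y) x = 'D_('D_v b x) g x + 'D_v ('D_(b x) g) x.
Proof.
move=> bE db sg; have di : differentiable (id : E -> E) x by exact: ex_diff.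
have := derive_along v bE di db sg.
by rewrite derive_id.
Qed.

Lemma derive_sub E F (g : E -> F) x v w :
  differentiable g x -> 'D_(v - w) g x = 'D_v g x - 'D_w g x.
Proof. by move=> dg; rewrite !deriveE // linearB. Qed.

End DeriveHelpers.

(** * Brackets of the fields omega^-1(A) and their naturality *)

Section Bracket.
Variables (R : realType) (p q : nat) (C : conformal_geometry R p q).
Notation N := (1 + (p + q + 1))%N.
Notation Mat := 'M[R]_N.
Notation T := (total_space C).
Notation dT := 'C(p + q + 2, 2).
Notation om := (@omega R p q C).
Notation X := (@omega_inv R p q C).

Let gT : good_atlas T := manifold_good T.
Let bR := fin_basis_real R.
Let bT : fin_basis 'rV[R]_dT := @fin_basis_mx R 1 dT.

Lemma omega_invE c u A f : atl T c -> cdom c u -> lie_g A -> smooth_fun f u ->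
  X A u f = 'D_(coef c A u) (f \o cinv c) (cmap c u).
Proof. by move=> ac cu gA sf; rewrite (coefP ac gA cu) tanvE. Qed.

Lemma near_omega_invE c u A f : atl T c -> cdom c u -> lie_g A -> smooth_fun f u ->
  \forall y \near cmap c u, X A (cinv c y) f = 'D_(coef c A (cinv c y)) (f \o cinv c) y.
Proof.
move=> ac cu gA sf.
have n1 := near_cinv gT ac cu (smooth_fun_near gT bR sf).
have n2 := near_chart gT ac cu.
by apply: filterS2 n1 n2 => y sy [cy ey]; rewrite (omega_invE ac) // ey.
Qed.

Lemma omega_inv_smooth u A f : lie_g A -> smooth_fun f u ->
  smooth_fun (fun w => X A w f) u.
Proof.
move=> gA sf; have [_ _ /(_ u)[c ac cu] _] := gT.
apply: (smooth_fun_intro gT bR ac cu).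
apply: (@smth_ext _ _ _ (fun y => 'D_(coef c A (cinv c y)) (f \o cinv c) (id y))).
  by apply: filterS (near_omega_invE ac cu gA sf) => y /= ->.
apply: smth_derive_along => //; first exact: smth_id.
  exact: coef_smth.
exact: smooth_fun_smth.
Qed.

Notation bracket A B := (lie_bracket (X A) (X B)).

Lemma bracketE u A B f : smooth_fun f u ->
  bracket A B u f = X A u (fun w => X B w f) - X B u (fun w => X A w f).
Proof. exact: germ_onlyT. Qed.

Lemma iter_deriveE c u A B f : atl T c -> cdom c u -> lie_g A -> lie_g B -> smooth_fun f u ->
  X A u (fun w => X B w f) =
  'D_('D_(coef c A u) (fun y => coef c B (cinv c y)) (cmap c u)) (f \o cinv c) (cmap c u)
  + 'D_(coef c A u) ('D_(coef c B u) (f \o cinv c)) (cmap c u).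
Proof.
move=> ac cu gA gB sf.
rewrite (omega_invE ac cu gA (omega_inv_smooth gB sf)).
rewrite (near_eq_derive _ (near_omega_invE ac cu gB sf)).
have db := smth_diff (coef_smth ac cu gB).
have sF := smooth_fun_smth sf ac cu.
have := derive_along_id (coef c A u) bT db sF.
by rewrite (cinvK gT ac cu).
Qed.

(** Each iterated derivative has a second order part, and these two parts cancel by [derive_swap].
    What is left is a derivative along a vector, so the bracket is a tangent vector and omega can be
    applied to it. *)
Lemma bracket_tanv c u A B : atl T c -> cdom c u -> lie_g A -> lie_g B ->
  bracket A B u =
  tanv c u ('D_(coef c A u) (fun y => coef c B (cinv c y)) (cmap c u)
          - 'D_(coef c B u) (fun y => coef c A (cinv c y)) (cmap c u)).
Proof.
move=> ac cu gA gB; apply: germ_eq => f sf.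
have sF := smooth_fun_smth sf ac cu.
rewrite (iter_deriveE ac cu gA gB sf) (iter_deriveE ac cu gB gA sf).
have sw := derive_swap (coef c A u) (coef c B u) sF.
have cancel (a b s s' t : R) : s = s' -> t = a - b -> a + s - (b + s') = t.
  by move=> -> ->; rewrite opprD addrACA subrr addr0.
exact: (cancel _ _ _ _ _ sw (derive_sub _ _ (smth_diff sF))).
Qed.

Lemma bracket_tan u A B : lie_g A -> lie_g B -> tangent u (bracket A B u).
Proof.
move=> gA gB; have [_ _ /(_ u)[c ac cu] _] := gT.
by rewrite (bracket_tanv ac cu) //; exact: tangent_tanv.
Qed.

Lemma smooth_funB (f g : T -> R) u : smooth_fun f u -> smooth_fun g u ->
  smooth_fun (fun w => f w - g w) u.
Proof.
move=> sf sg; have [_ _ /(_ u)[c ac cu] _] := gT.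
apply: (smooth_fun_intro gT bR ac cu).
apply: (@smth_add _ _ _ (f \o cinv c) (fun y => - (g \o cinv c) y)).
  exact: smooth_fun_smth.
by apply: smth_opp; exact: smooth_fun_smth.
Qed.

Lemma bracket_field A B : lie_g A -> lie_g B -> is_vector_field setT (bracket A B).
Proof.
move=> gA gB; split=> [|u _|u f _ sf]; [exact: openT|exact: bracket_tan|].
apply: (@smooth_at_ext _ _ _ T (vect R) gT (vect_good bR)
   (fun w => X A w (fun w => X B w f) - X B w (fun w => X A w f))).
  apply: filterS (smooth_fun_near gT bR sf) => w sw; exact/esym/bracketE.
apply: smooth_funB.
  by apply: (omega_inv_smooth gA); exact: omega_inv_smooth.
by apply: (omega_inv_smooth gB); exact: omega_inv_smooth.
Qed.

Definition Om u A B : Mat := om u (bracket A B u).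

Lemma Om_smooth A B u i j : lie_g A -> lie_g B -> smooth_fun (fun w => Om w A B i j) u.
Proof.
move=> gA gB; have [_ _ /(_ u)[c ac cu] _] := gT.
have [_ h _ _] := cartanP C.
apply: (smooth_fun_intro gT bR ac cu).
apply: (smth_entry i j (f := (fun w => Om w A B) \o cinv c)).
exact: (smooth_fun_smth (h _ _ (bracket_field gA gB) u I) ac cu).
Qed.

Lemma Om_asym u A B : lie_g A -> lie_g B -> Om u B A = - Om u A B.
Proof.
move=> gA gB; apply/eqP; rewrite -addr_eq0 -[Om u B A]scale1r; apply/eqP.
have tAB := bracket_tan u gA gB; have tBA := bracket_tan u gB gA.
have t0 : tangent u (fun _ => 0 : R).
  have := tangent_lin gT (-1) tAB tAB; congr tangent.
  by apply/funext => f; rewrite mulN1r addNr.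
have o0 : om u (fun _ => 0) = 0.
  have := omega_lin (-1) tAB tAB; rewrite scaleN1r addNr => <-; congr om.
  by apply/funext => f; rewrite mulN1r addNr.
rewrite /Om -omega_lin // -[RHS]o0; congr om; apply/funext => f.
case: (pselect (smooth_fun f u)) => sf.
  by rewrite !bracketE // mul1r; ring.
by rewrite /lie_bracket !germ_onlyF // mulr0 addr0.
Qed.

Lemma Om_linl u a A A' B : lie_g A -> lie_g A' -> lie_g B ->
  Om u (a *: A + A') B = a *: Om u A B + Om u A' B.
Proof.
move=> gA gA' gB; have gAA := lie_g_lin a gA gA'.
rewrite /Om -omega_lin; try exact: bracket_tan.
congr om; apply/funext => f; case: (pselect (smooth_fun f u)) => sf; last first.
  by rewrite /lie_bracket !germ_onlyF // mulr0 addr0.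
rewrite !bracketE // (omega_inv_lin u a gA gA').
have [_ _ /(_ u)[c ac cu] _] := gT.
have sA := omega_inv_smooth gA sf; have sA' := omega_inv_smooth gA' sf.
have sAA := omega_inv_smooth gAA sf.
have -> : X B u (fun w => X (a *: A + A') w f)
   = a * X B u (fun w => X A w f) + X B u (fun w => X A' w f).
  rewrite !(omega_invE ac cu gB) //.
  have dA := smth_diff (smooth_fun_smth sA ac cu).
  have dA' := smth_diff (smooth_fun_smth sA' ac cu).
  rewrite (_ : (fun w => X (a *: A + A') w f) \o cinv c =
     (fun y => a *: ((fun w => X A w f) \o cinv c) y) + ((fun w => X A' w f) \o cinv c)).
    rewrite deriveD; [|by apply: diff_derivable; exact: differentiableZ|exact: diff_derivable].
    by rewrite deriveZ //; exact: diff_derivable.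
  by apply/funext => y /=; rewrite (omega_inv_lin _ a gA gA').
ring.
Qed.

Lemma Om_linr u a A A' B : lie_g A -> lie_g A' -> lie_g B ->
  Om u B (a *: A + A') = a *: Om u B A + Om u B A'.
Proof.
move=> gA gA' gB; have gAA := lie_g_lin a gA gA'.
by rewrite Om_asym // Om_linl // opprD -scalerN -!Om_asym.
Qed.

(** If [F] carries omega to [L] composed with omega, then omega^-1(D) and omega^-1(L D) are
    [F]-related, and so are their brackets. The case [L = Ad_inv h] is the principal action, the
    case [L = id] an automorphism. *)
Lemma Om_transport (F : T -> T) (L : Mat -> Mat) u A B :
  (\forall w \near u, smooth_at F w /\
     forall delta, tangent w delta -> om (F w) (pushforward F w delta) = L (om w delta)) ->
  lie_g A -> lie_g B -> lie_g (L A) -> lie_g (L B) ->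
  Om (F u) (L A) (L B) = L (Om u A B).
Proof.
move=> nF gA gB gLA gLB.
have XF D : lie_g D -> lie_g (L D) ->
    \forall w \near u, X (L D) (F w) = pushforward F w (X D w).
  move=> gD gLD; apply: filterS nF => w [sF oF]; apply/esym/omega_inv_uniq.
    by apply: pushforward_tangent => //; exact: omega_inv_tan.
  by rewrite oF ?omega_invK //; exact: omega_inv_tan.
have [sFu oFu] := nbhs_singleton nF.
rewrite -oFu; last exact: bracket_tan.
congr om; apply: (tangent_eq (u := F u)).
- exact: bracket_tan.
- by apply: pushforward_tangent => //; exact: bracket_tan.
move=> g sg; have sgF : smooth_fun (g \o F) u by exact: smooth_fun_comp.
rewrite pushforwardE // !bracketE //.
(* The inner derivative must agree with its pullback on a neighbourhood of [u], since it is
   differentiated once more; this is why the premise on [F] holds near [u]. *)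
have key D D' : lie_g D -> lie_g (L D) -> lie_g D' -> lie_g (L D') ->
   X (L D) (F u) (fun w => X (L D') w g) = X D u (fun w => X D' w (g \o F)).
  move=> gD gLD gD' gLD'.
  rewrite (nbhs_singleton (XF D gD gLD)) pushforwardE; last exact: omega_inv_smooth.
  apply: (tangent_near gT (omega_inv_tan u gD)).
    have ng : \forall w \near u, smooth_fun g (F w).
      by have [cF _] := sFu; exact: (cF _ (smooth_fun_near gT bR sg)).
    by apply: filterS2 (XF D' gD' gLD') ng => w /= -> sgw; rewrite pushforwardE.
  apply: (smooth_fun_comp (f := F) (g := fun w => X (L D') w g)) => //.
  exact: omega_inv_smooth.
by rewrite !key.
Qed.

End Bracket.

Section CurveHelpers.
Variable R : realType.
Implicit Types E F G : normedModType R.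

Lemma pair_continuous (S U V : topologicalType) (f : S -> U) (g : S -> V) x :
  {for x, continuous f} -> {for x, continuous g} ->
  {for x, continuous (fun y => (f y, g y))}.
Proof. by move=> cf cg; exact: (cvg_pair cf cg). Qed.

Lemma mx_is_derive m n (M : R -> 'M[R]_(m, n)) (M' : 'M[R]_(m, n)) (t : R) :
  (forall i j, is_derive t (1 : R) (fun s : R => M s i j) (M' i j)) ->
  differentiable M t /\ 'D_1 M t = M'.
Proof.
move=> dM; have dd : derivable M t 1.
  by apply/derivable_mxP => i j; have [] := dM i j.
split; first exact/derivable1_diffP.
rewrite derive_mx //; apply/matrixP => i j; rewrite mxE.
by have [_ ->] := dM i j.
Qed.

Lemma derive_pair E F G (f : E -> F) (g : E -> G) x v :
  differentiable f x -> differentiable g x ->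
  'D_v (fun y => (f y, g y)) x = ('D_v f x, 'D_v g x).
Proof.
move=> df dg; rewrite !deriveE //; last exact: differentiable_pair.
by rewrite diff_pair.
Qed.

Lemma derive_fst E F G (H : E * F -> G) x y v : differentiable H (x, y) ->
  'D_v (fun x => H (x, y)) x = 'D_((v, 0)) H (x, y).
Proof.
move=> dH; have dp : differentiable (fun x : E => (x, y)) x.
  exact: (@differentiable_pair _ _ _ _ id (cst y)).
rewrite -[LHS]/('D_v (H \o (fun x => (x, y))) x) (derive_comp v dp dH).
by rewrite (@derive_pair _ _ _ id (cst y)) // derive_id derive_cst.
Qed.

Lemma nearI (S : topologicalType) (x : S) (P Q : S -> Prop) :
  (\forall y \near x, P y) -> (\forall y \near x, Q y) -> \forall y \near x, P y /\ Q y.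
Proof. by move=> nP nQ; exact: filterI. Qed.

Lemma near_slice E F (x : E) (h : F) (Q : (E * F)%type -> Prop) :
  (\forall z \near (x, h), Q z) -> \forall y \near x, Q (y, h).
Proof.
have := smth_cont (smth_pair (smth_id x) (smth_cst h x)).
by move=> cp nQ; exact: (cp _ nQ).
Qed.

Lemma fin_basis_linear_continuous E F (L : {linear E -> F}) :
  fin_basis E -> continuous L.
Proof.
move=> [I [e [c [cc ce]]]] x.
have -> : (L : E -> F) = \sum_i (fun v => c i v *: L (e i)).
  apply/funext => v; rewrite fct_sumE {1}(ce v) linear_sum; apply: eq_bigr => i _.
  by rewrite linearZ.
apply: (big_ind (fun g : E -> F => {for x, continuous g})) => [|g g' cg cg'|i _].
- exact: cst_continuous.
- exact: cvgD.
- by apply: cvgZr_tmp; exact: cc.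
Qed.

End CurveHelpers.

(** * The principal action, fundamental fields, and brackets with elements of p *)

Section Action.
Variables (R : realType) (p q : nat) (C : conformal_geometry R p q).
Notation N := (1 + (p + q + 1))%N.
Notation Mat := 'M[R]_N.
Notation T := (total_space C).
Notation dT := 'C(p + q + 2, 2).
Notation om := (@omega R p q C).
Notation X := (@omega_inv R p q C).
Notation act := (@act R p q C).
Notation Pm := (@Pmat R p q).
Notation bracket A B := (lie_bracket (X A) (X B)).
Notation Omega := (@Om R p q C).

Let gT : good_atlas T := manifold_good T.
Let bR := fin_basis_real R.
Let bM : fin_basis Mat := @fin_basis_mx R N N.
Let bT : fin_basis 'rV[R]_dT := @fin_basis_mx R 1 dT.

Lemma act1 u : act u 1%:M = u.
Proof. by have [/(_ u)[]] := bundleP C. Qed.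

Lemma actM u g h : Pm g -> Pm h -> act (act u g) h = act u (g *m h).
Proof. by have [/(_ u)[_ h'] _ _ _ _] := bundleP C; exact: h'. Qed.

Lemma pr_act u h : Pm h -> pr (act u h) = pr u.
Proof. by have [_ h' _ _ _] := bundleP C; exact: h'. Qed.

(** P is not open in the matrices, so the action has no derivatives of its own in the matrix
    variable. Its smoothness provides a local extension [g] to all matrices near [h0], whose chart
    expression can be differentiated; values are compared on P only. *)
Lemma act_extension u h0 : Pm h0 -> exists g : T * Mat -> T,
  [/\ {for (u, h0), continuous g},
      \forall z \near (u, h0), Pm z.2 -> g z = act z.1 z.2
    & forall c d, atl T c -> cdom c u -> atl T d -> cdom d (act u h0) ->
      smth (fun z : 'rV[R]_dT * Mat => cmap d (g (cinv c z.1, z.2))) (cmap c u, h0)].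
Proof.
move=> Ph; have [_ _ _ sw _] := bundleP C.
have [//|g [[cg sg] ng]] := sw (u, h0).
have n' : \forall z \near (u, h0), Pm z.2 -> g z = act z.1 z.2.
  by apply: filterS ng => z nz Pz; apply: nz.
exists g; split=> // c d ac cu ad du.
pose e : chart (T * Mat)%type ('rV[R]_dT * Mat)%type :=
  Chart (cdom c `*` setT) (fun z => (cmap c z.1, z.2)) (fun z => (cinv c z.1, z.2)).
have ae : atl (prodm T (vect Mat)) e by exists c, (Chart setT id id).
have eu : cdom e (u, h0) by split.
have dg : cdom d (g (u, h0)) by rewrite (nbhs_singleton n').
by have [U [oU Ux sU]] := sg e d ae ad eu dg; exists U.
Qed.

Lemma act_near u h0 c (Q : T -> Prop) : Pm h0 -> atl T c -> cdom c u ->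
  (\forall w \near act u h0, Q w) ->
  \forall z \near (cmap c u, h0), Pm z.2 -> Q (act (cinv c z.1) z.2).
Proof.
move=> Ph ac cu nQ; have [g [cg ng _]] := act_extension u Ph.
have gu : g (u, h0) = act u h0 by exact: (nbhs_singleton ng).
have n1 : \forall z \near (u, h0), Q (g z).
  by apply: cg; rewrite gu.
have cc : {for (cmap c u, h0), continuous (fun z : 'rV[R]_dT * Mat => (cinv c z.1, z.2) : T * Mat)}.
  apply: pair_continuous; last exact: cvg_snd.
  apply: (@continuous_comp _ _ _ fst (cinv c)); first exact: cvg_fst.
  exact: (cinv_cont gT).
have n2 : \forall z \near (cmap c u, h0), Q (g (cinv c z.1, z.2)) /\
     (Pm z.2 -> g (cinv c z.1, z.2) = act (cinv c z.1) z.2).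
  have n12 : \forall z \near (u, h0), Q (g z) /\ (Pm z.2 -> g z = act z.1 z.2).
    exact: nearI.
  move: cc; rewrite /prop_for /continuous_at /= (cinvK gT ac cu) => cc.
  exact: (cc _ n12).
by apply: filterS n2 => z [Qz ez] Pz; rewrite -ez.
Qed.

Lemma act_local u h0 c d : Pm h0 -> atl T c -> cdom c u -> atl T d -> cdom d (act u h0) ->
  exists G : 'rV[R]_dT * Mat -> 'rV[R]_dT, smth G (cmap c u, h0) /\
    \forall z \near (cmap c u, h0), Pm z.2 -> cmap d (act (cinv c z.1) z.2) = G z.
Proof.
move=> Ph ac cu ad du; have [g [cg ng sg]] := act_extension u Ph.
exists (fun z => cmap d (g (cinv c z.1, z.2))); split; first exact: sg.
have cc : {for (cmap c u, h0), continuous (fun z : 'rV[R]_dT * Mat => (cinv c z.1, z.2) : T * Mat)}.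
  apply: pair_continuous; last exact: cvg_snd.
  apply: (@continuous_comp _ _ _ fst (cinv c)); first exact: cvg_fst.
  exact: (cinv_cont gT).
move: cc; rewrite /prop_for /continuous_at /= (cinvK gT ac cu) => cc.
have n2 : \forall z \near (cmap c u, h0),
   (Pm z.2 -> g (cinv c z.1, z.2) = act (cinv c z.1) z.2) := cc _ ng.
by apply: filterS n2 => z /= ez /ez ->.
Qed.

Lemma act_fun_local u h0 c f : Pm h0 -> atl T c -> cdom c u -> smooth_fun f (act u h0) ->
  exists H : 'rV[R]_dT * Mat -> R, smth H (cmap c u, h0) /\
    \forall z \near (cmap c u, h0), Pm z.2 -> f (act (cinv c z.1) z.2) = H z.
Proof.
move=> Ph ac cu sf; have [_ _ /(_ (act u h0))[d ad du] _] := gT.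
have [G [sG nG]] := act_local Ph ac cu ad du.
have nd := act_near Ph ac cu (near_cdom gT ad du).
exists (fun z => (f \o cinv d) (G z)); split.
  apply: smth_comp => //; rewrite -(nbhs_singleton nG) //= (cinvK gT ac cu).
  exact: smooth_fun_smth.
apply: filterS2 nG nd => z ez dz Pz /=; rewrite -ez // (cinvK gT ad) //.
exact: dz.
Qed.

Lemma act_smooth u h : Pm h -> smooth_at (fun w => act w h) u.
Proof.
move=> Ph; have [_ _ /(_ u)[c ac cu] _] := gT; have [_ _ /(_ (act u h))[d ad du] _] := gT.
have [G [sG nG]] := act_local Ph ac cu ad du.
have slice (Q : 'rV[R]_dT * Mat -> Prop) : (\forall z \near (cmap c u, h), Q z) ->
    \forall y \near cmap c u, Q (y, h).
  exact: near_slice.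
have s1 : smth (cmap d \o (fun w => act w h) \o cinv c) (cmap c u).
  apply: (@smth_ext _ _ _ (fun y => G (y, h))).
    by apply: filterS (slice _ nG) => y /= ->.
  apply: (smth_comp (f := fun y => (y, h)) (g := G)) => //.
    exact: fin_basis_prod.
  by apply: smth_pair; [exact: smth_id|exact: smth_cst].
apply: (smooth_at_intro gT gT _ ac ad) => //; apply: (smth_continuous gT gT ac ad) => //.
have := near_cmap gT ac cu (slice _ (act_near Ph ac cu (near_cdom gT ad du))).
by apply: filterS2 (near_cdom gT ac cu) => w cw /= /(_ Ph); rewrite (cinvK gT ac cw).
Qed.

Lemma act_omega u h delta : Pm h -> tangent u delta ->
  om (act u h) (pushforward (fun w => act w h) u delta) = Ad_inv h (om u delta).
Proof. by have [_ _ h' _] := cartanP C; exact: h'. Qed.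

Lemma Ad_inv_gP h A : Pm h -> lie_g A -> lie_g (Ad_inv h A).
Proof. by move=> /PmatP[Gh _]; exact: Ad_inv_g. Qed.

Lemma act_omega_inv u h A : Pm h -> lie_g A ->
  X (Ad_inv h A) (act u h) = pushforward (fun w => act w h) u (X A u).
Proof.
move=> Ph gA; apply/esym/omega_inv_uniq.
  by apply: pushforward_tangent => //; [exact: act_smooth|exact: omega_inv_tan].
by rewrite act_omega // ?omega_invK //; exact: omega_inv_tan.
Qed.

Lemma act_omega_invE u h A f : Pm h -> lie_g A -> smooth_fun f (act u h) ->
  X (Ad_inv h A) (act u h) f = X A u (fun w => f (act w h)).
Proof. by move=> Ph gA sf; rewrite act_omega_inv // pushforwardE. Qed.

Lemma mexp_diff (A : Mat) :
  differentiable (fun t : R => mexp (t *: A) : Mat) 0 /\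
  'D_1 (fun t : R => mexp (t *: A) : Mat) 0 = A.
Proof.
have [] := @mx_is_derive _ _ _ (fun t : R => mexp (t *: A) : Mat) (A *m mexp ((0 : R) *: A)) 0.
  by move=> i j; exact: is_derive_mexp.
by rewrite scale0r mexp0 mulmx1.
Qed.

Lemma mexp_curve (A : Mat) (y : 'rV[R]_dT) :
  differentiable (fun t : R => (y, mexp (t *: A) : Mat)) 0 /\
  'D_1 (fun t : R => (y, mexp (t *: A) : Mat)) 0 = (0, A).
Proof.
have [d1 D1] := mexp_diff A; split.
  exact: (@differentiable_pair _ _ _ _ (cst y)).
by rewrite (@derive_pair _ _ _ _ (cst y)) // derive_cst D1.
Qed.

Lemma mexp_curve_near (A : Mat) (y : 'rV[R]_dT) (Q : 'rV[R]_dT * Mat -> Prop) :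
  (\forall z \near (y, 1%:M : Mat), Q z) ->
  \forall t \near (0 : R), Q (y, mexp (t *: A)).
Proof.
move=> nQ; have [d1 _] := mexp_curve A y.
have := differentiable_continuous d1.
rewrite /prop_for /continuous_at /= scale0r mexp0 => cc.
exact: (cc _ nQ).
Qed.

Lemma derive_mexp_curve (A : Mat) (y : 'rV[R]_dT) (F : normedModType R) (H : ('rV[R]_dT * Mat)%type -> F) :
  differentiable H (y, 1%:M : Mat) ->
  'D_1 (fun t : R => H (y, mexp (t *: A))) 0 = 'D_((0, A)) H (y, 1%:M : Mat).
Proof.
move=> dH; have [d1 D1] := mexp_curve A y.
have e0 : (fun t : R => (y, mexp (t *: A) : Mat)) 0 = (y, 1%:M) by rewrite /= scale0r mexp0.
have := @derive_comp _ _ _ _ (fun t : R => (y, mexp (t *: A) : Mat)) H 0 1 d1.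
by rewrite e0 D1; apply.
Qed.

(** The axiom gives the value of omega on a fundamental field but not that it is a tangent vector.
    This is shown by writing it as the derivative of the extended action in direction [(0, A)];
    uniqueness of omega^-1 then identifies the two. *)
Lemma fundamental_omega_inv u A : lie_p A -> X A u = fundamental_field act A u.
Proof.
move=> pA; apply/esym/omega_inv_uniq; last by have [_ _ _ h] := cartanP C; exact: h.
have [_ _ /(_ u)[c ac cu] _] := gT.
have du : cdom c (act u 1%:M) by rewrite act1.
have [G [sG nG]] := act_local (Pmat1 R p q) ac cu ac du.
have nd := act_near (Pmat1 R p q) ac cu (near_cdom gT ac du).
exists c, ('D_((0, A)) G (cmap c u, 1%:M : Mat)); split=> //.
apply: germ_eq => f sf.
have sF := smooth_fun_smth sf ac cu.
have G0 : G (cmap c u, 1%:M) = cmap c u.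
  by rewrite -(nbhs_singleton nG) /=; [rewrite (cinvK gT ac cu) act1|exact: Pmat1].
rewrite derive1E.
rewrite (@near_eq_derive _ _ _ _ (fun t : R => ((f \o cinv c) \o G) (cmap c u, mexp (t *: A)))).
  rewrite (@derive_mexp_curve A (cmap c u) _ ((f \o cinv c) \o G)).
    by rewrite derive_comp; [rewrite G0|exact: smth_diff|rewrite G0; exact: smth_diff].
  by apply: differentiable_comp; [exact: smth_diff|rewrite G0; exact: smth_diff].
apply: filterS2 (mexp_curve_near A nG) (mexp_curve_near A nd) => t /=.
rewrite (cinvK gT ac cu) => e1 e2; have Pt := Pmat_mexp t pA.
by rewrite -e1 // (cinvK gT ac) //; exact: e2.
Qed.

Lemma omega_inv_pE u A f : lie_p A -> smooth_fun f u ->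
  X A u f = 'D_1 (fun t : R => f (act u (mexp (t *: A)))) 0.
Proof. move=> pA sf; have -> := fundamental_omega_inv u pA.
exact: etrans (germ_onlyT _ sf) (derive1E _ _). Qed.

Lemma omega_inv_local u A f c (H : 'rV[R]_dT * Mat -> R) : lie_p A -> atl T c -> cdom c u ->
  smooth_fun f u -> differentiable H (cmap c u, 1%:M : Mat) ->
  (\forall z \near (cmap c u, 1%:M : Mat), Pm z.2 -> f (act (cinv c z.1) z.2) = H z) ->
  X A u f = 'D_((0, A)) H (cmap c u, 1%:M : Mat).
Proof.
move=> pA ac cu sf dH nH; rewrite omega_inv_pE // -derive_mexp_curve //.
apply: near_eq_derive; apply: filterS (mexp_curve_near A nH) => t /=.
by rewrite (cinvK gT ac cu) => -> //; exact: Pmat_mexp.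
Qed.

(* In a chart H(y, h) = f(y h) has derivative X_A f in the direction (0, A) at
   h = 1, and X_B (f o r_h) equals (X_(Ad_h^-1 B) f) o r_h; the second order terms
   of the bracket then cancel by symmetry of the second derivative. *)
Lemma horizontal u A B : lie_p A -> lie_g B -> bracket A B u = X (brk A B) u.
Proof.
move=> pA gB; have gA := lie_p_g pA.
have gAB : lie_g (brk A B) by apply/lie_gP; apply: is_g_brk; exact/lie_gP.
apply: (tangent_eq (u := u)); [exact: bracket_tan|exact: omega_inv_tan|move=> f sf].
rewrite bracketE //.
have [_ _ /(_ u)[c ac cu] _] := gT.
have sf1 : smooth_fun f (act u 1%:M) by rewrite act1.
have P1 := Pmat1 R p q.
have [H [sH nH]] := act_fun_local P1 ac cu sf1.
set y0 := cmap c u in sH nH *.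
have nH' := nbhs_interior nH; have nsH := smth_near sH.
pose L : {linear Mat -> 'rV[R]_dT} :=
  HB.pack (frame_inv ac cu) (GRing.isLinear.Build _ _ _ _ _ (frame_inv_lin ac cu)).
have cL : continuous L by exact: fin_basis_linear_continuous.
have LE D : lie_g D -> coef c D u = L D by exact: coef_frame.
have nc := near_chart gT ac cu.
have e3 : X (brk A B) u f = 'D_((L (brk A B), 0)) H (y0, 1%:M : Mat).
  rewrite (omega_invE ac cu gAB sf) LE // -derive_fst; last exact: smth_diff.
  apply: near_eq_derive; apply: filterS (near_slice nH) => y /= <- //.
  by rewrite act1.
have e2 : X B u (fun w => X A w f) = 'D_((L B, 0)) ('D_((0, A)) H) (y0, 1%:M : Mat).
  rewrite (omega_invE ac cu gB (omega_inv_smooth gA sf)) LE // -derive_fst; last first.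
    by apply: smth_diff; exact: smth_derive.
  apply: near_eq_derive.
  have n1 := near_cinv gT ac cu (smooth_fun_near gT bR sf).
  have n2 := nearI n1 (nearI nc (nearI (near_slice nH') (near_slice nsH))).
  apply: filterS n2 => y [sy [[cy ey] [nHy sHy]]] /=.
  by rewrite (@omega_inv_local (cinv c y) A f c H) ?ey //; exact: smth_diff.
have e1 : X A u (fun w => X B w f) = 'D_((L (brk A B), 0)) H (y0, 1%:M : Mat)
    + 'D_((0, A)) ('D_((L B, 0)) H) (y0, 1%:M : Mat).
  rewrite (omega_inv_pE pA (omega_inv_smooth gB sf)).
  pose B' (t : R) : Mat := Ad_inv (invmx (mexp (t *: A))) B.
  have [dB' DB'] : differentiable B' 0 /\ 'D_1 B' 0 = brk A B.
    by apply: mx_is_derive => i j; exact: is_derive_conj.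
  pose b (t : R) : 'rV[R]_dT * Mat := (L (B' t), 0).
  have dLB : differentiable (fun t : R => L (B' t)) 0.
    by apply: (@differentiable_comp _ _ _ _ B' L) => //; exact: linear_differentiable.
  have db : differentiable b 0 by exact: (@differentiable_pair _ _ _ _ _ (cst 0)).
  have Db : 'D_1 b 0 = (L (brk A B), 0).
    rewrite /b (@derive_pair _ _ _ _ _ (cst 0)) // derive_cst; congr (_, _).
    rewrite -[LHS]/('D_1 (L \o B') 0) derive_comp ?derive_lin ?DB' //.
    exact: linear_differentiable.
  have [dg Dg] := mexp_curve A y0.
  have g0 : (y0, mexp ((0 : R) *: A) : Mat) = (y0, 1%:M) by rewrite scale0r mexp0.
  have b0 : b 0 = (L B, 0).
    by rewrite /b /B' scale0r mexp0 /Ad_inv invmxK invmx1 mul1mx mulmx1.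
  have sH0 : smth H (y0, mexp ((0 : R) *: A) : Mat) by rewrite g0.
  have := @derive_along _ _ _ _ _ b H 0 1 (fin_basis_prod bT bM) dg db sH0.
  rewrite /= g0 Db Dg b0 => <-; apply: near_eq_derive.
  have nsf := act_near P1 ac cu (smooth_fun_near gT bR sf1).
  have n1 := nearI (mexp_curve_near A nH') (nearI (mexp_curve_near A nsH) (mexp_curve_near A nsf)).
  apply: filterS n1 => t [nHt [sHt sft]].
  have Pt := Pmat_mexp t pA; have uPt := Pmat_unit Pt.
  have {}sft : smooth_fun f (act u (mexp (t *: A))).
    by move: sft => /(_ Pt) /=; rewrite (cinvK gT ac cu).
  have gB' : lie_g (B' t) by apply: Ad_inv_gP => //; exact: Pmat_inv.
  have sfr : smooth_fun (fun w => f (act w (mexp (t *: A)))) u.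
    apply: (smooth_fun_comp (f := fun w => act w (mexp (t *: A))) (g := f)) => //.
    exact: act_smooth.
  rewrite -{1}(Ad_invK B uPt) -/(B' t) act_omega_invE //.
  rewrite (omega_invE ac cu gB' sfr) LE // /b -derive_fst; last exact: smth_diff.
  apply: near_eq_derive; apply: filterS (near_slice nHt) => y /= <- //.
rewrite e1 e2 e3 (derive_swap (0, A) (L B, 0) sH).
by rewrite addrK.
Qed.

Lemma Om_horizontal u A B : lie_p A -> lie_g B -> Omega u A B = brk A B.
Proof.
move=> pA gB; rewrite /Om horizontal // omega_invK //.
by apply/lie_gP; apply: is_g_brk; apply/lie_gP => //; exact: lie_p_g.
Qed.

End Action.

(** * Symmetries *)

#[local] Opaque mexp.

Section Symmetries.
Variables (R : realType) (p q : nat) (C : conformal_geometry R p q).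
Notation n := (p + q)%N.
Notation N := (1 + (p + q + 1))%N.
Notation Mat := 'M[R]_N.
Notation M := (base_space C).
Notation T := (total_space C).
Notation dT := 'C(p + q + 2, 2).
Notation om := (@omega R p q C).
Notation X := (@omega_inv R p q C).
Notation act := (@act R p q C).
Notation pr := (@pr R p q C).
Notation Pm := (@Pmat R p q).
Notation Omega := (@Om R p q C).
Notation mx3 := (@mx3 R p q).

Let gT : good_atlas T := manifold_good T.
Let gM : good_atlas M := manifold_good M.
Let bR := fin_basis_real R.
Let bM : fin_basis Mat := @fin_basis_mx R N N.
Let bT : fin_basis 'rV[R]_dT := @fin_basis_mx R 1 dT.

Lemma omega_invZ u a A f : lie_g A -> X (a *: A) u f = a * X A u f.
Proof.
move=> gA; have -> : a *: A = (a - 1) *: A + A by rewrite scalerBl scale1r subrK.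
by rewrite omega_inv_lin //; ring.
Qed.

Lemma omega_invD u A B f : lie_g A -> lie_g B -> X (A + B) u f = X A u f + X B u f.
Proof. by move=> gA gB; rewrite -[A]scale1r omega_inv_lin // scale1r mul1r. Qed.

Lemma Om_scalel u a A B : lie_g A -> lie_g B -> Omega u (a *: A) B = a *: Omega u A B.
Proof.
move=> gA gB; have -> : a *: A = (a - 1) *: A + A by rewrite scalerBl scale1r subrK.
by rewrite Om_linl // scalerBl scale1r subrK.
Qed.

Lemma Om_scaler u a A B : lie_g A -> lie_g B -> Omega u B (a *: A) = a *: Omega u B A.
Proof.
move=> gA gB; have -> : a *: A = (a - 1) *: A + A by rewrite scalerBl scale1r subrK.
by rewrite Om_linr // scalerBl scale1r subrK.
Qed.

Lemma Om_Dl u A A' B : lie_g A -> lie_g A' -> lie_g B ->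
  Omega u (A + A') B = Omega u A B + Omega u A' B.
Proof. by move=> gA gA' gB; have := Om_linl u 1 gA gA' gB; rewrite !scale1r. Qed.

Lemma Om_Dr u A A' B : lie_g A -> lie_g A' -> lie_g B ->
  Omega u B (A + A') = Omega u B A + Omega u B A'.
Proof. by move=> gA gA' gB; have := Om_linr u 1 gA gA' gB; rewrite !scale1r. Qed.

Lemma kappaE u x y : kappa u x y = - Omega u (gm1 x) (gm1 y).
Proof. by rewrite /kappa brk_gm1 sub0r. Qed.

Lemma Om_act u h A B : Pm h -> lie_g A -> lie_g B ->
  Omega (act u h) (Ad_inv h A) (Ad_inv h B) = Ad_inv h (Omega u A B).
Proof.
move=> Ph gA gB.
apply: (Om_transport (F := fun w => act w h) (L := Ad_inv h)) => //; try exact: Ad_inv_gP.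
apply: filterE => w; split; first exact: act_smooth.
by move=> delta td; exact: act_omega.
Qed.

(** The p-parts [A] and [B] contribute only Lie brackets, by [Om_horizontal]. Together with the zero
    bracket of [gm1 x'] and [gm1 y'] these add up to the bracket of the two conjugates, the
    conjugate of a bracket in the abelian g_-1, hence zero. So [Om] on g_-1 transforms as a tensor
    on g/p. *)
Lemma Om_gm1_act u h x y x' y' (A B : Mat) : Pm h -> lie_p A -> lie_p B ->
  Ad_inv (invmx h) (gm1 x) = gm1 x' + A -> Ad_inv (invmx h) (gm1 y) = gm1 y' + B ->
  Omega (act u h) (gm1 x) (gm1 y) = Ad_inv h (Omega u (gm1 x') (gm1 y')).
Proof.
move=> Ph pA pB ex ey; have uh := Pmat_unit Ph; have uh' := Pmat_unit (Pmat_inv Ph).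
have gA := lie_p_g pA; have gB := lie_p_g pB.
have gx := gm1_lie_g x'; have gy := gm1_lie_g y'.
have gxA : lie_g (gm1 x' + A) by exact: lie_gD.
have gyB : lie_g (gm1 y' + B) by exact: lie_gD.
rewrite -{1}(Ad_invK (gm1 x) uh) -{1}(Ad_invK (gm1 y) uh) ex ey Om_act //; congr Ad_inv.
have := brk_Ad (gm1 x) (gm1 y) uh'.
rewrite brk_gm1 ex ey /Ad_inv mulmx0 mul0mx => e0.
rewrite Om_Dl // (Om_horizontal u pA gyB) Om_Dr // (Om_asym u gB gx).
rewrite (Om_horizontal u pB gx) -addrA.
suff -> : - brk B (gm1 x') + brk A (gm1 y' + B) = 0 by rewrite addr0.
rewrite -e0 -[RHS]subr0 -(brk_gm1 x' y') /brk !(mulmxDl, mulmxDr).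
move: (B *m gm1 x') (gm1 x' *m B) (A *m gm1 y') (gm1 y' *m A) => a1 a2 a3 a4.
move: (A *m B) (B *m A) (gm1 x' *m gm1 y') (gm1 y' *m gm1 x') => a5 a6 a7 a8.
by apply/matrixP => i j; rewrite !mxE; ring.
Qed.

Section Automorphisms.
Variable phi : automorphism C.

Lemma near_adom u : adom phi (pr u) -> \forall w \near u, adom phi (pr w).
Proof.
move=> au; have [_ _ /(_ u)[cp _] _ _] := bundleP C.
apply: (cp (adom phi)); apply: open_nbhs_nbhs; split=> //; exact: adom_open.
Qed.

Lemma auto_smooth u : adom phi (pr u) -> smooth_at (afun phi) u.
Proof. by move=> /(afunP (a := phi))[]. Qed.

Lemma Om_auto u A B : adom phi (pr u) -> lie_g A -> lie_g B ->
  Omega (afun phi u) A B = Omega u A B.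
Proof.
move=> au gA gB; apply: (Om_transport (F := afun phi) (L := id)) => //.
apply: filterS (near_adom au) => w aw; split; first exact: auto_smooth.
by move=> delta td; exact: afun_omega.
Qed.

Lemma auto_omega_inv u A : adom phi (pr u) -> lie_g A ->
  X A (afun phi u) = pushforward (afun phi) u (X A u).
Proof.
move=> au gA; apply/esym/omega_inv_uniq.
  by apply: pushforward_tangent => //; [exact: auto_smooth|exact: omega_inv_tan].
by rewrite afun_omega ?omega_invK //; exact: omega_inv_tan.
Qed.

End Automorphisms.

Lemma fiber_transitive u u' : pr u = pr u' -> exists2 h, Pm h & u' = act u h.
Proof.
move=> e; have [_ _ _ _ /(_ (pr u))] := bundleP C.
move=> [U [triv [untriv [[oU Uu] t1 t2 t3 _]]]].
have [Pu eu _] := t1 u Uu; have [|Pu' eu' _] := t1 u'; first by rewrite -e.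
have Ph : Pm (invmx (triv u) *m triv u') by apply: Pmat_mul => //; exact: Pmat_inv.
exists (invmx (triv u) *m triv u') => //.
have Uh : U (pr (act u (invmx (triv u) *m triv u'))) by rewrite pr_act.
have [_ eh _] := t1 _ Uh.
by rewrite -eh pr_act // t2 // mulmxA mulmxV ?mul1mx ?e ?eu' //; exact: Pmat_unit.
Qed.

Lemma pr_smooth u : smooth_at pr u.
Proof. by have [_ _ h _ _] := bundleP C. Qed.

(* Differentiating h^T S h = S. *)
Lemma derive_Pmat (E : normedModType R) (tau : E -> Mat) y v :
  differentiable tau y -> (\forall z \near y, Pm (tau z)) ->
  lie_p (invmx (tau y) *m 'D_v tau y).
Proof.
move=> dt nP; have Py := nbhs_singleton nP; have /PmatP[Gy uy] := Py.
have uty := Pmat_unit Py.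
set D := 'D_v tau y.
pose l (t : R) := y + t *: v.
have dv : differentiable (fun t : R => t *: v) 0.
  exact: (@differentiable_scale _ _ _ (fun t : R => t) (cst v)).
have dl : differentiable l 0.
  exact: (@differentiableD _ _ _ (cst y) (fun t : R => t *: v)).
have Dl : 'D_1 l 0 = v.
  have ds : derivable (fun t : R => t *: v) 0 1 by exact: diff_derivable.
  have -> : l = cst y + (fun t : R => t *: v) by [].
  rewrite deriveD // derive_cst add0r derive_scale //.
  by rewrite derive_id derive_cst scale1r scaler0 addr0.
have l0 : l 0 = y by rewrite /l scale0r addr0.
pose m (t : R) : Mat := tau (l t).
have dm : differentiable m 0.
  by apply: (@differentiable_comp _ _ _ _ l tau) => //; rewrite l0.
have Dm : 'D_1 m 0 = D.
  rewrite -[m]/(tau \o l) derive_comp ?l0 ?Dl //.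
have mP : \forall t \near (0 : R), Pm (m t).
  have := differentiable_continuous dl; rewrite /prop_for /continuous_at l0 => cl.
  exact: (cl _ nP).
have dmkl k j : is_derive (0 : R) (1 : R) (fun t : R => m t k j) (D k j).
  have dd : derivable m 0 1 by exact: diff_derivable.
  by apply: DeriveDef; [exact: (derivable_mxP m 0 1).1|rewrite -Dm (derive_mx dd) mxE].
have m0 : m 0 = tau y by rewrite /m l0.
have quad : D^T *m Smx R p q *m tau y + (tau y)^T *m Smx R p q *m D = 0.
  apply/matrixP => k j.
  have [_ dq] := @is_derive_quad R p q m (fun=> D) (Smx R p q) 0 k j dmkl.
  rewrite -m0 -dq mxE (@near_eq_derive _ _ _ _ (cst (Smx R p q k j))) ?derive_cst //.
  by apply: filterS mP => t /PmatP[+ _]; rewrite /is_G => ->.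
have uppD : upp D.
  apply/uppP => i; have [_ <-] := dmkl (rshift 1 i) (lshift _ 0).
  rewrite (@near_eq_derive _ _ _ _ (cst 0)) ?derive_cst //.
  by apply: filterS mP => t /PmatP[_ /uppP ->].
apply/lie_pP; split; last first.
  by apply: upp_mul => //; have /PmatP[] := Pmat_inv Py.
move: quad; rewrite /is_g -[in X in X -> _](mulKVmx uty D).
move: (invmx (tau y) *m D) => B.
rewrite trmx_mul -(mulmxA B^T) -(mulmxA B^T) Gy [(tau y)^T *m _ *m _]mulmxA.
by rewrite Gy.
Qed.

(** In a local trivialization a vertical vector has zero base velocity, and its velocity in P is
    [h0 *m B] with [B] in p by [derive_Pmat]. The fundamental field of [B] has the same velocity, so
    it equals [delta]. *)
Lemma vertical_lie_p u delta : tangent u delta ->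
  (forall g, smooth_fun g (pr u) -> delta (fun w => g (pr w)) = 0) ->
  lie_p (om u delta).
Proof.
move=> td d0; have [_ _ _ _ /(_ (pr u))] := bundleP C.
move=> [U [triv [untriv [[oU Uu] t1 t2 t3 sw]]]].
have [_ _ /(_ u)[c ac cu] _] := gT; have [_ _ /(_ (pr u))[a aa au] _] := gM.
have [v ev] := tangentP gT ac cu td.
have [P0 e0 st] := t1 u Uu; set h0 := triv u in P0 e0.
set y0 := cmap c u.
have sfpr := pr_smooth u.
have [cpr _] := sfpr.
have nU : \forall w \near u, U (pr w) by apply: cpr; exact: open_nbhs_nbhs.
pose tau (y : 'rV[R]_dT) : Mat := triv (cinv c y).
have stau : smth tau y0 by exact: (smooth_fun_smth st ac cu).
pose pi (y : 'rV[R]_dT) : 'rV[R]_n := cmap a (pr (cinv c y)).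
have spi : smth pi y0 by exact: (smooth_at_smth sfpr ac aa cu au).
have Dpi : 'D_v pi y0 = 0.
  apply: (tanv_inj gM aa au).
  have := pushforward_tanv v gT gM sfpr ac cu aa au; rewrite -ev -/y0 => <-.
  have -> : tanv a (pr u) 0 = (fun _ => 0).
    apply/funext => f; case: (pselect (smooth_fun f (pr u))) => sf.
      by rewrite tanvE // derive0.
    by rewrite /tanv germ_onlyF.
  apply/funext => g; case: (pselect (smooth_fun g (pr u))) => sg.
    by rewrite pushforwardE // d0.
  by rewrite /pushforward germ_onlyF.
have tau0 : tau y0 = h0 by rewrite /tau (cinvK gT).
have pi0 : pi y0 = cmap a (pr u) by rewrite /pi (cinvK gT).
have ntau : \forall y \near y0, Pm (tau y).
  by apply: filterS (near_cinv gT ac cu nU) => y /t1[].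
have := derive_Pmat v (smth_diff stau) ntau.
rewrite tau0; set B := _ *m _ => pB.
have uh0 := Pmat_unit P0.
suff <- : X B u = delta by rewrite omega_invK //; exact: lie_p_g.
apply: (tangent_eq (u := u)) => //; first by apply: omega_inv_tan; exact: lie_p_g.
move=> f sf.
have [//|g [[cg sg] ng]] := sw (pr u, h0).
have n' : \forall z \near (pr u, h0), U z.1 -> Pm z.2 -> g z = untriv z.
  by apply: filterS ng => z nz Uz Pz; apply: nz.
have gu : g (pr u, h0) = u by rewrite (nbhs_singleton n').
pose e : chart (M * Mat)%type ('rV[R]_n * Mat)%type :=
  Chart (cdom a `*` setT) (fun z => (cmap a z.1, z.2)) (fun z => (cinv a z.1, z.2)).
have ae : atl (prodm M (vect Mat)) e by exists a, (Chart setT id id).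
have eu : cdom e (pr u, h0) by split.
have dg : cdom c (g (pr u, h0)) by rewrite gu.
have sG : smth (fun z : 'rV[R]_n * Mat => cmap c (g (cinv a z.1, z.2))) (cmap a (pr u), h0).
  by have [V [oV Vx sV]] := sg e c ae ac eu dg; exists V.
(* [f] read in the trivialization, extended smoothly to matrices outside P; both [delta] and the
   fundamental field will differentiate this one function at the same point. *)
pose Psi z := (f \o cinv c) (cmap c (g (cinv a z.1, z.2))).
have sPsi : smth Psi (cmap a (pr u), h0).
  apply: smth_comp => //=; rewrite (cinvK gM aa au) gu.
  exact: (smooth_fun_smth sf ac cu).
have bMn : fin_basis 'rV[R]_n by exact: fin_basis_mx.
have nPsi : \forall z \near (cmap a (pr u), h0), U (cinv a z.1) -> Pm z.2 ->
    f (untriv (cinv a z.1, z.2)) = Psi z.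
  have n1 : \forall z \near (pr u, h0), cdom c (g z).
    by apply: cg; rewrite gu; exact: (near_cdom gT).
  have cc : {for (cmap a (pr u), h0), continuous (fun z : 'rV[R]_n * Mat => (cinv a z.1, z.2) : M * Mat)}.
    apply: pair_continuous; last exact: cvg_snd.
    apply: (@continuous_comp _ _ _ fst (cinv a)); first exact: cvg_fst.
    exact: (cinv_cont gM).
  have n2 := nearI n1 n'.
  move: cc; rewrite /prop_for /continuous_at /= (cinvK gM aa au) => cc.
  have n3 : \forall z \near (cmap a (pr u), h0),
     cdom c (g (cinv a z.1, z.2)) /\
     (U (cinv a z.1) -> Pm z.2 -> g (cinv a z.1, z.2) = untriv (cinv a z.1, z.2)) := cc _ n2.
  apply: filterS n3 => z [cz gz] Uz Pz.
  by rewrite /Psi /= (cinvK gT ac cz) gz.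
have dPsi := smth_diff sPsi.
have edelta : delta f = 'D_((0, 'D_v tau y0)) Psi (cmap a (pr u), h0).
  rewrite ev tanvE // -/y0.
  pose k (y : 'rV[R]_dT) := (pi y, tau y).
  have dk : differentiable k y0 by apply: differentiable_pair; exact: smth_diff.
  have k0 : k y0 = (cmap a (pr u), h0) by rewrite /k pi0 tau0.
  have Dk : 'D_v k y0 = (0, 'D_v tau y0).
    by rewrite /k derive_pair ?Dpi //; exact: smth_diff.
  rewrite -Dk -k0 -derive_comp ?k0 //; apply: near_eq_derive.
  have nk : \forall y \near y0, U (cinv a (k y).1) -> Pm (k y).2 ->
      f (untriv (cinv a (k y).1, (k y).2)) = Psi (k y).
    have := differentiable_continuous dk; rewrite /prop_for /continuous_at k0 => ck.
    exact: (ck _ nPsi).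
  have na : \forall y \near y0, cdom a (pr (cinv c y)).
    apply: (near_cinv gT ac cu (P := fun w => cdom a (pr w))).
    exact: (cpr _ (near_cdom gM aa au)).
  have := nearI nk (nearI na (nearI ntau (near_cinv gT ac cu nU))).
  apply: filterS => y [ky [ay [Py Uy]]] /=; rewrite -ky //= /pi (cinvK gM aa ay) //.
  by have [_ -> _] := t1 _ Uy.
rewrite edelta omega_inv_pE //.
have [dB DB] := mexp_diff B.
pose Lh : {linear Mat -> Mat} := mulmx h0.
have cLh : continuous Lh by exact: fin_basis_linear_continuous.
(* This curve is the orbit of [u] under [mexp (t *: B)] in the trivialization. At [t = 0] its
   velocity is [h0 *m B = 'D_v tau y0] in P and zero on the base, as for [delta]. *)
pose k (t : R) : 'rV[R]_n * Mat := (cmap a (pr u), h0 *m mexp (t *: B)).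
have dLk : differentiable (fun t : R => h0 *m mexp (t *: B)) 0.
  apply: (@differentiable_comp _ _ _ _ (fun t : R => mexp (t *: B) : Mat) Lh).
    exact: dB.
  exact: linear_differentiable.
have DLk : 'D_1 (fun t : R => h0 *m mexp (t *: B)) 0 = 'D_v tau y0.
  rewrite -[LHS]/('D_1 (Lh \o (fun t : R => mexp (t *: B) : Mat)) 0).
  rewrite derive_comp //; last exact: linear_differentiable.
  by rewrite derive_lin // DB /= mulKVmx.
have dk : differentiable k 0 by exact: (@differentiable_pair _ _ _ _ (cst _)).
have k0 : k 0 = (cmap a (pr u), h0) by rewrite /k scale0r mexp0 mulmx1.
have Dk : 'D_1 k 0 = (0, 'D_v tau y0).
  by rewrite /k (@derive_pair _ _ _ _ (cst _)) // derive_cst DLk.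
rewrite -Dk -k0 -derive_comp ?k0 //; apply: near_eq_derive.
have nk : \forall t \near (0 : R), U (cinv a (k t).1) -> Pm (k t).2 ->
    f (untriv (cinv a (k t).1, (k t).2)) = Psi (k t).
  have := differentiable_continuous dk; rewrite /prop_for /continuous_at k0 => ck.
  exact: (ck _ nPsi).
apply: filterS nk => t /= kt.
have Pt := Pmat_mexp t pB.
rewrite -kt ?(cinvK gM aa au) //; last exact: Pmat_mul.
have Ut : U (pr (act u (mexp (t *: B)))) by rewrite pr_act.
by have [_ + _] := t1 _ Ut; rewrite pr_act // t2 // => ->.
Qed.

Lemma smooth_fun_pr u (g : M -> R) : smooth_fun g (pr u) -> smooth_fun (fun w => g (pr w)) u.
Proof. exact: (smooth_fun_comp gT gM bR (pr_smooth u)). Qed.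

(** As the symmetry fixes [x], the covering moves [u] to some [u h]. It preserves omega while its
    base map has differential -1, so [h] must act by -1 on g/p, and [sym_form] lists such [h]. *)
Lemma symmetry_form (s : M -> M) x (phi : automorphism C) u : (0 < n)%N ->
  is_symmetry s x -> covers phi s x -> pr u = x ->
  exists e Z, e * e = 1 /\ afun phi u = act u (sym_mx p q e *m mexp (g1 Z)).
Proof.
move=> n0 [ls sx ds _] [ax cov] ux.
have pru : pr (afun phi u) = pr u by rewrite (nbhs_singleton cov) // ux.
have [h Ph eh] := fiber_transitive (esym pru).
suff [e [Z [ee eZ]]] : exists e Z, e * e = 1 /\ h = sym_mx p q e *m mexp (g1 Z).
  by exists e, Z; rewrite -eZ.
apply: sym_form => // xi.
have gx := gm1_lie_g (R := R) (p := p) (q := q) xi.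
have gAx := Ad_inv_gP Ph gx.
have au : adom phi (pr u) by rewrite ux.
have ss : smooth_at s (pr u).
  by have [U [V [s' [_ _ Ux sU _]]]] := ls; rewrite ux; have [] := sU x Ux.
have [cpr _] := pr_smooth u.
(* At [u h] the two summands correspond to the image of one vector under the covering and under
   right translation. Their projections to the base are opposite, so the sum is vertical and has
   omega in p. *)
have pA : lie_p (gm1 xi + Ad_inv h (gm1 xi)).
  have gs : lie_g (gm1 xi + Ad_inv h (gm1 xi)) by exact: lie_gD.
  rewrite -(omega_invK (act u h) gs).
  apply: vertical_lie_p; first exact: omega_inv_tan.
  move=> g; rewrite pr_act // => sg.
  have sgh : smooth_fun g (pr (act u h)) by rewrite pr_act.
  rewrite omega_invD // act_omega_inv // -eh auto_omega_inv //.
  have sgph : smooth_fun (fun w => g (pr w)) (afun phi u).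
    by apply: smooth_fun_pr; rewrite pru.
  rewrite !pushforwardE //; last by rewrite -eh.
  have td := omega_inv_tan u gx.
  have -> : X (gm1 xi) u ((fun w => g (pr w)) \o (fun w => act w h))
     = X (gm1 xi) u (fun w => g (pr w)).
    by congr (X _ _ _); apply/funext => w; rewrite /= pr_act.
  have -> : X (gm1 xi) u ((fun w => g (pr w)) \o afun phi)
     = X (gm1 xi) u (fun w => (g \o s) (pr w)).
    apply: (tangent_near gT td).
      have nc : \forall w \near u, forall w', pr w' = pr w -> pr (afun phi w') = s (pr w).
        by move: cov; rewrite -ux => cov; exact: (cpr _ cov).
      by apply: filterS nc => w /(_ w erefl) /= ->.
    by apply: smooth_fun_comp => //; exact: auto_smooth.
  have sx' : s (pr u) = pr u by rewrite ux.
  have sgs : smooth_fun (g \o s) (pr u).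
    by apply: smooth_fun_comp => //; rewrite sx'.
  have tp := pushforward_tangent gT gM (pr_smooth u) td.
  have := ds (pushforward pr u (X (gm1 xi) u)).
  rewrite -ux => /(_ tp) /(congr1 (fun d : functional M => d g)).
  rewrite pushforwardE; last by rewrite sx'.
  rewrite !pushforwardE // => e1.
  by rewrite [X in X + _]e1 addNr.
exists (gm1 xi + Ad_inv h (gm1 xi)) => //.
by rewrite gm1N addKr.
Qed.

(** Each argument in g_-1 is multiplied by [lam^-1 * mu] modulo p, and bilinearity gives the
    square. *)
Lemma Om_scalar_act lam mu Z0 b Y h u x y : Pm h ->
  h = mx3 lam Z0 b 0 mu%:M Y 0 0 lam^-1 -> lam != 0 -> O_pq (mu%:M : 'M[R]_n) ->
  Omega (act u h) (gm1 x) (gm1 y)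
  = (lam^-1 * mu) ^+ 2 *: Ad_inv h (Omega u (gm1 x) (gm1 y)).
Proof.
move=> Ph eh l0 oC; have /PmatP[Gh _] := Ph.
have [A pA eA] := Ad_gm1 x Gh eh oC l0; have [B pB eB] := Ad_gm1 y Gh eh oC l0.
have := Om_gm1_act u Ph pA pB eA eB => ->.
rewrite !mul_scalar_mx !scalerA !gm1Z Om_scalel ?Om_scaler //; try exact: gm1_lie_g.
  by rewrite !Ad_invZ scalerA -expr2.
by rewrite -gm1Z; exact: gm1_lie_g.
Qed.

Lemma act_mexp_g1 u Z Z' :
  act (act u (mexp (g1 Z))) (mexp (g1 Z')) = act u (mexp (g1 (Z + Z'))).
Proof.
have := actM u (Pmat_mexp1 Z) (Pmat_mexp1 Z') => ->.
by congr act; exact: mexp_g1_add.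
Qed.

Lemma orbit1_self (u : T) : orbit1 u u.
Proof.
exists 0; first by []; rewrite g1_0.
by rewrite mexp0 act1.
Qed.

Lemma orbit1_act u Z : orbit1 (act u (mexp (g1 Z))) = orbit1 u.
Proof.
apply/seteqP; split=> w [Z' _ <-].
  by exists (Z + Z'); [by []|exact/esym/act_mexp_g1].
exists (Z' - Z); first by [].
by rewrite act_mexp_g1 addrC subrK.
Qed.

Lemma orbit1_pr u w : orbit1 u w -> pr w = pr u.
Proof. by move=> [Z _ <-]; rewrite pr_act //; exact: Pmat_mexp1. Qed.

Lemma orbit1_sym e u : e * e = 1 ->
  (fun w => act w (sym_mx p q e)) @` orbit1 u = orbit1 (act u (sym_mx p q e)).
Proof.
move=> ee; have Pg := Pmat_G0 (sym_mx_G0 p q ee).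
apply/seteqP; split=> [_ [w [Z _ <-] <-]|w [Z _ <-]].
  exists (- Z) => //; rewrite !actM ?mexp_g1_sym //; exact: Pmat_mexp1.
exists (act u (mexp (g1 (- Z)))); first by exists (- Z).
by rewrite !actM ?mexp_g1_sym ?opprK //; exact: Pmat_mexp1.
Qed.

(** Modulo exp(g_1) the covering moves [u] by a symmetry element [g], and equivariance of the Weyl
    structure makes its value on that orbit [u g]. The pullback at [orbit1 u] is thus the preimage
    of [u g], so the hypothesis on the pullback says where [g] is attained. It serves with [Y = 0]
    for one symmetry and with the difference for the other. *)
Lemma auto_weyl (s : M -> M) x (phi : automorphism C) sigma u Y : (0 < n)%N ->
  is_symmetry s x -> covers phi s x -> is_weyl_structure sigma ->
  pr u = x -> sigma (orbit1 u) = u ->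
  pullback_weyl phi sigma (orbit1 u) = act u (mexp (g1 Y)) ->
  exists2 e, e * e = 1 & afun phi (act u (mexp (g1 Y))) = act u (sym_mx p q e).
Proof.
move=> n0 ss cov [w1 w2 _] ux su.
have [e [Z [ee eu]]] := symmetry_form n0 ss cov ux.
have Pg := Pmat_G0 (sym_mx_G0 p q ee).
have au : adom phi (pr u) by rewrite ux; have [] := cov.
have [au' _ _] := afunP au.
have pru : pr (afun phi u) = pr u.
  by rewrite eu pr_act //; apply: Pmat_mul => //; exact: Pmat_mexp1.
rewrite /pullback_weyl.
(* The exp(g_1) factor of the image of [u] disappears in the orbit, leaving only the symmetry
   element. *)
have -> : afun phi @` orbit1 u = orbit1 (act u (sym_mx p q e)).
  rewrite -(orbit1_act (act u (sym_mx p q e)) Z) actM //; last exact: Pmat_mexp1.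
  rewrite -eu; apply/seteqP; split=> [_ [w [Z' _ <-] <-]|w [Z' _ <-]].
    by exists Z' => //; rewrite afun_act //; exact: Pmat_mexp1.
  by exists (act u (mexp (g1 Z'))); [exists Z'|rewrite afun_act //; exact: Pmat_mexp1].
rewrite -orbit1_sym // w2 ?su; last exact: sym_mx_G0.
move=> eY; exists e => //; rewrite -eY.
have [|_ -> //] := @ainvP _ _ _ _ phi (act u (sym_mx p q e)).
by rewrite pr_act // -pru.
Qed.

(** * Consequences at a frame fixed up to a symmetry element *)

Section FixedFrame.
Variables (phi : automorphism C) (e : R) (w : T).
Hypotheses (ee : e * e = 1) (aw : adom phi (pr w)).
Hypothesis (fw : afun phi w = act w (sym_mx p q e)).

Lemma sym_scalar u x y :
  Omega (act u (sym_mx p q e)) (gm1 x) (gm1 y)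
  = Ad_inv (sym_mx p q e) (Omega u (gm1 x) (gm1 y)).
Proof.
have Pg := Pmat_G0 (sym_mx_G0 p q ee).
have e0 : e != 0.
  by apply/eqP => e0; move: ee; rewrite e0 mul0r => /eqP; rewrite eq_sym oner_eq0.
have ie : e^-1 = e by apply: (mulfI e0); rewrite divff.
have oC : O_pq ((- e)%:M : 'M[R]_n).
  by rewrite /O_pq tr_scalar_mx mul_scalar_mx mul_mx_scalar scalerA mulrNN ee scale1r.
have eg : sym_mx p q e = mx3 e 0 0 0 (- e)%:M 0 0 0 e^-1 by rewrite ie.
have := Om_scalar_act u x y Pg eg e0 oC => ->.
by rewrite ie mulrN ee sqrrN expr1n scale1r.
Qed.

Lemma sym_fixed x y : Omega w (gm1 x) (gm1 y) = Ad_inv (sym_mx p q e) (Omega w (gm1 x) (gm1 y)).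
Proof. by rewrite -sym_scalar -fw Om_auto //; exact: gm1_lie_g. Qed.

(** The derivative at [afun phi w] is read in two ways: through the automorphism it equals the one
    at [w], through right translation by the symmetry element it is its opposite. *)
Lemma sym_derivative xi (nf : T -> R) :
  (forall u, smooth_fun nf u) ->
  (forall u, adom phi (pr u) -> nf (afun phi u) = nf u) ->
  (forall u, nf (act u (sym_mx p q e)) = nf u) ->
  X (gm1 xi) w nf = 0.
Proof.
move=> snf nphi ng; have Pg := Pmat_G0 (sym_mx_G0 p q ee).
have gx := gm1_lie_g (R := R) (p := p) (q := q) xi.
have gNx := gm1_lie_g (R := R) (p := p) (q := q) (- xi).
have e1 : X (gm1 xi) (afun phi w) nf = X (gm1 xi) w nf.
  rewrite auto_omega_inv // pushforwardE //.
  apply/esym/(tangent_near gT (omega_inv_tan w gx)) => //.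
  by apply: filterS (near_adom aw) => u au /=; rewrite nphi.
have e2 : X (gm1 xi) (act w (sym_mx p q e)) nf = - X (gm1 xi) w nf.
  have egx : gm1 xi = Ad_inv (sym_mx p q e) (gm1 (- xi)) by rewrite Ad_sym_gm1 // opprK.
  rewrite [in LHS]egx act_omega_invE //.
  have -> : (fun u => nf (act u (sym_mx p q e))) = nf by apply/funext => u.
  by rewrite gm1N -scaleN1r omega_invZ // mulN1r.
move: e1; rewrite fw e2 => /eqP; rewrite eq_sym -addr_eq0 -mulr2n mulrn_eq0 /=.
by move/eqP.
Qed.

End FixedFrame.

End Symmetries.

(** * Comparison of the two distinguished frames over the centre *)

Theorem theorem4p6 (R : realType) (p q : nat) (hpq : (3 <= p + q)%N)
    (C : conformal_geometry R p q) (hC : torsion_free C)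
    (x : base_space C) (s t : base_space C -> base_space C)
    (hs : is_symmetry s x) (ht : is_symmetry t x) (hst : different_at s t x)
    (Upsilon : set (total_space C) -> 'rV[R]_(p + q))
    (hUpsilon : is_difference s t x Upsilon)
    (hlength : nonzero_length_at Upsilon x) :
  curvature_vanishes_at x.
Proof.
have n0 : (0 < p + q)%N by apply: leq_trans hpq.
have [phi [psi [sigma [cphi cpsi wsigma fix_phi diff_psi]]]] := hUpsilon.
have [u ux len] := hlength.
have [w1 w2 _] := wsigma.
(* The frame in the image of [sigma] replaces [u]: it lies in the same orbit, so [Upsilon] has the
   same value there, and [sigma] returns it unchanged. *)
set u0 := sigma (orbit1 u).
have o0 : orbit1 u0 = orbit1 u by exact: w1.
have u0x : pr u0 = x.
  have : orbit1 u u0 by rewrite -o0; exact: orbit1_self.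
  by move/orbit1_pr; rewrite ux.
have su0 : sigma (orbit1 u0) = u0 by rewrite o0.
have m0 : mexp (g1 0) = 1%:M :> 'M[R]_(1 + (p + q + 1)).
  by rewrite g1_0 mexp0.
have aphi : adom phi (pr u0) by rewrite u0x; have [] := cphi.
have [e ee fu0] : exists2 e, e * e = 1 & afun phi u0 = act u0 (sym_mx p q e).
  have [e ee] : exists2 e, e * e = 1 &
      afun phi (act u0 (mexp (g1 0))) = act u0 (sym_mx p q e).
    apply: (auto_weyl n0 hs cphi wsigma u0x su0).
    by rewrite o0 fix_phi // m0 act1.
  by rewrite m0 act1; exists e.
set Y := Upsilon (orbit1 u) in len.
set Z := (1 / 2) *: Y.
pose u1 := act u0 (mexp (g1 Z)).
have PZ V : Pmat (mexp (g1 V) : 'M[R]_(1 + (p + q + 1))) by exact: Pmat_mexp1.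
have u1x : pr u1 = x by rewrite /u1 pr_act.
have apsi : adom psi (pr u1) by rewrite u1x; have [] := cpsi.
have [e' ee' fu1] : exists2 e, e * e = 1 & afun psi u1 = act u1 (sym_mx p q e).
  have [e' ee' fe'] : exists2 e, e * e = 1 &
      afun psi (act u0 (mexp (g1 Y))) = act u0 (sym_mx p q e).
    apply: (auto_weyl n0 ht cpsi wsigma u0x su0).
    rewrite diff_psi ?su0 ?o0 // u0x -u1x //.
  have Pg := Pmat_G0 (sym_mx_G0 p q ee').
  exists e'; first by [].
  (* [psi] is known at [u0 exp(Y)], and [exp(- Z)] leads from there back to [u1] as [Y - Z = Z].
     Hence [psi] maps [u1] to [u0 g exp(- Z) = u0 exp(Z) g = u1 g]. *)
  have e1 : u1 = act (act u0 (mexp (g1 Y))) (mexp (g1 (- Z))).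
    rewrite act_mexp_g1 /u1; congr (act _ (mexp (g1 _))).
    by rewrite /Z -scaleNr -{2}[Y]scale1r -scalerDl; congr (_ *: _); field.
  have aY : adom psi (pr (act u0 (mexp (g1 Y)))).
    by rewrite (pr_act u0 (PZ Y)) u0x -u1x.
  rewrite {1}e1 (afun_act aY (PZ (- Z))) fe'.
  rewrite (actM u0 Pg (PZ (- Z))) /u1 (actM u0 (PZ Z) Pg).
  by rewrite mexp_g1_sym.
(* Every frame over [x] is [u0 h] with [h] in P, and the curvature there is a conjugate of the one
   at [u0] for transformed arguments. *)
suff N0 x1 y1 : Om u0 (gm1 x1) (gm1 y1) = 0.
  move=> w wx x1 y1; rewrite kappaE.
  have [h Ph ->] := fiber_transitive (etrans u0x (esym wx)).
  have Ph' := Pmat_inv Ph.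
  have [x' [A [pA eA]]] := lie_g_split (Ad_inv_gP Ph' (gm1_lie_g x1)).
  have [y' [B [pB eB]]] := lie_g_split (Ad_inv_gP Ph' (gm1_lie_g y1)).
  by rewrite (Om_gm1_act u0 Ph pA pB eA eB) N0 /Ad_inv mulmx0 mul0mx oppr0.
have Np (w : total_space C) : lie_p (Om w (gm1 x1) (gm1 y1)).
  (* [Om] is minus [kappa]; it is obtained as [-2 kappa + kappa], the shape of linear combination
     that [lie_p_lin] accepts. *)
  have pk := hC w x1 y1; have := lie_p_lin (-2%:R) pk pk.
  by rewrite kappaE scalerN scaleNr opprK scaler_nat mulr2n addrK.
have z0 : (Z *m Jpq R p q *m Z^T) 0 0 != 0.
  have -> : Z *m Jpq R p q *m Z^T = (1 / 2 * (1 / 2)) *: (Y *m Jpq R p q *m Y^T).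
    by rewrite /Z linearZ /= -!scalemxAl -scalemxAr scalerA.
  move: len; move: (Y *m _ *m _) => K K0.
  rewrite mxE; apply: mulf_neq0; first by apply: mulf_neq0; rewrite mul1r invr_eq0 pnatr_eq0.
  apply: contra K0 => /eqP K0; apply/eqP/matrixP => i j.
  by rewrite !ord1 K0 mxE.
have diag0 i j : @diag_pos R p q i j -> Om u0 (gm1 x1) (gm1 y1) i j = 0.
  move=> dij; pose nf (w : total_space C) : R := Om w (gm1 x1) (gm1 y1) i j.
  have snf w : smooth_fun nf w by apply: Om_smooth; exact: gm1_lie_g.
  (* One rule for all elements of P with scalar O(p,q) part. It covers exp(g_1) with factor 1 and
     the flow of the grading element, where [lam = expR r] and [mu = 1]. Membership of [Om] in p is
     used here, through [same_diag]. *)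
  have nscale lam mu Z0 b Y0 h w : Pmat h -> h = @mx3 R p q lam Z0 b 0 mu%:M Y0 0 0 lam^-1 ->
      lam != 0 -> mu != 0 -> O_pq (mu%:M : 'M[R]_(p + q)) ->
      nf (act w h) = (lam^-1 * mu) ^+ 2 * nf w.
    move=> Ph eh l0 mu0 oC; rewrite /nf (Om_scalar_act w x1 y1 Ph eh l0 oC) mxE.
    have [a [A [V [oA ->]]]] := Np w.
    by have [V' ->] := same_diag a V Ph eh l0 mu0 oA; rewrite (dij a A V' V).
  have O1 : O_pq (1%:M : 'M[R]_(p + q)) by rewrite /O_pq trmx1 mul1mx mulmx1.
  have nexp w V : nf (act w (mexp (g1 V))) = nf w.
    have eV : mexp (g1 V) = @mx3 R p q 1 V (- ((V *m Jpq R p q *m V^T) 0 0 / 2)) 0 1%:M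
        (- (Jpq R p q *m V^T)) 0 0 1^-1 :> 'M[R]_(1 + (p + q + 1)).
      by rewrite mexp_g1 invr1.
    by rewrite (nscale _ _ _ _ _ _ w (PZ V) eV) ?oner_eq0 // invr1 mul1r expr1n mul1r.
  have nsym d w : d * d = 1 -> nf (act w (sym_mx p q d)) = nf w.
    move=> dd; rewrite /nf sym_scalar //.
    have [a [A [V [oA ->]]]] := Np w.
    by rewrite Ad_sym_p // (dij a A (- V) V).
  have nauto (chi : automorphism C) w : adom chi (pr w) -> nf (afun chi w) = nf w.
    by move=> aw; rewrite /nf Om_auto //; exact: gm1_lie_g.
  set xi := Jpq R p q *m Z^T.
  have gxi := gm1_lie_g (R := R) (p := p) (q := q) xi.
  have D0 : omega_inv (gm1 xi) u0 nf = 0.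
    exact: (sym_derivative ee aphi fu0 xi snf (nauto phi) (fun w => nsym e w ee)).
  have D1 : omega_inv (gm1 xi) u1 nf = 0.
    exact: (sym_derivative ee' apsi fu1 xi snf (nauto psi) (fun w => nsym e' w ee')).
  have Dg1 V : omega_inv (g1 V) u0 nf = 0.
    rewrite omega_inv_pE //; last exact: g1_lie_p.
    rewrite (_ : (fun _ => _) = cst (nf u0)) ?derive_cst //; apply/funext => r.
    by rewrite g1Z; exact: nexp.
  have Dgr : omega_inv (grading R p q) u0 nf = - (nf u0 + nf u0).
    rewrite omega_inv_pE //; last exact: grading_lie_p.
    rewrite (_ : (fun _ => _) = (fun r : R => expR (- r) * expR (- r) * nf u0)); last first.
      apply/funext => r; have Pr := Pmat_mexp r (grading_lie_p R p q).
      rewrite (nscale _ _ _ _ _ _ u0 Pr (mexp_grading p q r)) ?oner_eq0 //.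
        by rewrite mulr1 expr2 expRN.
      by rewrite gt_eqF // expR_gt0.
    have [_ ->] // : is_derive (0 : R) (1 : R)
      (fun r : R => expR (- r) * expR (- r) * nf u0) (- (nf u0 + nf u0)).
    apply: trigger_derive; rewrite /GRing.scale /= oppr0 expR0; ring.
  (* Since [nf] is invariant under [exp Z], its derivative at [u1] along [xi] equals the one at [u0]
     along Ad(exp Z) xi. The [xi] and g_1 terms vanish, so the grading term [- 2 z nf(u0)] is zero,
     where [z] is the square length of [Z]. *)
  have := D1; rewrite /u1 -{1}(Ad_invK (gm1 xi) (Pmat_unit (PZ Z))).
  have gA : lie_g (Ad_inv (invmx (mexp (g1 Z))) (gm1 xi)).
    by apply: Ad_inv_gP => //; exact: Pmat_inv.
  rewrite act_omega_invE //.
  rewrite (_ : (fun w => nf (act w (mexp (g1 Z)))) = nf); last by apply/funext.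
  rewrite (Ad_mexp_g1 erefl).
  have ggr := lie_p_g (grading_lie_p R p q).
  have gg1 V := lie_p_g (@g1_lie_p R p q V).
  rewrite omega_invD //; last exact: lie_g_lin.
  rewrite D0 add0r omega_inv_lin // Dg1 addr0 Dgr => /eqP.
  rewrite mulf_eq0 (negbTE z0) /= oppr_eq0 -mulr2n mulrn_eq0 /=.
  by move/eqP.
have [W eW] := diag_zero (Np u0) diag0.
have := sym_fixed ee aphi fu0 x1 y1; rewrite eW.
rewrite {2}/g1 Ad_sym_p // => /mx3_inj[[_ WW _] _].
have W0 : W = 0.
  by move/eqP: WW; rewrite -addr_eq0 -mulr2n -scaler_nat scaler_eq0 pnatr_eq0 /= => /eqP.
by rewrite W0 g1_0.
Qed.
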